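(* Let $t\ge 2$ be an integer. There is a polynomial-time $(2t-1)$-approximation algorithm for Priority $k$-Center with Outliers restricted to instances in which the radius function takes exactly $t$ distinct values.
   Context: Priority $k$-Center with Outliers: the input is a finite metric space $(X,d)$, a radius function $r:X\to\mathbb{R}_{>0}$, and integers $k,m$. The goal is to find $S\subseteq X$ with $|S|\le k$ minimizing $\alpha$ such that at least $m$ points $v\in X$ satisfy $d(v,S)\le \alpha\cdot r(v)$, where $d(v,S)=\min_{s\in S}d(v,s)$. A $\rho$-approximation algorithm outputs a feasible $S$ achieving value at most $\rho$ times the optimum value of $\alpha$. *)

(* Defs.v *)
From HB Require Import structures.
From mathcomp Require Import all_boot all_order all_algebra.
From mathcomp Require Import constructive_ereal.
Set Implicit Arguments.
Unset Strict Implicit.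
Unset Printing Implicit Defensive.
Import Order.TTheory GRing.Theory Num.Theory.
Local Open Scope ring_scope.

(* The data are rational so that an instance is a finite object that can be
   given to an algorithm. *)
Record instance := Instance {
  npts : nat;
  dist : 'I_npts -> 'I_npts -> rat;
  rad : 'I_npts -> rat;
  ncenters : nat; (* k *)
  ncovered : nat; (* m *)
  dist_ge0 : forall u v, 0 <= dist u v;
  dist_eq0 : forall u v, dist u v = 0 <-> u = v;
  dist_sym : forall u v, dist u v = dist v u;
  dist_triangle : forall u v w, dist u w <= dist u v + dist v w;
  rad_gt0 : forall v, 0 < rad v }.

(* The minimum over the empty set is +oo. *)
Definition set_dist (I : instance) (v : 'I_(npts I)) (S : {set 'I_(npts I)}) :
    \bar rat :=
  \big[Order.min/+oo%E]_(s in S) (dist v s)%:E.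

Definition covered (I : instance) (S : {set 'I_(npts I)}) (alpha : rat) :
    {set 'I_(npts I)} :=
  [set v | (set_dist v S <= (alpha * rad v)%:E)%E].

(* The constraint [0 <= alpha] only matters if [ncovered I = 0], where there
   would otherwise be no minimum. *)
Definition achieves (I : instance) (S : {set 'I_(npts I)}) (alpha : rat) : Prop :=
  0 <= alpha /\ (ncovered I <= #|covered S alpha|)%N.

Definition feasible_value (I : instance) (alpha : rat) : Prop :=
  exists S : {set 'I_(npts I)}, (#|S| <= ncenters I)%N /\ achieves S alpha.

Definition optimum (I : instance) (opt : rat) : Prop :=
  feasible_value I opt /\ forall alpha, feasible_value I alpha -> opt <= alpha.

(* If the instance is infeasible then it has no optimum, and only the bound on
   the number of centers is required. *)
Definition approx_solution (rho : rat) (I : instance) (S : {set 'I_(npts I)}) :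
    Prop :=
  (#|S| <= ncenters I)%N /\
  forall opt, optimum I opt ->
    exists alpha, achieves S alpha /\ alpha <= rho * opt.

Definition num_radii (I : instance) : nat := size (undup (codom (@rad I))).

(* Random access machine with the logarithmic cost criterion (Aho, Hopcroft
   and Ullman), with structured control flow.  The memory cells hold integers
   of arbitrary size, and evaluating an expression costs the total number of
   bits of its value and of all its intermediate values, including addresses.
   Running times agree with those of Turing machines up to a polynomial. *)

Definition bitlen (z : int) : nat := (trunc_log 2 `|z|).+1.

Definition memory := nat -> int.

Inductive expr :=
| Cst of int
| Read of expr
| Add of expr & expr
| Sub of expr & expr
| Mul of expr & expr
| Div of expr & expr
| Mod of expr & expr
| Leq of expr & expr.

Fixpoint eval (mu : memory) (e : expr) : int :=
  match e with
  | Cst c => c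
  | Read a => mu `|eval mu a|%N
  | Add e1 e2 => eval mu e1 + eval mu e2
  | Sub e1 e2 => eval mu e1 - eval mu e2
  | Mul e1 e2 => eval mu e1 * eval mu e2
  | Div e1 e2 => (eval mu e1 %/ eval mu e2)%Z
  | Mod e1 e2 => (eval mu e1 %% eval mu e2)%Z
  | Leq e1 e2 => if eval mu e1 <= eval mu e2 then 1 else 0
  end.

Fixpoint ecost (mu : memory) (e : expr) : nat :=
  (bitlen (eval mu e) +
   match e with
   | Cst _ => 0
   | Read a => ecost mu a
   | Add e1 e2 | Sub e1 e2 | Mul e1 e2 | Div e1 e2 | Mod e1 e2 | Leq e1 e2 =>
       ecost mu e1 + ecost mu e2
   end)%N.

Inductive program :=
| Skip
| Write of expr & expr
| Seq of program & program
| If of expr & program & program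
| While of expr & program.

Definition update (mu : memory) (a : nat) (z : int) : memory :=
  fun b => if b == a then z else mu b.

(* [exec c mu T mu']: started in [mu], the program [c] halts in [mu'] after
   time [T]. *)
Inductive exec : program -> memory -> nat -> memory -> Prop :=
| ExecSkip mu : exec Skip mu 1 mu
| ExecWrite a e mu :
    exec (Write a e) mu (ecost mu a + ecost mu e)%N
      (update mu `|eval mu a|%N (eval mu e))
| ExecSeq c1 c2 mu T1 mu1 T2 mu2 :
    exec c1 mu T1 mu1 -> exec c2 mu1 T2 mu2 ->
    exec (Seq c1 c2) mu (T1 + T2)%N mu2
| ExecIfTrue e c1 c2 mu T mu' :
    eval mu e != 0 -> exec c1 mu T mu' ->
    exec (If e c1 c2) mu (ecost mu e + T)%N mu'
| ExecIfFalse e c1 c2 mu T mu' :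
    eval mu e = 0 -> exec c2 mu T mu' ->
    exec (If e c1 c2) mu (ecost mu e + T)%N mu'
| ExecWhileTrue e c mu T1 mu1 T2 mu2 :
    eval mu e != 0 -> exec c mu T1 mu1 -> exec (While e c) mu1 T2 mu2 ->
    exec (While e c) mu (ecost mu e + T1 + T2)%N mu2
| ExecWhileFalse e c mu :
    eval mu e = 0 -> exec (While e c) mu (ecost mu e) mu.

Definition encode_rat (q : rat) : seq int := [:: numq q; denq q].

Definition encode (I : instance) : seq int :=
  [:: (npts I)%:Z; (ncenters I)%:Z; (ncovered I)%:Z]
  ++ flatten [seq encode_rat (rad v) | v <- enum 'I_(npts I)]
  ++ flatten [seq encode_rat (dist u v) | u <- enum 'I_(npts I),
                                          v <- enum 'I_(npts I)].

Definition input_size (I : instance) : nat := \sum_(z <- encode I) bitlen z.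

(* The input occupies the first memory cells; all other cells contain 0. *)
Definition initial (I : instance) : memory := fun a => nth 0 (encode I) a.

(* The nonzero cells among the first [npts I] ones are the selected centers. *)
Definition output (I : instance) (mu : memory) : {set 'I_(npts I)} :=
  [set v | mu (val v) != 0].

Definition polytime_approx (rho : rat) (P : instance -> Prop) (c : program) :
    Prop :=
  exists p : {poly nat}, forall I : instance, P I ->
    exists T mu, [/\ exec c (initial I) T mu,
                     (T <= p.[input_size I])%N
                   & approx_solution rho (output I mu)].

(* Main.v *)
(* Fix a guess alpha for the dilation; the optimum is one of the finitely many
   values d(u, v) / r(v).  Say that u covers v if d(u, v) <= alpha r(v).

   If k centers cover m points, then a perceptron on the constraints of the
   natural linear program finds, with integral multipliers and in polynomially
   many steps, a fractional choice x of k centers that covers more than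
   m - 1 / (2n + 1) points fractionally.  Points of equal radius are clustered
   greedily by decreasing coverage around representatives with disjoint balls,
   so that every center covers at most one representative of each radius, and
   these, by decreasing radius, form a path in the contact graph, whose edges
   join points of different radii that are covered by a common center.  Hence x
   is a fractional packing of k paths.  Integral packings are assignments of
   every vertex to its successor, a source or a sink, and an auction with
   increment 1 and benefits scaled by 2n + 1 finds an integral packing that is
   at least as good, since the final prices are a dual solution that bounds x.

   Each path v_1, ..., v_l gets one center covering both v_(l-1) and v_l.  The
   center is within r(v_1) + 2 r(v_2) + ... + 2 r(v_(l-1)) <= (2t - 3) r(v_1) times
   alpha of v_1, and the points of the cluster of v_1 are within
   2 alpha r(v_1) of v_1, which gives the ratio 2t - 1.

   The algorithm is a program of a language with arrays and polynomially bounded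
   loops in which every expression that is stored is built from sums,
   differences, comparisons and the like, but not from products; then each step
   adds only a constant number of bits to the numbers, so that a polynomial
   bound on the number of steps bounds the logarithmic cost. *)

Require Import Defs.
From mathcomp Require Import all_boot all_order all_algebra.
From mathcomp Require Import constructive_ereal.
From mathcomp Require Import zify ring.
Set Implicit Arguments.
Unset Strict Implicit.
Unset Printing Implicit Defensive.
Import Defs Order.TTheory GRing.Theory Num.Theory.
Local Open Scope ring_scope.

(** The accuracy [1 / (2n + 1)] comes from integrality. The fractional solution falls short of [m]
    by less than [1 / (2n + 1)], and the auction, with [2n] persons, increment 1 and benefits scaled
    by [2n + 1], loses at most [2n / (2n + 1)]. The total is less than 1, so the integral packing
    has value at least [m].

    The perceptron and the auction are chosen because their updates only add, subtract and compare,
    as the restriction on stored expressions demands; both run for a number of rounds that depends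
    on [n] alone.

    At a guess that admits no solution, nothing is claimed about what the loops compute. Therefore
    every candidate is tested before it is stored, and only the feasible guesses are shown to pass
    the test. The guess that is kept is then at most the optimum. *)

(** * Bit lengths and the logarithmic cost of runs *)

Lemma bitlen_le (z : int) (b : nat) :
  (0 < b)%N -> (bitlen z <= b)%N = (`|z| < 2 ^ b)%N.
Proof.
move=> b0; apply/idP/idP => [zb|zb].
  by apply: (leq_trans (trunc_log_ltn _ (leqnn 2))); rewrite leq_pexp2l.
rewrite /bitlen; have [->|z0] := posnP `|z|%N; first by rewrite trunc_log0.
rewrite -(@ltn_exp2l 2) //; apply: leq_ltn_trans zb.
exact: trunc_logP.
Qed.

Lemma absz_bitlen (z : int) : (`|z| < 2 ^ bitlen z)%N.
Proof. by rewrite -bitlen_le. Qed.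

Lemma bitlenD (x y : int) :
  (bitlen (x + y) <= (maxn (bitlen x) (bitlen y)).+1)%N.
Proof.
rewrite bitlen_le // expnS.
have hx : (`|x| < 2 ^ maxn (bitlen x) (bitlen y))%N by rewrite -bitlen_le ?leq_max ?leqnn.
have hy : (`|y| < 2 ^ maxn (bitlen x) (bitlen y))%N
  by rewrite -bitlen_le ?leq_max ?leqnn ?orbT.
lia.
Qed.

Lemma bitlenN (x : int) : bitlen (- x) = bitlen x.
Proof. by rewrite /bitlen abszN. Qed.

Lemma bitlenM (x y : int) : (bitlen (x * y) <= bitlen x + bitlen y)%N.
Proof. by rewrite bitlen_le ?addn_gt0 // abszM expnD ltn_mul ?absz_bitlen. Qed.

Lemma leq_bitlen (x y : int) : (`|x| <= `|y|)%N -> (bitlen x <= bitlen y)%N.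
Proof. by move=> xy; rewrite bitlen_le // (leq_ltn_trans xy) ?absz_bitlen. Qed.

Lemma bitlen_div (x y : int) : (bitlen (x %/ y)%Z <= bitlen x)%N.
Proof. exact/leq_bitlen/lez_div. Qed.

Lemma bitlen_mod (x y : int) :
  (bitlen (x %% y)%Z <= maxn (bitlen x) (bitlen y))%N.
Proof.
rewrite leq_max; have [->|y0] := eqVneq y 0; first by rewrite modz0 leqnn.
apply/orP; right; apply: leq_bitlen.
by have := modz_ge0 x y0; have := ltz_mod x y0; lia.
Qed.

Lemma bitlen_bool (b : bool) : bitlen (if b then 1 else 0 : int) = 1%N.
Proof. by case: b; rewrite /bitlen ?trunc_log0 ?trunc_log1. Qed.

Fixpoint expr_size (e : expr) : nat :=
  match e with
  | Cst c => bitlen c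
  | Read a => (expr_size a).+1
  | Add e1 e2 | Sub e1 e2 | Mul e1 e2 | Div e1 e2 | Mod e1 e2 | Leq e1 e2 =>
      (expr_size e1 + expr_size e2).+1
  end.

(* Multiplication by a truth value does not lengthen a number. *)
Fixpoint additive (e : expr) : bool :=
  match e with
  | Cst _ | Read _ | Leq _ _ => true
  | Add e1 e2 | Sub e1 e2 | Div e1 e2 | Mod e1 e2 => additive e1 && additive e2
  | Mul (Leq _ _) e2 => additive e2
  | Mul _ _ => false
  end.

Definition bounded (L : nat) (mu : memory) := forall a, (bitlen (mu a) <= L)%N.

Lemma bitlen_eval L mu e :
  bounded L mu -> (bitlen (eval mu e) <= expr_size e * L.+1)%N.
Proof.
move=> muL; elim: e => /= [c|e _|e1 h1 e2 h2|e1 h1 e2 h2|e1 h1 e2 h2|e1 h1 e2 h2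
  |e1 h1 e2 h2|e1 h1 e2 h2].
- exact: leq_pmulr.
- by apply: leq_trans (muL _) _; nia.
- by apply: leq_trans (bitlenD _ _) _; lia.
- by apply: leq_trans (bitlenD _ _) _; rewrite bitlenN; lia.
- by apply: leq_trans (bitlenM _ _) _; lia.
- by apply: leq_trans (bitlen_div _ _) _; lia.
- by apply: leq_trans (bitlen_mod _ _) _; lia.
- by rewrite bitlen_bool; lia.
Qed.

Lemma ecost_le L mu e :
  bounded L mu -> (ecost mu e <= expr_size e ^ 2 * L.+1)%N.
Proof.
move=> muL.
have bin e1 e2 (b : nat) : (ecost mu e1 <= expr_size e1 ^ 2 * L.+1)%N ->
    (ecost mu e2 <= expr_size e2 ^ 2 * L.+1)%N ->
    (b <= (expr_size e1 + expr_size e2).+1 * L.+1)%N ->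
    (b + (ecost mu e1 + ecost mu e2)
       <= (expr_size e1 + expr_size e2).+1 ^ 2 * L.+1)%N.
  by move=> h1 h2 hb; rewrite !expnS !expn0 !muln1 in h1 h2 *; nia.
elim: e => [c|e he|e1 h1 e2 h2|e1 h1 e2 h2|e1 h1 e2 h2|e1 h1 e2 h2
  |e1 h1 e2 h2|e1 h1 e2 h2].
- by rewrite /= addn0; have : (0 < bitlen c)%N by []; nia.
- have := bitlen_eval (Read e) muL; move: he.
  by rewrite /= !expnS !expn0 !muln1; nia.
- exact: bin h1 h2 (bitlen_eval (Add e1 e2) muL).
- exact: bin h1 h2 (bitlen_eval (Sub e1 e2) muL).
- exact: bin h1 h2 (bitlen_eval (Mul e1 e2) muL).
- exact: bin h1 h2 (bitlen_eval (Div e1 e2) muL).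
- exact: bin h1 h2 (bitlen_eval (Mod e1 e2) muL).
- exact: bin h1 h2 (bitlen_eval (Leq e1 e2) muL).
Qed.

(** [bitlen_eval] multiplies the length by a constant and would become exponential when iterated.
    Stored values need this additive bound; addresses and tests are not stored, so [bitlen_eval] is
    enough for their cost. *)
Lemma bitlen_additive L mu e :
  bounded L mu -> additive e -> (bitlen (eval mu e) <= L + expr_size e)%N.
Proof.
move=> muL; elim: e => [c|e _|e1 h1 e2 h2|e1 h1 e2 h2|e1 h1 e2 h2|e1 h1 e2 h2
  |e1 h1 e2 h2|e1 h1 e2 h2].
- by rewrite leq_addl.
- by move=> _; apply: leq_trans (muL _) _; rewrite leq_addr.
- move=> /= /andP[a1 a2]; apply: leq_trans (bitlenD _ _) _.
  by have := h1 a1; have := h2 a2; lia.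
- move=> /= /andP[a1 a2]; apply: leq_trans (bitlenD _ _) _.
  by have := h1 a1; have := h2 a2; rewrite bitlenN; lia.
- case: e1 h1 => //= f1 f2 _ a2.
  have := h2 a2; case: ifP => _; rewrite ?mul1r ?mul0r; first by lia.
  by rewrite /(bitlen 0) trunc_log0; lia.
- move=> /= /andP[a1 a2]; apply: leq_trans (bitlen_div _ _) _.
  by have := h1 a1; lia.
- move=> /= /andP[a1 a2]; apply: leq_trans (bitlen_mod _ _) _.
  by have := h1 a1; have := h2 a2; lia.
- by rewrite /= bitlen_bool; lia.
Qed.

(* Along [st] writes of additive expressions the cells grow by at most [K] bits
   each time, so that the logarithmic cost stays polynomial in the unit cost. *)
Definition cost_bound (K L st : nat) : nat := (st * (K ^ 2 * (L + K * st).+1))%N.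

Definition timed (K : nat) (c : program) (mu : memory) (st : nat) (mu' : memory) :=
  forall L, bounded L mu -> bounded (L + K * st) mu' /\
    exists2 T, exec c mu T mu' & (T <= cost_bound K L st)%N.

(** The second run starts with cells that are already longer by [K * st1]; this inequality is what
    lets timed runs be chained. *)
Lemma cost_boundD K L st1 st2 :
  (cost_bound K L st1 + cost_bound K (L + K * st1) st2
     <= cost_bound K L (st1 + st2))%N.
Proof.
rewrite /cost_bound -addnA -mulnDr mulnDl leq_add2r leq_mul2l leq_mul2l ltnS.
by apply/orP; right; apply/orP; right; nia.
Qed.

Lemma leq_cost_bound K L st1 st2 :
  (st1 <= st2)%N -> (cost_bound K L st1 <= cost_bound K L st2)%N.
Proof.
by move=> h; rewrite leq_mul ?leq_mul // ltnS leq_add2l leq_mul.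
Qed.

Lemma timed_weaken K c mu st st' mu' :
  (st <= st')%N -> timed K c mu st mu' -> timed K c mu st' mu'.
Proof.
move=> h H L /H[b [T e t]]; split.
  by move=> a; apply: leq_trans (b a) _; rewrite leq_add2l leq_mul.
by exists T => //; apply: leq_trans t (leq_cost_bound _ _ h).
Qed.

Lemma timed_skip K mu : (0 < K)%N -> timed K Skip mu 1 mu.
Proof.
move=> K0 L b; split; first by move=> a; apply: leq_trans (b a) (leq_addr _ _).
by exists 1%N; [exact: ExecSkip | rewrite /cost_bound; nia].
Qed.

Lemma ecost_cost_bound K L mu e :
  bounded L mu -> (expr_size e <= K)%N -> (ecost mu e <= cost_bound K L 1)%N.
Proof.
move=> b h; apply: leq_trans (ecost_le e b) _.
by rewrite /cost_bound mul1n leq_mul ?leq_exp2r // muln1 ltnS leq_addr.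
Qed.

Lemma timed_write K mu a e :
  (expr_size a <= K)%N -> (expr_size e <= K)%N -> additive e ->
  timed K (Write a e) mu 2 (update mu `|eval mu a|%N (eval mu e)).
Proof.
move=> ha he ade L b; split.
  move=> i; rewrite /update; case: ifP => _.
    by apply: leq_trans (bitlen_additive b ade) _; nia.
  exact: leq_trans (b i) (leq_addr _ _).
exists (ecost mu a + ecost mu e)%N; first exact: ExecWrite.
have := cost_boundD K L 1 1; apply: leq_trans.
apply: leq_add; first exact: ecost_cost_bound.
apply: leq_trans (ecost_cost_bound b he) _.
by rewrite /cost_bound leq_mul // leq_mul // ltnS leq_add2r leq_addr.
Qed.

Lemma timed_seq K c1 c2 mu mu1 mu2 st1 st2 :
  timed K c1 mu st1 mu1 -> timed K c2 mu1 st2 mu2 ->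
  timed K (Seq c1 c2) mu (st1 + st2) mu2.
Proof.
move=> H1 H2 L /H1[/H2[b2 [T2 e2 t2]] [T1 e1 t1]]; split.
  by rewrite mulnDr addnA.
exists (T1 + T2)%N; first exact: ExecSeq e1 e2.
exact: leq_trans (leq_add t1 t2) (cost_boundD _ _ _ _).
Qed.

(** Evaluating a test leaves the memory unchanged and counts as one step; conditionals and loops
    share this argument. *)
Lemma timed_test K mu mu' e st c c' :
  (expr_size e <= K)%N ->
  timed K c mu st mu' ->
  (forall T, exec c mu T mu' -> exec c' mu (ecost mu e + T) mu') ->
  timed K c' mu st.+1 mu'.
Proof.
move=> he H cc' L b; have [b' [T ex t]] := H L b; split.
  by move=> a; apply: leq_trans (b' a) _; nia.
exists (ecost mu e + T)%N; first exact: cc'.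
apply: leq_trans (cost_boundD K L 1 st).
apply: leq_add; first exact: ecost_cost_bound.
apply: leq_trans t _.
by rewrite /cost_bound leq_mul // leq_mul // ltnS leq_add2r leq_addr.
Qed.

Lemma timed_if K e c1 c2 mu mu' st :
  (expr_size e <= K)%N ->
  timed K (if eval mu e != 0 then c1 else c2) mu st mu' ->
  timed K (If e c1 c2) mu st.+1 mu'.
Proof.
move=> he H; apply: timed_test he H _ => T.
case: (eqVneq (eval mu e) 0) => /= [e0|e0] ex.
  exact: ExecIfFalse.
exact: ExecIfTrue.
Qed.

Lemma timed_while K (I : nat -> memory -> Prop) N e c mu st :
  (expr_size e <= K)%N ->
  (forall i mu1, (i < N)%N -> I i mu1 -> eval mu1 e != 0 /\
     exists2 mu2, timed K c mu1 st mu2 & I i.+1 mu2) ->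
  (forall mu1, I N mu1 -> eval mu1 e = 0) ->
  I 0%N mu ->
  exists2 mu', timed K (While e c) mu (N * st.+1).+1 mu' & I N mu'.
Proof.
move=> he step stop I0.
(* A loop unrolls from its first iteration, so the induction is on the number of iterations that
   remain. *)
suff H j mu1 : (j <= N)%N -> I (N - j)%N mu1 ->
    exists2 mu', timed K (While e c) mu1 (j * st.+1).+1 mu' & I N mu'.
  by apply: H => //; rewrite subnn.
elim: j mu1 => [|j IH] mu1 jN I1.
  rewrite subn0 in I1; exists mu1 => // L b; split.
    by move=> a; apply: leq_trans (b a) (leq_addr _ _).
  exists (ecost mu1 e); last exact: ecost_cost_bound.
  exact/ExecWhileFalse/stop.
have [|e1 [mu2 t2 I2]] := step _ _ _ I1; first by lia.
have [|mu3 t3 I3] := IH mu2 (ltnW jN).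
  by rewrite (_ : (N - j = (N - j.+1).+1)%N) //; lia.
exists mu3 => //; rewrite mulSn addSn -addnS.
apply: timed_test he (timed_seq t2 t3) _ => T ex; inversion ex; subst.
by rewrite addnA; apply: ExecWhileTrue e1 _ _; eassumption.
Qed.

(** * A language with arrays and bounded loops *)

Inductive binop := OAdd | OSub | OMul | ODiv | OMod | OLeq.

Definition op_sem (o : binop) (x y : int) : int :=
  match o with
  | OAdd => x + y
  | OSub => x - y
  | OMul => x * y
  | ODiv => (x %/ y)%Z
  | OMod => (x %% y)%Z
  | OLeq => if x <= y then 1 else 0
  end.

Definition op_code (o : binop) : expr -> expr -> expr :=
  match o with
  | OAdd => Add | OSub => Sub | OMul => Mul
  | ODiv => Div | OMod => Mod | OLeq => Leq
  end.

Inductive aexp :=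
| Lit of int
| Inp of aexp
| Arr of nat & aexp
| Bin of binop & aexp & aexp.

(* [CFor x c d b] runs [b] for [x] from [0] to [c * n ^ d - 1], where [n] is
   the first input cell. *)
Inductive cmd :=
| CSkip
| CSet of nat & aexp & aexp
| CSeq of cmd & cmd
| CIf of aexp & cmd & cmd
| CFor of nat & nat & nat & cmd.

(* [s a i] is the content of cell [i] of the infinite array [a]; scalar
   variables are the cells [0]. *)
Definition state := nat -> nat -> int.

Definition upd (s : state) (a i : nat) (z : int) : state :=
  fun a' i' => if (a' == a) && (i' == i) then z else s a' i'.

Definition input_end (n : nat) : nat := (3 + 2 * (n + n * n))%N.

(** Input addresses are reduced modulo the length of the input, so that [Inp] never reads a cell
    that belongs to an array. *)
Fixpoint ev (inp : nat -> int) (s : state) (e : aexp) : int :=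
  match e with
  | Lit z => z
  | Inp e => inp `|(ev inp s e %% (input_end `|inp 0%N|)%:Z)%Z|%N
  | Arr a e => s a `|ev inp s e|%N
  | Bin o e1 e2 => op_sem o (ev inp s e1) (ev inp s e2)
  end.

(** The counter is set to [i.+1] and not incremented; the compiled increment agrees with this
    because [wf] forbids bodies that write [x]. *)
Definition forloop (x N : nat) (f : state -> state) (s : state) : state :=
  iteri N (fun i s => upd (f s) x 0 i.+1%:Z) (upd s x 0 0).

Fixpoint den (inp : nat -> int) (c : cmd) (s : state) : state :=
  match c with
  | CSkip => s
  | CSet a i e => upd s a `|ev inp s i|%N (ev inp s e)
  | CSeq c1 c2 => den inp c2 (den inp c1 s)
  | CIf e c1 c2 => if ev inp s e != 0 then den inp c1 s else den inp c2 s
  | CFor x c d b => forloop x (c * `|inp 0%N| ^ d)%N (den inp b) s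
  end.

Fixpoint writes (c : cmd) : seq nat :=
  match c with
  | CSkip => [::]
  | CSet a _ _ => [:: a]
  | CSeq c1 c2 | CIf _ c1 c2 => writes c1 ++ writes c2
  | CFor x _ _ b => x :: writes b
  end.

Lemma upd_neq s a i z a' : a' != a -> upd s a i z a' = s a'.
Proof. by rewrite /upd => /negbTE->. Qed.

Lemma upd_eq s a i z : upd s a i z a i = z.
Proof. by rewrite /upd !eqxx. Qed.

Lemma den_frame inp c s a : a \notin writes c -> den inp c s a = s a.
Proof.
elim: c s => //= [b i e|c1 h1 c2 h2|e c1 h1 c2 h2|x k d b h] s.
- by rewrite inE => ?; rewrite upd_neq.
- by rewrite mem_cat negb_or => /andP[a1 a2]; rewrite h2 // h1.
- by rewrite mem_cat negb_or => /andP[a1 a2]; case: ifP => _; rewrite ?h1 ?h2.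
- rewrite inE negb_or => /andP[ax ab]; rewrite /forloop.
  elim: (_ * _)%N => [|N IH] /=; first by rewrite upd_neq.
  by rewrite upd_neq // h.
Qed.

(** * Compilation to the random access machine *)

Definition size_expr : expr := Read (Cst 0).

Definition input_end_expr : expr :=
  Add (Cst 3) (Mul (Cst 2) (Add size_expr (Mul size_expr size_expr))).

(* Array [a < A] occupies the cells [input_end + a + A * i ^ 2]; squaring the
   index makes negative indices harmless. *)
Definition cell (A a : nat) (e : expr) : expr :=
  Add input_end_expr (Add (Cst a) (Mul (Cst A) (Mul e e))).

Fixpoint code (A : nat) (e : aexp) : expr :=
  match e with
  | Lit z => Cst z
  | Inp e => Read (Mod (code A e) input_end_expr)
  | Arr a e => Read (cell A a (code A e))
  | Bin o e1 e2 => op_code o (code A e1) (code A e2)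
  end.

Fixpoint pow_expr (d : nat) : expr :=
  if d is d'.+1 then Mul size_expr (pow_expr d') else Cst 1.

Definition below (A x : nat) (b : expr) : expr :=
  Leq (Add (Read (cell A x (Cst 0))) (Cst 1)) b.

Definition incr (A x : nat) : program :=
  Write (cell A x (Cst 0)) (Add (Read (cell A x (Cst 0))) (Cst 1)).

Fixpoint compile (A : nat) (c : cmd) : program :=
  match c with
  | CSkip => Skip
  | CSet a i e => Write (cell A a (code A i)) (code A e)
  | CSeq c1 c2 => Seq (compile A c1) (compile A c2)
  | CIf e c1 c2 => If (code A e) (compile A c1) (compile A c2)
  | CFor x c d b =>
      Seq (Write (cell A x (Cst 0)) (Cst 0))
        (While (below A x (Mul (Cst c) (pow_expr d)))
           (Seq (compile A b) (incr A x)))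
  end.

Fixpoint program_size (c : program) : nat :=
  match c with
  | Skip => 1
  | Write a e => (expr_size a + expr_size e).+1
  | Seq c1 c2 => program_size c1 + program_size c2
  | If e c1 c2 => expr_size e + (program_size c1 + program_size c2)
  | While e c => expr_size e + program_size c
  end.

Fixpoint wf_aexp (A : nat) (e : aexp) : bool :=
  match e with
  | Lit _ => true
  | Inp e => wf_aexp A e
  | Arr a e => (a < A)%N && wf_aexp A e
  | Bin _ e1 e2 => wf_aexp A e1 && wf_aexp A e2
  end.

Fixpoint wf (A : nat) (c : cmd) : bool :=
  match c with
  | CSkip => true
  | CSet a i e =>
      [&& (a < A)%N, wf_aexp A i, wf_aexp A e & additive (code A e)]
  | CSeq c1 c2 => wf A c1 && wf A c2
  | CIf e c1 c2 => [&& wf_aexp A e, wf A c1 & wf A c2]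
  | CFor x _ _ b => [&& (x < A)%N, x \notin writes b & wf A b]
  end.

(** Both branches of a conditional are charged, so that the count depends on [n] only. In a loop, 3
    pays for the initial write and the last test, and each round pays 2 for the increment and 1 for
    the test. *)
Fixpoint steps (c : cmd) : {poly nat} :=
  match c with
  | CSkip => 1%:P
  | CSet _ _ _ => 2%:P
  | CSeq c1 c2 => steps c1 + steps c2
  | CIf _ c1 c2 => 1%:P + (steps c1 + steps c2)
  | CFor _ c d b => 3%:P + c%:P * 'X^d * (steps b + 3%:P)
  end.

Definition represents (A : nat) (inp : nat -> int) (mu : memory) (s : state) :=
  (forall i, (i < input_end `|inp 0%N|)%N -> mu i = inp i) /\
  (forall a i, (a < A)%N ->
     mu (input_end `|inp 0%N| + (a + A * (i * i)))%N = s a i).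

Section Simulation.
Variables (A : nat) (inp : nat -> int).
Hypothesis inp0 : 0 <= inp 0%N.

Local Notation n := `|inp 0%N|%N.

Lemma eval_input_end mu :
  mu 0%N = inp 0%N -> eval mu input_end_expr = (input_end n)%:Z.
Proof. by move=> /= ->; rewrite /input_end; lia. Qed.

Lemma eval_cell mu a e :
  mu 0%N = inp 0%N ->
  `|eval mu (cell A a e)|%N =
    (input_end n + (a + A * (`|eval mu e| * `|eval mu e|)))%N.
Proof.
move=> mu0; rewrite /cell.
rewrite -[LHS]/(absz (eval mu input_end_expr + (a%:Z + A%:Z * (eval mu e * eval mu e)))).
rewrite eval_input_end //; set z := eval mu e.
have -> : z * z = (`|z| * `|z|)%N%:Z by rewrite PoszM; lia.
by rewrite -PoszM -!PoszD.
Qed.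

Lemma represents0 mu s : represents A inp mu s -> mu 0%N = inp 0%N.
Proof. by case=> h _; apply: h. Qed.

(** The residue modulo [A] determines the array, and then the square determines the index. *)
Lemma cell_inj a i a' i' : (a < A)%N -> (a' < A)%N ->
  ((a' + A * (i' * i') == a + A * (i * i)) = (a' == a) && (i' == i))%N.
Proof.
move=> aA aA'; apply/eqP/andP => [h|[/eqP-> /eqP->] //].
have A0 : (0 < A)%N by lia.
have /eqP ea : a' == a.
  have := congr1 (modn^~ A) h.
  by rewrite /= !(addnC _ (A * _)%N) ![(A * _)%N]mulnC !modnMDl !modn_small // => ->.
move: h; rewrite ea => /addnI /eqP; rewrite eqn_pmul2l // => /eqP h.
by split=> //; rewrite -(eqn_sqr i' i) !expnS !expn0 !muln1 h.
Qed.

Lemma represents_write mu s a i z : (a < A)%N -> represents A inp mu s ->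
  represents A inp (update mu (input_end n + (a + A * (i * i)))%N z)
    (upd s a i z).
Proof.
move=> aA [h1 h2]; split=> [j jn|a' i' a'A].
  by rewrite /update; case: eqP => [?|_]; [lia|exact: h1].
by rewrite /update /upd eqn_add2l cell_inj // h2.
Qed.

Lemma eval_code mu s e : represents A inp mu s -> wf_aexp A e ->
  eval mu (code A e) = ev inp s e.
Proof.
move=> r; have r0 := represents0 r.
elim: e => //= [e h /h {h}he|a e h /andP[aA /h {h}he]|o e1 h1 e2 h2 /andP[/h1 e1E /h2 e2E]].
- rewrite -/(eval mu input_end_expr) -[_ + 2 * _]/(eval mu input_end_expr).
  rewrite eval_input_end // he.
  case: r => h _; apply: h.
  have := ltz_pmod (ev inp s e) (isT : (0:int) < (input_end n)%:Z).
  by have := modz_ge0 (ev inp s e) (isT : (input_end n)%:Z != 0); lia.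
- have := eval_cell a (code A e) r0; rewrite /= => ->.
  by case: r => _ ->; rewrite ?he.
- by rewrite -e1E -e2E; case: o.
Qed.

Lemma eval_pow mu d : mu 0%N = inp 0%N -> eval mu (pow_expr d) = (n ^ d)%N%:Z.
Proof. by move=> m0; elim: d => //= d ->; rewrite m0 expnS PoszM gez0_abs. Qed.

Lemma eval_read_cell mu s x : (x < A)%N -> represents A inp mu s ->
  eval mu (Read (cell A x (Cst 0))) = s x 0%N.
Proof.
move=> xA r; rewrite -[LHS]/(mu `|eval mu (cell A x (Cst 0))|%N).
by rewrite eval_cell ?(represents0 r) //; case: r => _ ->.
Qed.

(** One constant [K], the size of the compiled program, bounds the size of every expression in it
    and hence the growth of the cells in each step. *)
Lemma compile_correct K c mu s : (0 < K)%N ->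
  wf A c -> (program_size (compile A c) <= K)%N -> represents A inp mu s ->
  exists2 mu', timed K (compile A c) mu (steps c).[n] mu' &
    represents A inp mu' (den inp c s).
Proof.
move=> K0; elim: c mu s => [|a i e|c1 h1 c2 h2|e c1 h1 c2 h2|x c d b h] mu s /=.
- by move=> _ _ r; exists mu => //; rewrite hornerC; apply: timed_skip.
- case/and4P=> aA wi we ad hK r; rewrite hornerC; eexists.
    by apply: timed_write ad; rewrite /=; lia.
  rewrite eval_cell ?(represents0 r) //.
  rewrite (eval_code r we) (eval_code r wi).
  exact: represents_write.
- case/andP=> w1 w2 hK r; rewrite hornerD.
  have [|mu1 t1 r1] := h1 mu s w1 _ r; first by lia.
  have [|mu2 t2 r2] := h2 mu1 _ w2 _ r1; first by lia.
  by exists mu2 => //; apply: timed_seq t1 t2.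
- case/and3P=> we w1 w2 hK r; rewrite !hornerD hornerC.
  have [|mu1 t1 r1] := h1 mu s w1 _ r; first by lia.
  have [|mu2 t2 r2] := h2 mu s w2 _ r; first by lia.
  have eE := eval_code r we.
  case: (boolP (ev inp s e == 0)) => e0 /=.
    exists mu2 => //; rewrite -[(1 + _)%R]/(_.+1); apply: timed_if; first by lia.
    by rewrite eE e0; apply: timed_weaken t2; rewrite leq_addl.
  exists mu1 => //; rewrite -[(1 + _)%R]/(_.+1); apply: timed_if; first by lia.
  by rewrite eE e0; apply: timed_weaken t1; rewrite leq_addr.
- case/and3P=> xA xb wb hK r.
  set N := (c * n ^ d)%N.
  pose st i := iteri i (fun i s => upd (den inp b s) x 0 i.+1%:Z) (upd s x 0 0).
  have st0 i : st i x 0%N = i%:Z by case: i => [|i]; rewrite /st /= upd_eq.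
  pose I i mu := represents A inp mu (st i).
  have testE i mu1 : I i mu1 ->
      eval mu1 (below A x (Mul (Cst c) (pow_expr d))) =
      if (i < N)%N then 1 else 0.
    move=> I1; rewrite -[LHS]/(if eval mu1 (Read (cell A x (Cst 0))) + 1
      <= c%:Z * eval mu1 (pow_expr d) then 1 else 0).
    rewrite (eval_read_cell xA I1) eval_pow ?(represents0 I1) // st0.
    by rewrite -PoszM -PoszD addn1.
  have [||||mu1 t1 I1] := @timed_while K I N
    (below A x (Mul (Cst c) (pow_expr d))) (Seq (compile A b) (incr A x))
    (update mu `|eval mu (cell A x (Cst 0))|%N 0) ((steps b).[n] + 2)%N.
  + by move: hK; rewrite /=; lia.
  + move=> i mu1 iN I1; rewrite (testE _ _ I1) iN; split=> //.
    have [|mu2 t2 I2] := h mu1 (st i) wb _ I1; first by lia.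
    eexists.
      apply: timed_seq t2 _; apply: timed_write => //;
      by move: hK; rewrite /=; lia.
    rewrite eval_cell ?(represents0 I2) //
      -[eval _ (Add _ _)]/(eval mu2 (Read (cell A x (Cst 0))) + 1).
    rewrite (eval_read_cell xA I2) den_frame // st0.
    by rewrite -PoszD addn1; apply: represents_write.
  + by move=> mu1 I1; rewrite (testE _ _ I1) ltnn.
  + rewrite /I eval_cell ?(represents0 r) //.
    exact: represents_write.
  exists mu1 => //.
  have -> : (3%:P + c%:P * 'X^d * (steps b + 3%:P)).[n] =
     (2 + (N * ((steps b).[n] + 2).+1).+1)%N.
    rewrite !(hornerD, hornerM, hornerC, hornerXn) /N.
    rewrite -[(_ + _ * _ * _)%R]/(3 + c * _ * ((steps b).[n] + 3))%N.
    by rewrite natrXE addnS addnS -addn1 !addnS; lia.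
  apply: timed_seq t1; apply: timed_write => //;
  by move: hK; rewrite /=; lia.
Qed.

End Simulation.

(** * Layout of the input and delivery of the output *)

Lemma size_flatten_const (T U : Type) (f : T -> seq U) (k : nat) (s : seq T) :
  (forall x, size (f x) = k) ->
  size (flatten [seq f x | x <- s]) = (size s * k)%N.
Proof. by move=> fk; elim: s => //= x s IH; rewrite size_cat IH fk mulSn. Qed.

Lemma nth_flatten_const (T U : Type) (f : T -> seq U) (k : nat) (s : seq T)
    (x0 : T) (y0 : U) (i j : nat) :
  (forall x, size (f x) = k) -> (i < size s)%N -> (j < k)%N ->
  nth y0 (flatten [seq f x | x <- s]) (i * k + j) = nth y0 (f (nth x0 s i)) j.
Proof.
move=> fk + jk; elim: s i => //= x s IH [|i] is_ /=.
  by rewrite nth_cat fk mul0n jk.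
by rewrite nth_cat fk mulSn -addnA ltnNge leq_addr /= addKn IH.
Qed.

Lemma flatten_flatten_map (T U : Type) (f : T -> seq (seq U)) (s : seq T) :
  flatten (flatten [seq f x | x <- s]) = flatten [seq flatten (f x) | x <- s].
Proof. by elim: s => //= x s IH; rewrite flatten_cat IH. Qed.

Lemma size_encode I : size (encode I) = input_end (npts I).
Proof.
rewrite /encode !size_cat flatten_flatten_map.
rewrite (@size_flatten_const _ _ _ 2) //.
rewrite (@size_flatten_const _ _ _ (npts I * 2)); last first.
  by move=> u; rewrite (@size_flatten_const _ _ _ 2) // size_enum_ord.
by rewrite size_enum_ord /input_end /=; lia.
Qed.

Definition inp_of (I : instance) : nat -> int := fun i => nth 0 (encode I) i.

Lemma inp_of_rad I (v : 'I_(npts I)) (j : nat) : (j < 2)%N ->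
  inp_of I (3 + (v * 2 + j))%N = nth 0 (encode_rat (rad v)) j.
Proof.
move=> j2; rewrite /inp_of /encode nth_cat /= nth_cat addKn.
rewrite (@size_flatten_const _ _ _ 2) // size_enum_ord.
have vn := ltn_ord v; case: ifP => [_|]; last by lia.
by rewrite (@nth_flatten_const _ _ _ 2 _ v) ?size_enum_ord // nth_ord_enum.
Qed.

Lemma inp_of_dist I (u v : 'I_(npts I)) (j : nat) : (j < 2)%N ->
  inp_of I (3 + (npts I * 2 + (u * (npts I * 2) + (v * 2 + j))))%N =
  nth 0 (encode_rat (dist u v)) j.
Proof.
move=> j2; rewrite /inp_of /encode nth_cat /= nth_cat addKn.
rewrite (@size_flatten_const _ _ _ 2) // size_enum_ord.
rewrite ltnNge leq_addr /= addKn flatten_flatten_map.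
have vn := ltn_ord v; have un := ltn_ord u.
have sz w : size (flatten [seq encode_rat (dist w v) | v <- enum 'I_(npts I)])
    = (npts I * 2)%N.
  by rewrite (@size_flatten_const _ _ _ 2) // size_enum_ord.
rewrite (@nth_flatten_const _ _ _ (npts I * 2) _ u) ?size_enum_ord //; last by lia.
by rewrite (@nth_flatten_const _ _ _ 2 _ v) ?size_enum_ord // !nth_ord_enum.
Qed.

Definition init_state : state := fun _ _ => 0.

(* The answer is copied to the first cells from the last one down, because the
   addresses of the arrays are computed from cell [0]. *)
Definition with_output (A x res : nat) (c : program) : program :=
  Seq c
  (Seq (Seq (Write (cell A x (Cst 0)) (Cst 0))
        (While (below A x (Sub size_expr (Cst 1)))
         (Seq (incr A x)
            (Write (Sub size_expr (Read (cell A x (Cst 0))))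
               (Read (cell A res (Sub size_expr (Read (cell A x (Cst 0))))))))))
     (Write (Cst 0) (Read (cell A res (Cst 0))))).

Lemma bitlen_inp_of I i : (bitlen (inp_of I i) <= input_size I)%N.
Proof.
rewrite /inp_of /input_size; have [hi|hi] := ltnP i (size (encode I)).
  by rewrite [X in (_ <= X)%N](big_nth 0) big_mkord (bigD1 (Ordinal hi)) //= leq_addr.
by rewrite nth_default // {1}/bitlen trunc_log0 /encode big_cons.
Qed.

Lemma leq_npts_input_size I : (npts I <= input_size I)%N.
Proof.
rewrite /input_size; apply: (@leq_trans (\sum_(z <- encode I) 1)).
  by rewrite sum1_size size_encode /input_end; lia.
by apply: leq_sum.
Qed.

Lemma leq_horner_nat (p : {poly nat}) (x y : nat) : (x <= y)%N -> (p.[x] <= p.[y])%N.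
Proof.
move=> xy; elim/poly_ind: p => [|p c IH]; first by rewrite !horner0.
rewrite !hornerMXaddC; apply: leq_add => //.
exact: leq_mul.
Qed.

Lemma represents_init I A : represents A (inp_of I) (initial I) init_state.
Proof.
split=> // a i aA; rewrite /initial nth_default // size_encode.
exact: leq_addr.
Qed.

(** While the answer is delivered the input cells are overwritten. The memory then serves as its own
    input, of which the layout of the arrays only uses cell 0. *)
Lemma represents_self A inp mu s : represents A inp mu s -> represents A mu mu s.
Proof. by move=> r; have := represents0 r; case: r => [_ r] r0; rewrite /represents r0. Qed.

Lemma with_output_run A K x res c mu mu1 s st n :
  (0 < n)%N -> mu1 0%N = n%:Z ->
  (x < A)%N -> (res < A)%N -> res != x ->
  (program_size (with_output A x res c) <= K)%N ->
  timed K c mu st mu1 -> represents A mu1 mu1 s ->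
  exists2 mu', timed K (with_output A x res c) mu (st + 5 * n + 5) mu' &
    forall v, (v < n)%N -> mu' v = s res v.
Proof.
move=> n0 mu10 xA resA xres hK t1 r1.
pose J i mu := [/\ represents A mu mu (upd s x 0 i%:Z),
   mu 0%N = n%:Z & forall v, (n - i <= v < n)%N -> mu v = s res v].
have nend : (n < input_end n)%N by rewrite /input_end; lia.
(* Output cells other than cell 0 lie below [input_end n], so writing them affects neither the
   arrays nor their addresses. *)
have rw (mu2 : memory) s2 b z : mu2 0%N = n%:Z -> (0 < b < n)%N ->
    represents A mu2 mu2 s2 ->
    represents A (update mu2 b z) (update mu2 b z) s2.
  move=> m0 bn [h1 h2]; split=> // a j aA; rewrite -h2 // {1}/update.
  have -> : update mu2 b z 0%N = mu2 0%N by rewrite /update; case: eqP => //; lia.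
  by rewrite m0 absz_nat; case: eqP => //; lia.
have [||||mu2 t2 [r2 m2 o2]] := @timed_while K J n.-1
    (below A x (Sub size_expr (Cst 1)))
    (Seq (incr A x)
            (Write (Sub size_expr (Read (cell A x (Cst 0))))
               (Read (cell A res (Sub size_expr (Read (cell A x (Cst 0))))))))
    (update mu1 `|eval mu1 (cell A x (Cst 0))|%N 0) 4.
- by move: hK; rewrite /=; lia.
- move=> i mu2 i_n [r2 m2 o2].
  have m20 : 0 <= mu2 0%N by rewrite m2.
  split.
    rewrite -[eval _ _]/(if eval mu2 (Read (cell A x (Cst 0))) + 1
      <= mu2 0%N - 1 then 1 else 0).
    by rewrite (eval_read_cell m20 xA r2) upd_eq m2 ifT //; lia.
  set mu3 := update mu2 `|eval mu2 (cell A x (Cst 0))|%N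
    (eval mu2 (Add (Read (cell A x (Cst 0))) (Cst 1))).
  have mu3l b : (b < input_end n)%N -> mu3 b = mu2 b.
    move=> bn; rewrite /mu3 /update (@eval_cell A mu2) // m2 absz_nat.
    by case: eqP => //; lia.
  have m3 : mu3 0%N = n%:Z by rewrite mu3l //; lia.
  have r3 : represents A mu3 mu3 (upd s x 0 i.+1%:Z).
    have : represents A mu2 mu3 (upd (upd s x 0 i%:Z) x 0 i.+1%:Z).
      rewrite /mu3 (@eval_cell A mu2) //.
      have -> : eval mu2 (Add (Read (cell A x (Cst 0))) (Cst 1)) = i.+1%:Z.
        rewrite -[LHS]/(eval mu2 (Read (cell A x (Cst 0))) + 1).
        by rewrite (eval_read_cell m20 xA r2) upd_eq -PoszD addn1.
      exact: represents_write.
    move=> /represents_self [_ h]; split=> [//|a j aA]; rewrite h //.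
    by rewrite /upd; case: (_ && _).
  have m30 : 0 <= mu3 0%N by rewrite m3.
  have xE : eval mu3 (Read (cell A x (Cst 0))) = i.+1%:Z.
    by rewrite (eval_read_cell m30 xA r3) upd_eq.
  have jE : eval mu3 (Sub size_expr (Read (cell A x (Cst 0)))) = (n - i.+1)%N%:Z.
    rewrite -[LHS]/(mu3 0%N - eval mu3 (Read (cell A x (Cst 0)))) xE m3.
    by lia.
  have zE : eval mu3 (Read (cell A res (Sub size_expr (Read (cell A x (Cst 0)))))) =
      s res (n - i.+1)%N.
    rewrite -[LHS]/(mu3 `|eval mu3 (cell A res (Sub size_expr (Read (cell A x (Cst 0)))))|%N).
    rewrite (@eval_cell A mu3) // jE; case: r3 => _ ->  //.
    by rewrite upd_neq.
  exists (update mu3 (n - i.+1)%N (s res (n - i.+1)%N)); last split.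
  + have -> : 4%N = (2 + 2)%N by [].
    apply: (@timed_seq _ _ _ _ mu3).
      by apply: timed_write => //; move: hK; rewrite /=; lia.
    rewrite -zE -[X in update _ X _]/(`|(n - i.+1)%N%:Z|%N) -jE.
    by apply: timed_write => //; move: hK; rewrite /=; lia.
  + by apply: rw => //; lia.
  + by rewrite /update; case: eqP => //; lia.
  + move=> v vn; rewrite /update; case: eqP => [->//|nv].
    by rewrite mu3l ?o2 //; lia.
- move=> mu2 [r2 m2 _].
  have m20 : 0 <= mu2 0%N by rewrite m2.
  rewrite -[eval _ _]/(if eval mu2 (Read (cell A x (Cst 0))) + 1
      <= mu2 0%N - 1 then 1 else 0).
  by rewrite (eval_read_cell m20 xA r2) upd_eq m2 ifF //; lia.
- have m10 : 0 <= mu1 0%N by rewrite mu10.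
  rewrite (@eval_cell A mu1) // mu10 absz_nat; split.
  + have : represents A mu1 (update mu1 (input_end n + (x + A * (0 * 0)))%N 0) (upd s x 0 0).
      by have := @represents_write A mu1 m10 _ _ _ 0 0 xA r1; rewrite mu10.
    exact: represents_self.
  + by rewrite /update; case: eqP => //; lia.
  + by move=> v; lia.
have m20 : 0 <= mu2 0%N by rewrite m2.
have zE : eval mu2 (Read (cell A res (Cst 0))) = s res 0%N.
  by rewrite (eval_read_cell m20 resA r2) upd_neq.
exists (update mu2 0%N (s res 0%N)).
  apply: (@timed_weaken _ _ _ (st + (2 + (n.-1 * 5).+1 + 2))%N); first by lia.
  apply: timed_seq t1 _; apply: timed_seq (timed_seq _ t2) _.
    by apply: timed_write => //; move: hK; rewrite /=; lia.
  rewrite -zE -[X in update _ X _]/(`|eval mu2 (Cst 0)|%N).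
  by apply: timed_write => //; move: hK; rewrite /=; lia.
move=> v vn; rewrite /update; case: eqP => [->//|v0].
by apply: o2; lia.
Qed.

Theorem with_output_correct (A x res : nat) (c : cmd) :
  wf A c -> (x < A)%N -> (res < A)%N -> res != x ->
  exists p : {poly nat}, forall I, (0 < npts I)%N ->
    exists T mu, [/\ exec (with_output A x res (compile A c)) (initial I) T mu,
      (T <= p.[input_size I])%N &
      forall v, (v < npts I)%N -> mu v = den (inp_of I) c init_state res v].
Proof.
move=> wfc xA resA rx.
set P := with_output A x res (compile A c).
pose K := (program_size P).+1.
pose st : {poly nat} := steps c + 5%:P * 'X + 5%:P.
(* This is [cost_bound] as a polynomial in the input size, which bounds both the initial bit lengths
   and [npts I]. *)
exists (st * ((K ^ 2)%N%:P * ('X + K%:P * st + 1%:P))) => I n0.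
have [||mu1 t1 r1] := @compile_correct A (inp_of I) _ K c _ _ (ltn0Sn _) wfc _
  (represents_init I A) => //.
  by rewrite /K /P /=; lia.
have [||mu t o] := @with_output_run A K x res _ _ _ _ _ (npts I) n0 _ xA resA rx _ t1
  (represents_self r1).
- by rewrite (represents0 r1).
- exact: leqnSn.
have [|_ [T ex Tle]] := t (input_size I); first by move=> a; exact: bitlen_inp_of.
exists T, mu; split=> //.
have stn : ((steps c).[`|inp_of I 0%N|%N] + 5 * npts I + 5 <= st.[input_size I])%N.
  apply: leq_trans (leq_horner_nat st (leq_npts_input_size I)).
  by rewrite /st !(hornerD, hornerM, hornerC, hornerX).
apply: leq_trans Tle _; apply: leq_trans (leq_cost_bound _ _ stn) _.
rewrite !(hornerD, hornerM, hornerC, hornerX) /cost_bound.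
set w := (_ + _ + 5)%R.
by rewrite -[leqRHS]/(w * (K ^ 2 * (input_size I + K * w + 1)))%N addn1.
Qed.

Lemma sumz_bool (T : finType) (b : pred T) :
  \sum_x (b x)%:Z = #|[set x | b x]|%:Z.
Proof.
rewrite cardsE -sum1_card (big_morph Posz PoszD (erefl 0)) [RHS]big_mkcond /=.
by apply: eq_bigr => x _; rewrite unfold_in; case: (b x).
Qed.

Lemma sqrz_le (x : int) (k : nat) : - k%:Z <= x <= k%:Z -> x ^+ 2 <= (k ^ 2)%N%:Z.
Proof. by rewrite expr2 -[(k ^ 2)%N]/(k * k)%N PoszM => ?; nia. Qed.

(** * Fractional solutions by a perceptron *)

Section Perceptron.
Variables (n k m : nat) (c : nat -> nat -> bool).

Definition score (W : nat -> int) (u : nat) : int := \sum_(v < n) (c u v)%:Z * W v.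
Definition load (X : nat -> int) (v : nat) : int := \sum_(u < n) (c u v)%:Z * X u.

(* The constraints are [y v <= k * load X v], with multiplier [W v], and
   [m <= sum y], with multiplier [WW].  A step takes the Lagrangian optimum:
   all [k] centers at the best facility [us], and [y v] = [W v < WW]. *)
Definition perceptron_step (W : nat -> int) (WW : int) (X W' : nat -> int) (WW' : int)
    (X' : nat -> int) : Prop :=
  exists us, [/\ (us < n)%N,
    forall u, (u < n)%N -> score W u <= score W us,
    forall u, (u < n)%N -> X' u = X u + (u == us)%:Z,
    forall v, (v < n)%N ->
      W' v = Num.max 0 (W v + (W v < WW)%R%:Z - (c us v)%:Z * k%:Z) &
    WW' = Num.max 0 (WW + m%:Z - \sum_(v < n) (W v < WW)%R%:Z)].

(* [Y v] counts the steps with [y v = 1]. *)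
Definition perceptron_inv (q : nat) (W : nat -> int) (WW : int) (X Y : nat -> int) : Prop :=
  [/\ forall v, (v < n)%N -> 0 <= W v, 0 <= WW,
      forall u, (u < n)%N -> 0 <= X u &
      \sum_(u < n) X u = q%:Z] /\
  [/\
      \sum_(v < n) W v ^+ 2 + WW ^+ 2 <= (q * (n.+1 * n ^ 2))%N%:Z,
      forall v, (v < n)%N -> Y v <= q%:Z,
      forall v, (v < n)%N -> Y v - k%:Z * load X v <= W v &
      (q * m)%N%:Z - \sum_(v < n) Y v <= WW].

Definition feasible : Prop :=
  exists S : {set 'I_n}, (#|S| <= k)%N /\
    (m <= #|[set v : 'I_n | [exists u in S, c u v]]|)%N.

Hypothesis feas : feasible.
Hypothesis kn : (k <= n)%N.

Lemma feasible_leq : (m <= n)%N.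
Proof.
case: feas => S [_ h]; apply: leq_trans h _.
by apply: leq_trans (max_card _) _; rewrite card_ord.
Qed.

(* An integral feasible solution has nonpositive Lagrangian value. *)
Lemma perceptron_oracle W WW us :
  (forall v, (v < n)%N -> 0 <= W v) -> 0 <= WW ->
  (forall u, (u < n)%N -> score W u <= score W us) ->
  (us < n)%N ->
  \sum_(v < n) W v * ((W v < WW)%R%:Z - (c us v)%:Z * k%:Z)
   + WW * (m%:Z - \sum_(v < n) (W v < WW)%R%:Z) <= 0.
Proof.
move=> W0 WW0 best us_n; have [S [Sk Sm]] := feas.
pose y (v : 'I_n) := [exists u in S, c u v].
(* The choice [[W v < WW]] minimises each term separately; by [h2] the weight covered by [S] is at
   most [k] times the best score. *)
have h1 : \sum_(v < n) (W v < WW)%R%:Z * (W v - WW) <=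
    \sum_(v < n) (y v)%:Z * (W v - WW).
  apply: ler_sum => v _; case: ltP => h; case: (y v); rewrite ?mul1r ?mul0r //; lia.
have h2 : \sum_(v < n) (y v)%:Z * W v <= k%:Z * score W us.
  apply: (@le_trans _ _ (\sum_(u in S) score W u)).
    rewrite exchange_big /=; apply: ler_sum => v _.
    rewrite -mulr_suml ler_wpM2r ?W0 //.
    rewrite /y; case: existsP => [[u /andP[uS cuv]]|_].
      by rewrite (bigD1 u) //= cuv lerDl sumr_ge0.
    by apply: sumr_ge0 => i _.
  apply: (@le_trans _ _ (\sum_(u in S) score W us)).
    by apply: ler_sum => u _; apply: best.
  rewrite sumr_const -mulr_natl ler_wpM2r ?sumr_ge0 // => [v _|].
    by rewrite mulr_ge0 ?W0.
  by rewrite natz lez_nat.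
have h3 : m%:Z <= \sum_(v < n) (y v)%:Z.
  by rewrite sumz_bool lez_nat.
have e1 : \sum_(v < n) W v * ((W v < WW)%R%:Z - (c us v)%:Z * k%:Z) =
   \sum_(v < n) (W v < WW)%R%:Z * W v - k%:Z * score W us.
  rewrite /score mulr_sumr -sumrB; apply: eq_bigr => v _.
  by ring.
have e2 (z : 'I_n -> bool) : \sum_(v < n) (z v)%:Z * (W v - WW) =
    \sum_(v < n) (z v)%:Z * W v - (\sum_(v < n) (z v)%:Z) * WW.
  by rewrite mulr_suml -sumrB; apply: eq_bigr => v _; rewrite mulrBr.
rewrite !e2 in h1; rewrite e1; nia.
Qed.

(** Potential argument: truncation at 0 does not increase a square, the cross term is nonpositive by
    [perceptron_oracle], and each of the [n + 1] squared violations is at most [n ^ 2]. *)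
Lemma perceptron_step_inv q W WW X Y W' WW' X' :
  perceptron_inv q W WW X Y -> perceptron_step W WW X W' WW' X' ->
  perceptron_inv q.+1 W' WW' X' (fun v => Y v + (W v < WW)%R%:Z).
Proof.
move=> [[W0 WW0 X0 Xs] [pot Yq YW YWW]] [us [us_n best X'E W'E WW'E]].
have sqr_max (x y : int) : y ^+ 2 <= x -> Num.max 0 y ^+ 2 <= x.
  move=> h; apply: le_trans h; rewrite expr2 expr2 maxEle; case: ifP => // ?.
  by rewrite mul0r -expr2 sqr_ge0.
split; split.
- by move=> v vn; rewrite W'E // le_max lexx.
- by rewrite WW'E le_max lexx.
- by move=> u un; rewrite X'E // addr_ge0 ?X0.
- under eq_bigr do rewrite X'E //.
  rewrite big_split /= Xs (bigD1 (Ordinal us_n)) //= eqxx big1 ?addr0; first lia.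
  by move=> u; rewrite -val_eqE /= => /negbTE->.
- pose d := fun v : 'I_n => (W v < WW)%R%:Z - (c us v)%:Z * k%:Z.
  pose e : int := m%:Z - \sum_(v < n) (W v < WW)%R%:Z.
  have orc : \sum_(v < n) W v * d v + WW * e <= 0.
    exact: perceptron_oracle W0 WW0 best us_n.
  have dn v : d v ^+ 2 <= (n ^ 2)%N%:Z.
    by apply: sqrz_le; rewrite /d; case: (_ < _); case: c => /=; lia.
  have en : e ^+ 2 <= (n ^ 2)%N%:Z.
    apply: sqrz_le.
    rewrite /e sumz_bool; have mn := feasible_leq.
    set T := [set _ | _]; have := max_card T; rewrite card_ord => Tn.
    by apply/andP; split; lia.
  have -> : (q.+1 * (n.+1 * n ^ 2))%N%:Z =
    (q * (n.+1 * n ^ 2))%N%:Z + (\sum_(v < n) (n ^ 2)%N%:Z + (n ^ 2)%N%:Z).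
    by rewrite sumr_const card_ord -mulr_natr natz; lia.
  apply: (@le_trans _ _ (\sum_(v < n) (W v + d v) ^+ 2 + (WW + e) ^+ 2)).
    apply: lerD; last by rewrite WW'E; apply: sqr_max; rewrite /e addrA.
    by apply: ler_sum => v _; rewrite W'E //; apply: sqr_max; rewrite /d addrA.
  have -> : \sum_(v < n) (W v + d v) ^+ 2 + (WW + e) ^+ 2 =
     \sum_(v < n) W v ^+ 2 + WW ^+ 2 + 2 * (\sum_(v < n) W v * d v + WW * e) +
     (\sum_(v < n) d v ^+ 2 + e ^+ 2).
    rewrite (eq_bigr (fun v : 'I_n => W v ^+ 2 + 2 * (W v * d v) + d v ^+ 2)); last first.
      by move=> v _; ring.
    by rewrite !big_split /= -mulr_sumr; ring.
  apply: lerD; first by rewrite -[leRHS]addr0 lerD // pmulr_rle0.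
  by apply: lerD => //; apply: ler_sum.
- by move=> v vn; have := Yq v vn; case: (_ < _) => /=; lia.
- move=> v vn; rewrite W'E // le_max; apply/orP; right.
  have -> : load X' v = load X v + (c us v)%:Z.
    rewrite /load; under eq_bigr do rewrite X'E // mulrDr.
    rewrite big_split /=; congr (_ + _).
    rewrite (bigD1 (Ordinal us_n)) //= eqxx mulr1 big1 ?addr0 //.
    by move=> u; rewrite -val_eqE /= => /negbTE->; rewrite mulr0.
  by have := YW v vn; lia.
- rewrite WW'E le_max; apply/orP; right; rewrite big_split /=.
  have H (a b x y w : int) : x - a <= w -> y + x - (a + b) <= w + y - b by lia.
  by rewrite mulSn PoszD; apply: H.
Qed.

(** The potential grows linearly, so each multiplier is at most the square root of
    [q * (n + 1) * n ^ 2]. For [q] this large it is less than [q / ((n + 1) * (2n + 1))], and the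
    [n + 1] multipliers bound the accumulated violation by less than [q / (2n + 1)]. *)
Lemma perceptron_load q W WW X Y :
  ((n + n).+1 ^ 2 * (n.+1 ^ 3 * n ^ 2) < q)%N ->
  perceptron_inv q W WW X Y ->
  (n + n).+1%:Z * ((q * m)%N%:Z - \sum_(v < n) Num.min q%:Z (k%:Z * load X v)) < q%:Z.
Proof.
move=> big [[W0 WW0 _ _] [pot Yq YW YWW]].
set s := (n + n).+1 in big *.
have small (E : int) : 0 <= E -> E ^+ 2 <= (q * (n.+1 * n ^ 2))%N%:Z ->
    n.+1%:Z * (s%:Z * E) < q%:Z.
  move=> E0; rewrite -(gez0_abs E0); move: `|E|%N => x {E0}.
  rewrite expr2 -!PoszM lez_nat ltz_nat => xle.
  rewrite ltnNge; apply/negP => h.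
  have : (q ^ 2 <= q * (s ^ 2 * (n.+1 ^ 3 * n ^ 2)))%N.
    apply: (@leq_trans ((n.+1 * (s * x)) ^ 2)); first by rewrite leq_sqr.
    rewrite !expnMn.
    have -> : (q * (s ^ 2 * (n.+1 ^ 3 * n ^ 2)) =
      n.+1 ^ 2 * (s ^ 2 * (q * (n.+1 * n ^ 2))))%N by ring.
    by rewrite leq_mul // leq_mul.
  have q0 : (0 < q)%N by lia.
  by rewrite expnS expn1 leq_pmul2l //; lia.
have sq0 (x : int) : 0 <= x ^+ 2 by apply: sqr_ge0.
have Wsm (v : 'I_n) : n.+1%:Z * (s%:Z * W v) < q%:Z.
  apply: small; first exact: W0.
  apply: le_trans pot; rewrite (bigD1 v) //= -addrA lerDl addr_ge0 //.
  exact: sumr_ge0.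
have WWsm : n.+1%:Z * (s%:Z * WW) < q%:Z.
  by apply: small => //; apply: le_trans pot; rewrite lerDr sumr_ge0.
have min_ge : \sum_(v < n) Y v - \sum_(v < n) W v <=
    \sum_(v < n) Num.min q%:Z (k%:Z * load X v).
  rewrite -sumrB; apply: ler_sum => v _; rewrite le_min.
  have := Yq v (ltn_ord v); have := YW v (ltn_ord v); have := W0 v (ltn_ord v).
  by move=> *; apply/andP; split; lia.
have sumW : n.+1%:Z * (s%:Z * \sum_(v < n) W v) <= n%:Z * q%:Z.
  rewrite !mulr_sumr.
  apply: le_trans (_ : \sum_(v < n) q%:Z <= _).
    by apply: ler_sum => v _; apply: ltW.
  by rewrite sumr_const card_ord -mulr_natl natz.
have : n.+1%:Z * (s%:Z * ((q * m)%N%:Z - \sum_(v < n) Num.min q%:Z (k%:Z * load X v)))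
    < n.+1%:Z * q%:Z.
  apply: (@le_lt_trans _ _ (n.+1%:Z * (s%:Z * (\sum_(v < n) W v + WW)))).
    by rewrite !ler_pM2l //; lia.
  by rewrite !mulrDr; lia.
by rewrite ltr_pM2l.
Qed.

End Perceptron.

(** * Clusters of equal radius *)

Section Clustering.
Variables (n : nat) (R : nat -> rat) (share : nat -> nat -> bool) (sc : nat -> int).

(* [par w] is [0] as long as [w] belongs to no cluster, and [v.+1] once it
   belongs to the cluster of [v]. *)
Definition cluster_step (par par' : nat -> nat) : Prop :=
  exists vs, [/\ (vs < n)%N,
    forall v, (v < n)%N -> par v = 0%N -> par vs = 0%N /\ sc v <= sc vs &
    forall w, (w < n)%N ->
      par' w = if [&& par w == 0%N, R w == R vs & share vs w] then vs.+1
               else par w].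

Definition cluster_inv (q : nat) (par : nat -> nat) : Prop :=
  [/\ forall w, (w < n)%N -> (0 < par w)%N ->
        exists2 v, (v < n)%N /\ par w = v.+1 &
          [/\ R w = R v, share v w, sc w <= sc v & par v = v.+1],
      forall v w, (v < n)%N -> (w < n)%N -> par v = v.+1 -> par w = w.+1 ->
        v != w -> R v = R w -> ~~ share v w,
      forall v w, (v < n)%N -> (w < n)%N -> par v = v.+1 -> par w = 0%N ->
        R v = R w -> ~~ share v w &
      (#|[set w : 'I_n | par w == 0%N]| <= n - q)%N].

Hypothesis share_refl : forall v, (v < n)%N -> share v v.
Hypothesis share_sym : forall v w, (v < n)%N -> (w < n)%N -> share v w = share w v.

(** A new representative was unassigned before, so by the third clause of the invariant it shares no
    center with the older ones of its radius. Every round with an unassigned point left assigns at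
    least [vs] itself, by reflexivity, which gives the last clause. *)
Lemma cluster_step_inv q par par' :
  cluster_inv q par -> cluster_step par par' -> cluster_inv q.+1 par'.
Proof.
move=> [h1 h2 h3 h4] [vs [vs_n best parE]].
have old w : (w < n)%N -> (0 < par w)%N -> par' w = par w.
  by move=> wn w0; rewrite parE // -(negbK (par w == 0%N)) -lt0n w0.
have [vs0|vs0] := posnP (par vs); last first.
  have same w : (w < n)%N -> par' w = par w.
    move=> wn; rewrite parE //; case: eqP => // w0.
    by have [] := best w wn w0; lia.
  split=> [w wn|v w vn wn|v w vn wn|]; rewrite ?same //.
  - by move=> /(h1 _ wn)[v [vn e] [? ? ? ?]]; exists v; rewrite ?same.
  - exact: h2.
  - exact: h3.
  - rewrite (eq_card0 (A := [set w : 'I_n | par' w == 0%N])) // => w.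
    by rewrite inE same //; apply/negP => /eqP /(best _ (ltn_ord w)) []; lia.
have vs' : par' vs = vs.+1 by rewrite parE // vs0 !eqxx share_refl.
have new w : (w < n)%N -> par w = 0%N -> par' w != 0%N -> 
    [/\ par' w = vs.+1, R w = R vs & share vs w].
  by move=> wn w0; rewrite parE // w0 eqxx /=; case: ifP => // /andP[/eqP -> ->].
have rep v : (v < n)%N -> par' v = v.+1 -> par v = v.+1 \/ v = vs.
  move=> vn e; have [v0|v0] := posnP (par v); last by left; rewrite -old.
  by have [|e' _ _] := new v vn v0; [rewrite e|right; apply/eqP; rewrite -eqSS -e e'].
split.
- move=> w wn w0; have [pw0|pw0] := posnP (par w).
    have [|e Rw sw] := new w wn pw0; first by rewrite -lt0n.
    by exists vs => //; split=> //; have [] := best w wn pw0.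
  have [v [vn e] [Rv sv scv pv]] := h1 w wn pw0.
  by exists v; [rewrite old | split=> //; rewrite old ?pv].
- move=> v w vn wn /(rep _ vn)[v1|->] /(rep _ wn)[w1|->] vw Rvw.
  + exact: h2.
  + exact: h3.
  + by rewrite share_sym //; apply: h3.
  + by rewrite eqxx in vw.
- move=> v w vn wn /(rep _ vn) e w0 Rvw.
  have pw0 : par w = 0%N.
    by have [//|pw] := posnP (par w); have := old w wn pw; lia.
  case: e => [v1|ev]; first exact: h3.
  apply/negP => svw; move: w0; rewrite parE // pw0 eqxx -Rvw -ev eqxx svw.
  by [].
- have sub : [set w : 'I_n | par' w == 0%N] \subset
      [set w : 'I_n | par w == 0%N] :\ Ordinal vs_n.
    apply/subsetP => w; rewrite !inE => /eqP w0; apply/andP; split.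
      by apply/eqP => e; move: w0; rewrite e /= vs'.
    by have [//|pw] := posnP (par w); have := old w (ltn_ord w) pw; lia.
  apply: leq_trans (subset_leq_card sub) _.
  by move: h4; rewrite (cardsD1 (Ordinal vs_n)) inE /= vs0 eqxx subnS; lia.
Qed.

Lemma cluster_done par : cluster_inv n par -> forall w, (w < n)%N -> (0 < par w)%N.
Proof.
move=> [_ _ _ h] w wn; rewrite lt0n; apply/negP => w0.
move: h; rewrite subnn leqn0 cards_eq0 => /eqP/setP/(_ (Ordinal wn)).
by rewrite !inE w0.
Qed.

Definition weight (par : nat -> nat) (v : nat) : int := \sum_(w < n) (par w == v.+1)%:Z.

Lemma weight_ge0 par v : 0 <= weight par v.
Proof. exact: sumr_ge0. Qed.

(** Double counting: every point contributes once, at its representative. *)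
Lemma sum_weight par (f : nat -> int) :
  (forall w, (w < n)%N -> exists2 v, (v < n)%N & par w = v.+1) ->
  \sum_(v < n) weight par v * f v = \sum_(w < n) f (par w).-1.
Proof.
move=> h; rewrite /weight.
under eq_bigr do rewrite mulr_suml.
rewrite exchange_big /=; apply: eq_bigr => w _.
have [v vn e] := h w (ltn_ord w).
rewrite (bigD1 (Ordinal vn)) //= e eqxx mul1r big1 ?addr0 // => u.
by rewrite -val_eqE /= eqSS eq_sym => /negbTE->; rewrite mul0r.
Qed.

End Clustering.

(** * The assignment problem by an auction *)

Section Auction.
Variables (N : nat) (ben : nat -> nat -> int) (B : int).

(* Object [j] belongs to person [i] if [own j = i.+1] and [has i = j.+1]; the
   value [0] means unassigned.  An unassigned person takes the best object at
   the current prices [P] and raises its price by [1]. *)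
Definition auction_step (own has : nat -> nat) (P : nat -> int)
    (own' has' : nat -> nat) (P' : nat -> int) : Prop :=
  exists i, [/\ (i < N)%N, forall i', (i' < N)%N -> has i' = 0%N -> has i = 0%N &
  if has i == 0%N then
    exists j, [/\ (j < N)%N,
      forall l, (l < N)%N -> ben i l - P l <= ben i j - P j,
      forall l, (l < N)%N -> own' l = if l == j then i.+1 else own l,
      forall l, (l < N)%N -> has' l = if l == i then j.+1
                     else if own j == l.+1 then 0%N else has l &
      forall l, (l < N)%N -> P' l = P l + (l == j)%:Z]
  else [/\ forall l, (l < N)%N -> own' l = own l,
           forall l, (l < N)%N -> has' l = has l &
           forall l, (l < N)%N -> P' l = P l]].

Definition matched (own has : nat -> nat) : Prop :=
  (forall i, (i < N)%N -> (0 < has i)%N ->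
     exists2 j, (j < N)%N & has i = j.+1 /\ own j = i.+1) /\
  (forall j, (j < N)%N -> (0 < own j)%N ->
     exists2 i, (i < N)%N & own j = i.+1 /\ has i = j.+1).

(** The third clause is complementary slackness up to the increment 1. The last one is the progress
    measure: as long as somebody is unassigned, each round has raised the sum of the prices by 1. *)
Definition auction_inv (q : nat) (own has : nat -> nat) (P : nat -> int) : Prop :=
  [/\ matched own has,
      forall j, (j < N)%N -> 0 <= P j <= B /\ (own j = 0%N -> P j = 0),
      forall i j, (i < N)%N -> (j < N)%N -> has i = j.+1 ->
        forall l, (l < N)%N -> ben i l - P l <= ben i j - P j + 1 &
      (forall i, (i < N)%N -> (0 < has i)%N) \/ q%:Z <= \sum_(j < N) P j].

Lemma matched_full own has : matched own has ->
  (forall j, (j < N)%N -> (0 < own j)%N) -> forall i, (i < N)%N -> (0 < has i)%N.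
Proof.
move=> [_ h] full i iN.
have f_lt (j : 'I_N) : ((own j).-1 < N)%N.
  by have [i' ? [-> _]] := h j (ltn_ord j) (full j (ltn_ord j)).
pose f j := Ordinal (f_lt j).
have f_inj : injective f.
  move=> j1 j2 /(congr1 val) /=.
  have [i1 _ [-> e1]] := h j1 (ltn_ord j1) (full j1 (ltn_ord j1)).
  have [i2 _ [-> e2]] := h j2 (ltn_ord j2) (full j2 (ltn_ord j2)).
  by move=> /= e; apply/val_inj/eqP; rewrite -eqSS -e1 -e2 e.
have /codomP[j /(congr1 val) /= ->] := injF_onto f_inj (Ordinal iN).
by have [i1 _ [-> ->]] := h j (ltn_ord j) (full j (ltn_ord j)).
Qed.

Hypothesis ben_spread : forall i j l, (i < N)%N -> (j < N)%N -> (l < N)%N ->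
  ben i j - ben i l + 1 <= B.

Lemma auction_step_inv q own has P own' has' P' :
  auction_inv q own has P -> auction_step own has P own' has' P' -> auction_inv q.+1 own' has' P'.
Proof.
move=> [[m1 m2] hP hC hq] [i [iN pick]].
have [hi0|hi0] := eqVneq; last first.
  move=> [ownE hasE PE]; split.
  - split=> [l lN|l lN]; rewrite ?hasE ?ownE // => h.
      by have [j jN [? ?]] := m1 l lN h; exists j; rewrite ?ownE ?hasE.
    by have [j jN [? ?]] := m2 l lN h; exists j; rewrite ?ownE ?hasE.
  - by move=> j jN; rewrite PE // ownE //; apply: hP.
  - by move=> i' j iN' jN; rewrite hasE // => e l lN; rewrite !PE //; apply: hC.
  - left=> l lN; rewrite hasE // lt0n; apply/eqP => /(pick _ lN) e.
    by rewrite e in hi0.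
move=> [j [jN best ownE hasE PE]].
(* By counting, an unassigned person leaves an unassigned object [l0]. It still has price 0, and as
   [j] is preferred to it, the price of [j] is at most [B - 1]. *)
have [l0 l0N l00] : exists2 l, (l < N)%N & own l = 0%N.
  case: (pickP (fun l : 'I_N => own l == 0%N)) => [l /eqP e|no]; first by exists l.
  suff: (0 < has i)%N by rewrite hi0.
  apply: (matched_full (conj m1 m2)) iN => l lN.
  by rewrite lt0n; have := no (Ordinal lN) => /= ->.
have PjB : P j + 1 <= B.
  have := best l0 l0N; have [_ /(_ l00) ->] := hP l0 l0N.
  by have := @ben_spread i j l0 iN jN l0N; lia.
have own_ne l : (l < N)%N -> (0 < own l)%N -> own l != i.+1.
  move=> lN h; have [i' i'N [-> e]] := m2 l lN h.
  by rewrite eqSS; apply/eqP => e'; rewrite e' hi0 in e.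
have injo l l' i' : (l < N)%N -> (l' < N)%N -> own l = i'.+1 -> own l' = i'.+1 -> l = l'.
  move=> lN lN' e e'.
  have [|a _ [ea ha]] := m2 l lN; first by rewrite e.
  have [|b _ [eb hb]] := m2 l' lN'; first by rewrite e'.
  by apply/eqP; rewrite -eqSS -ha -hb; apply/eqP; congr has; apply/eqP; rewrite -eqSS -ea -eb e e'.
split.
- split=> [l lN|l lN].
    rewrite hasE //; case: eqP => [->|li] => [_|].
      by exists j => //; rewrite ownE // eqxx.
    case: eqP => // oj h; have [l' lN' [e1 e2]] := m1 l lN h.
    exists l' => //; split=> //; rewrite ownE //; case: eqP => // e.
    by rewrite e in e2.
  rewrite ownE //; case: eqP => [->|lj] => [_|h].
    by exists i => //; rewrite hasE // eqxx.
  have [i' iN' [e1 e2]] := m2 l lN h.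
  exists i' => //; split=> //; rewrite hasE //; case: eqP => [e|_].
    by rewrite e hi0 in e2.
  case: eqP => // e; case: lj; exact: injo e1 e.
- move=> l lN; rewrite PE // ownE //; have [/andP[P0 PB] Po] := hP l lN.
  case: eqP => [e|_] /=; last by rewrite addr0 P0 PB.
  by split=> //; rewrite e in P0 PB *; apply/andP; split; lia.
- move=> i' j' iN' jN'; rewrite hasE // => e l lN; rewrite !PE //.
  move: e; case: eqP => [-> [<-]|_].
    by rewrite eqxx; have := best l lN; case: (l == j) => /=; lia.
  case: eqP => // oj e; have := hC i' j' iN' jN' e l lN.
  case: (j' =P j) => [e'|_]; last by case: (l == j) => /=; lia.
  have [|j2 _ [e2 o2]] := m1 i' iN'; first by rewrite e.
  by move: e2; rewrite e e' => -[e2]; rewrite -e2 in o2.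
- right; case: hq => [all|h]; first by have := all i iN; rewrite hi0.
  under eq_bigr do rewrite PE //.
  rewrite big_split /= -addn1 PoszD lerD //.
  by rewrite (bigD1 (Ordinal jN)) //= eqxx lerDl sumr_ge0.
Qed.

Lemma auction_done q own has P : (N%:Z * B < q%:Z) -> auction_inv q own has P ->
  forall i, (i < N)%N -> (0 < has i)%N.
Proof.
move=> hq [_ hP _ []] // h; suff : \sum_(j < N) P j <= N%:Z * B by lia.
apply: (@le_trans _ _ (\sum_(j < N) B)).
  by apply: ler_sum => j _; have [/andP[]] := hP j (ltn_ord j).
by rewrite sumr_const card_ord -mulr_natl natz.
Qed.

(** Adding the slack 1 to the profit of every person makes the dual solution exactly feasible, at a
    total price of [N]. *)
Lemma auction_dual q own has P : (N%:Z * B < q%:Z) -> auction_inv q own has P ->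
  exists2 pi : nat -> int,
    (forall i l, (i < N)%N -> (l < N)%N -> ben i l <= pi i + P l) &
    \sum_(i < N) (pi i + P i) = \sum_(j < N) ben (own j).-1 j + N%:Z.
Proof.
move=> hq inv; have full := auction_done hq inv; case: inv => -[m1 m2] hP hC _.
exists (fun i => ben i (has i).-1 - P (has i).-1 + 1).
  move=> i l iN lN; have [j jN [e _]] := m1 i iN (full i iN).
  by have := hC i j iN jN e l lN; rewrite e /=; lia.
have s_lt (i : 'I_N) : ((has i).-1 < N)%N.
  by have [j jN [-> _]] := m1 i (ltn_ord i) (full i (ltn_ord i)).
pose s i := Ordinal (s_lt i).
have ownE (i : 'I_N) : own (s i) = i.+1.
  by rewrite /s /=; have [j jN [-> ]] := m1 i (ltn_ord i) (full i (ltn_ord i)).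
have s_inj : injective s.
  by move=> i1 i2 e; apply/val_inj/eqP; rewrite -eqSS -!ownE e.
(* Summing objects in the order of their owners makes the prices cancel. *)
rewrite big_split /= [in RHS](reindex_inj s_inj) [X in _ + X](reindex_inj s_inj).
rewrite -big_split /=.
have -> : N%:Z = \sum_(i < N) 1 by rewrite sumr_const card_ord natz.
rewrite -big_split /=.
apply: eq_bigr => i _; rewrite -[(has i).-1]/(val (s i)) ownE /=; lia.
Qed.

End Auction.

(** * Packing paths in the contact graph *)

Section PathPacking.
Variables (n k : nat) (lam : nat -> int) (edge : nat -> nat -> bool) (R : nat -> rat).
Hypothesis kn : (k <= n)%N.
Hypothesis lam_ge0 : forall v, 0 <= lam v.
Hypothesis lam_sum : \sum_(v < n) lam v <= n%:Z.

(* Persons [i < n] leave vertex [i] and persons [n + i] with [i < k] are the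
   sources of the paths; objects [j < n] enter vertex [j] and the objects
   [n + j] are the sinks.  An unused vertex is assigned to itself. *)
Definition pack_allowed (i j : nat) : bool :=
  if (i < n)%N then edge i j else (i < n + k)%N.

(** The penalty [n + 1] exceeds the total weight, which is at most [n], so an assignment of
    nonnegative value contains no forbidden pair. *)
Definition pack_benefit (i j : nat) : int :=
  if (j < n)%N then
    if i == j then 0 else if pack_allowed i j then lam j else - n.+1%:Z
  else 0.

(* The auction loses less than [pack_scale] in total, that is, less than one unit
   of the scaled benefits. *)
Definition pack_scale : nat := (n + n).+1.

Lemma lam_le v : (v < n)%N -> lam v <= n%:Z.
Proof.
move=> vn; apply: le_trans lam_sum.
by rewrite (bigD1 (Ordinal vn)) //= lerDl sumr_ge0.
Qed.

(** Benefits lie between [-(n + 1)] and [n], hence differ by at most [pack_scale]. The right side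
    serves as the price cap [B] of the auction. *)
Lemma pack_benefit_spread i j l :
  pack_scale%:Z * pack_benefit i j - pack_scale%:Z * pack_benefit i l + 1
    <= pack_scale%:Z * pack_scale%:Z + 1.
Proof.
rewrite -mulrBr lerD2r ler_pM2l // /pack_scale /pack_benefit.
have := @lam_le j; have := @lam_le l; have := lam_ge0 j; have := lam_ge0 l.
by case: ifP => _; case: ifP => _; do ?case: ifP => _ //; lia.
Qed.

Section Dual.
Variables pi P : nat -> int.
Hypothesis dual : forall i l, (i < n + n)%N -> (l < n + n)%N ->
  pack_scale%:Z * pack_benefit i l <= pi i + P l.

Lemma dual_diag_ge0 i : (i < n + n)%N -> 0 <= pi i + P i.
Proof.
move=> iN; have := dual iN iN.
by rewrite /pack_benefit eqxx; case: ifP; rewrite mulr0.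
Qed.

(* The vertices of [C], by decreasing radius, form a path of the contact graph:
   sum the dual constraints of its edges. *)
Lemma chain_last (C : {set 'I_n}) i : (n <= i < n + k)%N ->
  {in C &, forall v w : 'I_n, R v = R w -> v = w} ->
  {in C &, forall v w : 'I_n, R w < R v -> edge v w} -> C != set0 ->
  exists2 last, last \in C & (forall v, v \in C -> R last <= R v) /\
    \sum_(v in C) (pack_scale%:Z * lam v - (pi v + P v)) + pi last <= pi i.
Proof.
move=> ik; move: {2}#|C| (leqnn #|C|) => b; elim: b C => [|b IH] C.
  by rewrite leqn0 cards_eq0 => /eqP->; rewrite eqxx.
move=> Cb Rinj Redge /set0Pn[v0 v0C].
(* The vertex of least radius ends the path; the last vertex of the rest is its predecessor. *)
case: (arg_minP (fun v : 'I_n => R v) v0C) => l lC0 lmin.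
have lC : l \in C by exact: lC0.
exists l => //; split=> //.
have [C0|C0] := eqVneq (C :\ l) set0.
  rewrite (big_setD1 l) //= C0 big_set0 addr0.
  have := @dual i l; rewrite /pack_benefit ltn_ord /pack_allowed.
  have [-> ->] : (i < n)%N = false /\ (i < n + k)%N by lia.
  have -> : (i == l) = false by have := ltn_ord l; lia.
  by have := ltn_ord l; lia.
have sub v : v \in C :\ l -> v \in C by rewrite inE => /andP[].
have [|||l' l'C [l'min l'sum]] := IH (C :\ l) _ _ _ C0.
- by move: Cb; rewrite (cardsD1 l) lC.
- by move=> v w /sub vC /sub wC; apply: Rinj.
- by move=> v w /sub vC /sub wC; apply: Redge.
have l'l : R l < R l'.
  rewrite lt_neqAle (lmin l' (sub _ l'C)) andbT; apply/eqP => /(Rinj _ _ lC (sub _ l'C)) e.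
  by move: l'C; rewrite e !inE eqxx.
rewrite (big_setD1 l) //=.
have := @dual l' l; rewrite /pack_benefit ltn_ord /pack_allowed ltn_ord.
rewrite (Redge _ _ (sub _ l'C) lC l'l).
have -> : (l' == l :> nat) = false by apply/eqP => /val_inj e; rewrite e ltxx in l'l.
have := ltn_ord l; have := ltn_ord l'; move: l'sum.
by move: (\sum_(v in C :\ l) _) => S; lia.
Qed.

(** The path is closed at the sink [j] with benefit 0, which disposes of [pi last]; if [C] is empty,
    the source goes straight to the sink. *)
Lemma chain_dual (C : {set 'I_n}) i j : (n <= i < n + k)%N -> (n <= j < n + n)%N ->
  {in C &, forall v w : 'I_n, R v = R w -> v = w} ->
  {in C &, forall v w : 'I_n, R w < R v -> edge v w} ->
  \sum_(v in C) (pack_scale%:Z * lam v - (pi v + P v)) <= pi i + P j.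
Proof.
move=> ik jn Rinj Redge.
have sink i' : (i' < n + n)%N -> 0 <= pi i' + P j.
  move=> iN; have := @dual i' j; rewrite /pack_benefit.
  have -> : (j < n)%N = false by lia.
  by rewrite mulr0; apply=> //; lia.
have [->|C0] := eqVneq C set0; first by rewrite big_set0; apply: sink; lia.
have [l lC [_ h]] := chain_last ik Rinj Redge C0.
by have := sink l; have := ltn_ord l; lia.
Qed.

(** Weak duality for the fractional packing [X]. The price [z v] of a vertex pays for coverage
    truncated at [q], and the reduced weight [pos v] pays for the rest. A center collects reduced
    weight along a single chain, which a source and a sink can pay for. *)
Lemma dual_bound (q : nat) (X : nat -> int) (c : nat -> nat -> bool) :
  (forall u, (u < n)%N -> 0 <= X u) -> \sum_(u < n) X u = q%:Z ->
  (forall u v w, (u < n)%N -> (v < n)%N -> (w < n)%N -> lam v != 0 -> lam w != 0 ->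
     c u v -> c u w -> R v = R w -> v = w) ->
  (forall u v w, (u < n)%N -> (v < n)%N -> (w < n)%N ->
     c u v -> c u w -> R w < R v -> edge v w) ->
  pack_scale%:Z * \sum_(v < n) lam v * Num.min q%:Z (k%:Z * load n c X v)
    <= q%:Z * \sum_(i < n + n) (pi i + P i).
Proof.
move=> X0 Xq chainR chainE.
pose z v := pi v + P v.
have z0 v : (v < n)%N -> 0 <= z v by move=> vn; apply: dual_diag_ge0; lia.
pose pos v := Num.max 0 (pack_scale%:Z * lam v - z v).
have pos0 v : 0 <= pos v by rewrite le_max lexx.
have load0 v : 0 <= load n c X v by apply: sumr_ge0 => u _; rewrite mulr_ge0 ?X0.
(* If [l >= z], split [l = z + (l - z)] and bound the minimum by [q] in the first part and by [L] in
   the second. *)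
have vertex v : (v < n)%N ->
    pack_scale%:Z * (lam v * Num.min q%:Z (k%:Z * load n c X v)) <=
    q%:Z * z v + pos v * (k%:Z * load n c X v).
  move=> vn; have := z0 v vn; have := load0 v; have := lam_ge0 v.
  move: (k%:Z * _) (mulr_ge0 (isT : 0 <= k%:Z) (load0 v)) => L L0.
  have l0 : 0 <= pack_scale%:Z * lam v by rewrite mulr_ge0.
  rewrite /pos mulrA; move: (pack_scale%:Z * lam v) l0 => l l0 _ _ zv.
  by rewrite minEle maxEle; do 2?case: ifP; nia.
set Z := \sum_(i < n) (pi (n + i)%N + P (n + i)%N).
(* Each of the [k] sources, paired with the sink of the same index, bounds the chain of [u]; the
   other pairs of [Z] are nonnegative by [dual_diag_ge0]. *)
have facility u : (u < n)%N -> k%:Z * \sum_(v < n) (c u v)%:Z * pos v <= Z.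
  move=> un; pose C := [set v : 'I_n | c u v && (z v < pack_scale%:Z * lam v)].
  have -> : \sum_(v < n) (c u v)%:Z * pos v =
      \sum_(v in C) (pack_scale%:Z * lam v - (pi v + P v)).
    rewrite [RHS]big_mkcond /=; apply: eq_bigr => v _; rewrite inE /pos /z.
    case: (c u v); rewrite ?mul0r // mul1r /= maxEle.
    by case: ltP => ?; case: ifP; lia.
  have lam0 v : v \in C -> lam v != 0.
    rewrite inE => /andP[_]; have := z0 v (ltn_ord v).
    by case: eqP => // ->; rewrite mulr0; lia.
  have -> : forall x, k%:Z * x = \sum_(i < k) x.
    by move=> x; rewrite sumr_const card_ord -mulr_natl natz.
  rewrite (big_ord_widen n (fun _ => _) kn) big_mkcond /=.
  apply: ler_sum => i _; case: ifP => ik; last by apply: dual_diag_ge0; rewrite ltn_add2l.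
  apply: chain_dual.
  - by rewrite leq_addr ltn_add2l.
  - by rewrite leq_addr ltn_add2l ltn_ord.
  - move=> v w vC wC Rvw; apply/val_inj/(@chainR u v w); rewrite ?ltn_ord ?lam0 //.
      by move: vC; rewrite inE => /andP[].
    by move: wC; rewrite inE => /andP[].
  - move=> v w; rewrite !inE => /andP[cv _] /andP[cw _].
    exact: (@chainE u).
rewrite mulr_sumr; apply: (@le_trans _ _ (\sum_(v < n)
   (q%:Z * z v + pos v * (k%:Z * load n c X v)))).
  by apply: ler_sum => v _; apply: vertex.
rewrite big_split_ord /= mulrDr big_split /= -mulr_sumr lerD //.
have -> : \sum_(v < n) pos v * (k%:Z * load n c X v) =
    \sum_(u < n) X u * (k%:Z * \sum_(v < n) (c u v)%:Z * pos v).
  under eq_bigr do rewrite /load !mulr_sumr.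
  under [RHS]eq_bigr do rewrite !mulr_sumr.
  rewrite exchange_big /=; apply: eq_bigr => u _; apply: eq_bigr => v _.
  by ring.
rewrite -Xq mulr_suml; apply: ler_sum => u _.
by rewrite ler_wpM2l ?X0 ?facility.
Qed.

End Dual.

Section Assignment.
Variables own has : nat -> nat.
Hypothesis match_own : matched (n + n) own has.
Hypothesis full : forall i, (i < n + n)%N -> (0 < has i)%N.

Lemma has_own i : (i < n + n)%N -> ((has i).-1 < n + n)%N /\ own (has i).-1 = i.+1.
Proof. by move=> iN; case: match_own => m1 _; have [j ? [-> ?]] := m1 i iN (full iN). Qed.

Lemma own_full j : (j < n + n)%N -> (0 < own j)%N.
Proof.
case: match_own => m1 m2; apply: (@matched_full (n + n) has own).
  by split.
by [].
Qed.

Lemma own_has j : (j < n + n)%N -> ((own j).-1 < n + n)%N /\ has (own j).-1 = j.+1.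
Proof.
by move=> jN; case: match_own => _ m2; have [i ? [-> ?]] := m2 j jN (own_full jN).
Qed.

Lemma pack_valueE :
  \sum_(j < n + n) pack_benefit (own j).-1 j = \sum_(j < n) pack_benefit (own j).-1 j.
Proof.
rewrite big_split_ord /= [X in _ + X]big1 ?addr0 // => j _.
by rewrite /pack_benefit ltnNge leq_addr.
Qed.

Lemma pack_value_le :
  \sum_(j < n + n) pack_benefit (own j).-1 j
    <= \sum_(v < n) (own v != v.+1)%:Z * lam v.
Proof.
rewrite pack_valueE; apply: ler_sum => v _; rewrite /pack_benefit ltn_ord.
have vN : (v < n + n)%N by have := ltn_ord v; lia.
have -> : ((own v).-1 == v) = (own v == v.+1) by have := own_full vN; lia.
by case: eqP => _; rewrite ?mul0r // mul1r; case: ifP => // _; have := lam_ge0 v; lia.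
Qed.

Lemma pack_ge0_allowed : 0 <= \sum_(j < n + n) pack_benefit (own j).-1 j ->
  forall v, (v < n)%N -> own v != v.+1 -> pack_allowed (own v).-1 v.
Proof.
rewrite pack_valueE => h v vn ov; apply/negPn/negP => bad.
have vN : (v < n + n)%N by lia.
have : \sum_(j < n) pack_benefit (own j).-1 j <= n%:Z - n.+1%:Z.
  apply: le_trans (_ : \sum_(j < n) lam j - n.+1%:Z <= _); last by rewrite lerB.
  rewrite (bigD1 (Ordinal vn)) //= [X in _ <= X - _](bigD1 (Ordinal vn)) //=.
  have -> : pack_benefit (own v).-1 v = - n.+1%:Z.
    rewrite /pack_benefit vn (negbTE bad) ifF //.
    by have := own_full vN; lia.
  have : \sum_(j < n | j != Ordinal vn) pack_benefit (own j).-1 j <=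
     \sum_(j < n | j != Ordinal vn) lam j.
    apply: ler_sum => j _; rewrite /pack_benefit ltn_ord.
    by have := lam_ge0 j; do 2?case: ifP => _ //; lia.
  have aux (x y l e : int) : 0 <= l -> x <= y -> - e + x <= l + y - e by lia.
  exact: aux (lam_ge0 v).
by lia.
Qed.

(* Every path has one source and one terminal vertex. *)
Lemma card_terminals : 0 <= \sum_(j < n + n) pack_benefit (own j).-1 j ->
  (#|[set v : 'I_n | (n < has v)%N]| <= k)%N.
Proof.
move=> h; have allowed := pack_ge0_allowed h.
pose A := [set v : 'I_n | (n < has v)%N].
pose E := [set v : 'I_n | (n < own v)%N].
have nN (v : 'I_n) : (v < n + n)%N by have := ltn_ord v; lia.
have ownI (v w : 'I_n) : own v = own w -> v = w.
  move=> e; apply/val_inj; have [_ a] := own_has (nN v); have [_ b] := own_has (nN w).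
  by apply/eqP; rewrite -eqSS -a -b e.
have EA : (#|~: E| <= #|~: A|)%N.
  pose f (v : 'I_n) : 'I_n := insubd v (own v).-1.
  have fE v : v \in ~: E -> f v = (own v).-1 :> nat.
    by rewrite !inE /f val_insubd => h1; rewrite ifT //; have := own_full (nN v); lia.
  have <- : #|[set f v | v in ~: E]| = #|~: E|.
    apply: card_in_imset => v w vE wE /(congr1 val) /=.
    rewrite (fE v) // (fE w) // => e; apply: ownI.
    by have := own_full (nN v); have := own_full (nN w); lia.
  apply/subset_leq_card/subsetP => _ /imsetP[v vE ->]; rewrite !inE fE //.
  by have [_ ->] := own_has (nN v); have := ltn_ord v; lia.
have AE : (#|A| <= #|E|)%N.
  by rewrite -(leq_add2r #|~: E|) cardsC -(cardsC A) leq_add2l.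
apply: leq_trans AE _.
have Ek v : v \in E -> ((own v).-1 - n < k)%N.
  rewrite inE => vE; have := allowed v (ltn_ord v); rewrite /pack_allowed.
  by have := ltn_ord v; case: ifP => ?; lia.
have [k0|k0] := posnP k.
  by rewrite k0 leqn0 cards_eq0; apply/eqP/setP => v; rewrite in_set0; apply/negP => /Ek; lia.
pose g (v : 'I_n) : 'I_k := insubd (Ordinal k0) ((own v).-1 - n)%N.
have gE v : v \in E -> g v = ((own v).-1 - n)%N :> nat.
  by move=> vE; rewrite /g val_insubd Ek.
rewrite -[k]card_ord -(@card_in_imset _ _ g E) ?max_card // => v w vE wE /(congr1 val) /=.
rewrite !gE // => e; apply: ownI; move: vE wE; rewrite !inE; lia.
Qed.

End Assignment.
End PathPacking.

(** * Dilation of the rounded solution *)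

Section Covering.
Variables (n t k m : nat) (D : nat -> nat -> rat) (R : nat -> rat) (alpha : rat)
  (fu : nat -> nat -> nat) (h : nat -> nat).
Hypothesis t2 : (2 <= t)%N.
Hypothesis kn : (k <= n)%N.
Hypothesis alpha_ge0 : 0 <= alpha.
Hypothesis D_self : forall u, D u u = 0.
Hypothesis D_sym : forall u v, D u v = D v u.
Hypothesis D_tri : forall u v w, D u w <= D u v + D v w.
Hypothesis R_gt0 : forall v, 0 < R v.
Hypothesis h_lt : forall v w, (v < n)%N -> (w < n)%N -> R w < R v -> (h w < h v)%N.
Hypothesis ht : forall v, (h v < t)%N.
Hypothesis fu_lt : forall v w, (v < n)%N -> (w < n)%N -> (fu v w < n)%N.

Definition covers (u v : nat) : bool := D u v <= alpha * R v.
Definition shares (v w : nat) : bool := covers (fu v w) v && covers (fu v w) w.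
Hypothesis fu_shares : forall u v w, (u < n)%N -> (v < n)%N -> (w < n)%N ->
  covers u v -> covers u w -> shares v w.
Definition descends (v w : nat) : bool := (R w < R v) && shares v w.
(* The center of a path lies in the balls of its last two vertices. *)
Definition center (own : nat -> nat) (v : nat) : nat :=
  if ((own v).-1 < n)%N then fu (own v).-1 v else v.
Definition solution (own has : nat -> nat) : {set 'I_n} :=
  [set u : 'I_n | [exists v : 'I_n, (n < has v)%N && (center own v == u)]].

(* With [j] smaller radii below it, a vertex on a path is within [detour j] times
   its own radius of the center. *)
Definition detour (j : nat) : nat := maxn 1 (j.*2).-1.

Lemma aR_ge0 v : 0 <= alpha * R v.
Proof. by rewrite mulr_ge0 // ltW. Qed.

Section Paths.
Variables own has : nat -> nat.
Hypothesis match_own : matched (n + n) own has.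
Hypothesis full : forall i, (i < n + n)%N -> (0 < has i)%N.
Hypothesis allowed : forall v, (v < n)%N -> own v != v.+1 ->
  pack_allowed n k descends (own v).-1 v.

Lemma center_covers v : (v < n)%N -> own v != v.+1 ->
  D v (center own v) <= alpha * R v.
Proof.
move=> vn ov; have := allowed vn ov; rewrite /center /pack_allowed.
case: ifP => _; last by rewrite D_self aR_ge0.
by rewrite D_sym => /andP[_ /andP[]].
Qed.

Lemma path_center v : (v < n)%N -> own v != v.+1 ->
  exists2 v', (v' < n)%N & (n < has v')%N /\
    D v (center own v') <= alpha * R v * (detour (h v))%:R.
Proof.
have [b] := ubnP (h v); elim: b v => // b IH v hb vn ov.
have vN : (v < n + n)%N by lia.
have det1 j : 1 <= (detour j)%:R :> rat by rewrite ler1n leq_max.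
have wid (x y : rat) j : 0 <= y -> x <= y -> x <= y * (detour j)%:R.
  by move=> y0 xy; apply: le_trans xy _; rewrite ler_peMr.
have [hv|hv] := ltnP n (has v).
  by exists v => //; split=> //; apply: wid (aR_ge0 v) _; apply: center_covers.
have next u : (u < n)%N -> own u != u.+1 -> (has u <= n)%N ->
    let w := (has u).-1 in
    [/\ (w < n)%N, own w = u.+1, own w != w.+1 & descends u w].
  move=> un ou hu w; have uN : (u < n + n)%N by lia.
  have [wN ow] := has_own match_own full uN; have hu0 := full uN.
  have wn : (w < n)%N by rewrite /w; lia.
  have ow' : own w != w.+1.
    rewrite ow eqSS; apply/eqP => e; move: ou; rewrite {1}e -/w.
    by rewrite ow eqxx.
  split=> //; have := allowed wn ow'.
  by rewrite ow /= /pack_allowed un.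
have [] := next v vn ov hv; set w := (has v).-1 => wn ow ow' /andP[Rwv /andP[cv cw]].
have hwv := h_lt vn wn Rwv.
have [hw|hw] := ltnP n (has w).
  exists w => //; split=> //; apply: wid (aR_ge0 v) _.
  by rewrite /center ow /= vn D_sym.
have [v' vn' [hv' Dw]] := IH w (leq_trans hwv hb) wn ow'.
exists v' => //; split=> //.
(* The successor of [w] has a smaller radius, so [h w >= 1]. This gives
   [detour (h w) + 2 <= detour (h v)], which may fail for [h w = 0]. *)
have [w2n _ _ /andP[Rw2 _]] := next w wn ow' hw.
have hw1 := h_lt wn w2n Rw2.
have Rle : alpha * R w <= alpha * R v by rewrite ler_wpM2l // ltW.
apply: le_trans (_ : alpha * R v + alpha * R v + alpha * R v * (detour (h w))%:R <= _).
  apply: le_trans (D_tri v w _) _; apply: lerD.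
    apply: le_trans (D_tri v (fu v w) w) _.
    by rewrite D_sym lerD // (le_trans cw).
  by apply: le_trans Dw _; rewrite ler_wpM2r.
rewrite -{1 2}[alpha * R v]mulr1 -!mulrDr ler_wpM2l ?aR_ge0 //.
by rewrite -(natrD _ 1 1) -natrD ler_nat /detour; lia.
Qed.

End Paths.

(** The data are arbitrary ones that satisfy the three loop invariants after enough rounds, so the
    rounding argument is independent of the program. *)
Theorem approximation_core (T q : nat) (W X Y : nat -> int) (WW : int)
    (par own has : nat -> nat) (P : nat -> int) (B : int) :
  ((n + n).+1 ^ 2 * (n.+1 ^ 3 * n ^ 2) < T)%N ->
  perceptron_inv n k m covers T W WW X Y ->
  cluster_inv n R shares (load n covers X) n par ->
  (n + n)%N%:Z * B < q%:Z ->
  auction_inv (n + n)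
    (fun i j => (pack_scale n)%:Z * pack_benefit n k (weight n par) descends i j)
    B q own has P ->
  (#|solution own has| <= k)%N /\
  (m <= #|[set w : 'I_n | [exists u in solution own has,
            (D w u <= (2 * t%:R - 1) * (alpha * R w))%R]]|)%N.
Proof.
move=> Tbig pI rI qbig aI.
have done_ := cluster_done rI; have full := auction_done qbig aI.
have mo : matched (n + n) own has by case: aI.
have [r1 r2 _ _] := rI.
have par1 w : (w < n)%N -> exists2 v, (v < n)%N & par w = v.+1.
  by move=> wn; have [v [vn e] _] := r1 w wn (done_ w wn); exists v.
pose f v : int := Num.min T%:Z (k%:Z * load n covers X v).
have lam0 := weight_ge0 n par.
have lam_sum : \sum_(v < n) weight n par v <= n%:Z.
  have := sum_weight (fun _ => 1) par1.
  rewrite (eq_bigr (fun v : 'I_n => weight n par v)) => [->|v _]; last by rewrite mulr1.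
  by rewrite sumr_const card_ord natz.
have rep v : (v < n)%N -> weight n par v != 0 -> par v = v.+1.
  move=> vn; apply: contraNeq => pv; rewrite /weight big1 // => w _.
  case: eqP => // e; have [v' [_ e'] [_ _ _ pv']] := r1 w (ltn_ord w) (done_ w (ltn_ord w)).
  by move: e'; rewrite e => -[ev]; rewrite ev pv' eqxx in pv.
have [pi dual dualE] := auction_dual qbig aI.
pose V : int := \sum_(j < n + n) pack_benefit n k (weight n par) descends (own j).-1 j.
have [[_ _ X0 XT] _] := pI.
have bound := dual_bound kn lam0 lam_sum dual X0 XT.
have Vm : m%:Z <= V.
  have {bound} := bound R covers.
  rewrite dualE -mulr_sumr -/V (sum_weight f par1) => bound.
  have {}bound : (pack_scale n)%:Z * \sum_(w < n) f (par w).-1 <=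
      T%:Z * ((pack_scale n)%:Z * V + (n + n)%N%:Z).
    apply: bound => [u v w un vn wn lv lw cv cw Rvw|u v w un vn wn cv cw Rwv].
      apply/eqP/negPn/negP => vw.
      by have := r2 v w vn wn (rep v vn lv) (rep w wn lw) vw Rvw; rewrite (fu_shares un).
    by rewrite /descends Rwv (fu_shares un).
  (* Here the greedy order matters: every point hands its share to a representative of at least the
     same load. *)
  have f_mono : \sum_(w < n) f w <= \sum_(w < n) f (par w).-1.
    apply: ler_sum => w _; have [v [vn ->] [_ _ scw _]] := r1 w (ltn_ord w) (done_ w (ltn_ord w)).
    rewrite /f /= le_min ge_min lexx /= ge_min; apply/orP; right.
    by rewrite ler_wpM2l.
  have := perceptron_load kn Tbig pI.
  rewrite -/f; move: (\sum_(w < n) f w) f_mono => S f_mono.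
  rewrite /pack_scale in bound *; move: V bound => V bound lt1.
  have : ((n + n).+1 * T)%N%:Z * m%:Z - T%:Z < T%:Z * ((n + n).+1%:Z * V + (n + n)%N%:Z).
    by apply: lt_le_trans bound; rewrite !PoszM in lt1 *; nia.
  have -> : ((n + n).+1 * T)%N%:Z * m%:Z - T%:Z = T%:Z * ((n + n).+1%:Z * m%:Z - 1).
    by rewrite PoszM; ring.
  have T0 : 0 < T%:Z by lia.
  rewrite (ltr_pM2l T0) => lt2.
  by rewrite leNgt; apply/negP => lt3; nia.
have V0 : 0 <= V by lia.
have allowed := pack_ge0_allowed kn lam0 lam_sum mo full V0.
split.
  apply: leq_trans (card_terminals kn lam0 lam_sum mo full V0).
  have sub : solution own has \subset
      [set insubd v (center own v) | v : 'I_n in [set v : 'I_n | (n < has v)%N]].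
    apply/subsetP => u; rewrite inE => /existsP[v /andP[hv /eqP e]].
    apply/imsetP; exists v; rewrite ?inE //.
    by apply/val_inj; rewrite val_insubd e ltn_ord.
  exact: leq_trans (subset_leq_card sub) (leq_imset_card _ _).
(* The value of the packing is at most the number of points whose representative is used by a
   path. *)
have : m%:Z <= \sum_(w < n) (own (par w).-1 != (par w).-1.+1)%:Z.
  apply: le_trans Vm _; apply: le_trans (pack_value_le _ kn lam0 lam_sum mo full) _.
  rewrite -(sum_weight (fun v => (own v != v.+1)%:Z) par1).
  by apply: ler_sum => v _; rewrite mulrC.
rewrite sumz_bool lez_nat => /leq_trans; apply.
apply/subset_leq_card/subsetP => w; rewrite !inE => ow.
have [v [vn e] [Rwv svw _ _]] := r1 w (ltn_ord w) (done_ w (ltn_ord w)).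
rewrite e /= in ow.
have [v' vn' [hv' Dv]] := path_center mo full allowed vn ow.
have cn : (center own v' < n)%N.
  rewrite /center; case: ifP => // h1.
  exact: fu_lt.
apply/existsP; exists (Ordinal cn); apply/andP; split.
  by rewrite inE; apply/existsP; exists (Ordinal vn'); rewrite /= hv' eqxx.
case/andP: svw => cv cw /=.
apply: le_trans (D_tri w v _) _.
apply: (@le_trans _ _ (alpha * R w + alpha * R v + alpha * R v * (detour (h v))%:R)).
  apply: lerD => //; apply: le_trans (D_tri w (fu v w) v) _.
  by rewrite D_sym lerD.
rewrite -Rwv -{1 2}[alpha * R w]mulr1 -!mulrDr [leRHS]mulrC ler_wpM2l ?aR_ge0 //.
(* As [h v <= t - 1] and [t >= 2], the detour is at most [2t - 3]; moving to the representative adds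
   2. *)
rewrite lerBrDr -(natrD _ 1 1) -natrM -natrD -(natrD _ _ 1) ler_nat /detour.
by have := ht v; lia.
Qed.

End Covering.

(** * The program *)

(** Only the index is stored and the value at it is recomputed, so [val] may contain products that
    [wf] would reject in a stored expression. *)
Definition argmax (x best c d : nat) (val : aexp -> aexp) : cmd :=
  CSeq (CSet best (Lit 0) (Lit 0))
    (CFor x c d
      (CIf (Bin OLeq (Bin OAdd (val (Arr best (Lit 0))) (Lit 1))
                     (val (Arr x (Lit 0))))
         (CSet best (Lit 0) (Arr x (Lit 0))) CSkip)).

Definition sumcmd (x acc c d : nat) (e : aexp) : cmd :=
  CSeq (CSet acc (Lit 0) (Lit 0))
    (CFor x c d (CSet acc (Lit 0) (Bin OAdd (Arr acc (Lit 0)) e))).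

Definition agree (l : seq nat) (s s' : state) : Prop :=
  forall a, a \notin l -> s' a = s a.

Lemma agree_sub l1 l2 s1 s2 : {subset l1 <= l2} -> agree l1 s1 s2 -> agree l2 s1 s2.
Proof. by move=> l12 h a al2; apply: h; apply: contra al2 => /l12. Qed.

Lemma agree_den inp c s : agree (writes c) s (den inp c s).
Proof. by move=> a; exact: den_frame. Qed.

Lemma agree_upd x i z s : agree [:: x] s (upd s x i z).
Proof. by move=> a; rewrite inE => ax; rewrite upd_neq. Qed.

Lemma forloop_inv (x N : nat) (f : state -> state) (I : nat -> state -> Prop) s :
  I 0%N (upd s x 0 0) ->
  (forall i s', (i < N)%N -> s' x 0%N = i%:Z -> I i s' ->
     I i.+1 (upd (f s') x 0 i.+1%:Z)) ->
  I N (forloop x N f s).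
Proof.
move=> I0 step; rewrite /forloop.
set st := fun i => iteri i (fun i s => upd (f s) x 0 i.+1%:Z) (upd s x 0 0).
rewrite -/(st N); have : forall i, (i <= N)%N -> I i (st i).
  elim=> [|i IH] iN; first exact: I0.
  apply: (step i (st i)) => //; last by apply: IH; lia.
  by case: (i) => [|j]; rewrite /st /= upd_eq.
by apply.
Qed.

Section LoopSpecs.
Variable inp : nat -> int.
Local Notation n := `|inp 0%N|%N.

Lemma argmax_correct x best c d val s (f : nat -> int) :
  x != best -> (0 < c * n ^ d)%N ->
  (forall s' y i, agree [:: x; best] s s' -> y \in [:: x; best] ->
     (i < c * n ^ d)%N -> s' y 0%N = i%:Z -> ev inp s' (val (Arr y (Lit 0))) = f i) ->
  exists b, [/\ (b < c * n ^ d)%N, forall i, (i < c * n ^ d)%N -> f i <= f b &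
    den inp (argmax x best c d val) s best 0%N = b%:Z].
Proof.
move=> xb N0 valE; set N := (c * n ^ d)%N in N0 valE *.
pose I i s' := agree [:: x; best] s s' /\
  exists b, [/\ (b < N)%N, s' best 0%N = b%:Z & forall j, (j < i)%N -> f j <= f b].
suff [_ [b [bN e h]]] : I N (den inp (argmax x best c d val) s) by exists b.
apply: (@forloop_inv x N _ I (upd s best 0 0)).
- split.
    by move=> a; rewrite !inE negb_or => /andP[ax ab]; rewrite !upd_neq.
  by exists 0%N; split=> //; rewrite upd_neq 1?eq_sym // upd_eq.
- move=> i s' iN xi [ag [b [bN sb hb]]].
  have e1 : ev inp s' (val (Arr best (Lit 0))) = f b.
    by apply: valE => //; rewrite !inE eqxx orbT.
  have e2 : ev inp s' (val (Arr x (Lit 0))) = f i.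
    by apply: valE => //; rewrite !inE eqxx.
  rewrite /= e1 e2; split.
    move=> a al; move: (al); rewrite !inE negb_or => /andP[ax ab].
    by rewrite upd_neq //; case: ifP => _; rewrite ?upd_neq // ag.
  case: ifP => [|/negbT]; case: ifP => //= lt _.
    exists i; split=> //; first by rewrite upd_neq 1?eq_sym // upd_eq.
    by move=> j; rewrite ltnS leq_eqVlt => /orP[/eqP->//|/hb]; lia.
  exists b; split=> //; first by rewrite upd_neq 1?eq_sym.
  by move=> j; rewrite ltnS leq_eqVlt => /orP[/eqP->|/hb]; lia.
Qed.

Lemma sumcmd_correct x acc c d e s (f : nat -> int) :
  x != acc ->
  (forall s' i, agree [:: x; acc] s s' -> (i < c * n ^ d)%N -> s' x 0%N = i%:Z ->
     ev inp s' e = f i) ->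
  den inp (sumcmd x acc c d e) s acc 0%N = \sum_(i < c * n ^ d) f i.
Proof.
move=> xa eE; set N := (c * n ^ d)%N in eE *.
pose I i s' := agree [:: x; acc] s s' /\ s' acc 0%N = \sum_(j < i) f j.
suff [_ ->] : I N (den inp (sumcmd x acc c d e) s) by [].
apply: (@forloop_inv x N _ I (upd s acc 0 0)).
- split; last by rewrite big_ord0 upd_neq 1?eq_sym // upd_eq.
  by move=> a; rewrite !inE negb_or => /andP[ax ab]; rewrite !upd_neq.
- move=> i s' iN xi [ag h]; split.
    move=> a al; move: (al); rewrite !inE negb_or => /andP[ax ab].
    by rewrite !upd_neq // ag.
  by rewrite /= upd_neq 1?eq_sym // upd_eq h (eE _ i) // big_ord_recr.
Qed.

(** The premise that the entries from [i] on are still the initial ones serves updates in place, as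
    for [vW] and [vPAR]. *)
Lemma map_correct x A c d body s (Q : nat -> int -> Prop) :
  A != x ->
  (forall s' i, agree (x :: writes body) s s' -> (i < c * n ^ d)%N -> s' x 0%N = i%:Z ->
     (forall j, (i <= j)%N -> s' A j = s A j) ->
     exists2 z, Q i z & forall j, den inp body s' A j = if j == i then z else s' A j) ->
  forall i, (i < c * n ^ d)%N -> Q i (den inp (CFor x c d body) s A i).
Proof.
move=> Ax h; set N := (c * n ^ d)%N in h *.
pose I i s' := [/\ agree (x :: writes body) s s', forall j, (i <= j)%N -> s' A j = s A j &
  forall j, (j < i)%N -> Q j (s' A j)].
suff [] : I N (den inp (CFor x c d body) s) by [].
apply: (@forloop_inv x N (den inp body) I s).
- split=> [a|j _|//]; last by rewrite upd_neq.
  by rewrite inE negb_or => /andP[ax _]; rewrite upd_neq.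
- move=> i s' iN xi [ag same IA]; have [z Qz E] := h s' i ag iN xi same; split.
  + move=> a al; move: (al); rewrite inE negb_or => /andP[ax ab].
    by rewrite upd_neq // den_frame // ag.
  + move=> j ij; rewrite upd_neq // E; case: eqP => [e|_]; [lia|by apply: same; lia].
  + move=> j ji; rewrite upd_neq // E; case: eqP => [->//|e]; apply: IA; lia.
Qed.

Lemma iter_correct x c d body s (J : nat -> state -> Prop) :
  (forall i s1 s2, agree [:: x] s1 s2 -> J i s1 -> J i s2) ->
  J 0%N s ->
  (forall i s', agree (x :: writes body) s s' -> J i s' -> J i.+1 (den inp body s')) ->
  J (c * n ^ d)%N (den inp (CFor x c d body) s).
Proof.
move=> stable J0 step.
pose I i s' := agree (x :: writes body) s s' /\ J i s'.
suff [] : I (c * n ^ d)%N (den inp (CFor x c d body) s) by [].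
apply: (@forloop_inv x _ (den inp body) I s).
- split; last exact: stable _ _ _ (@agree_upd _ _ _ _) J0.
  by apply: (agree_sub _ (@agree_upd x 0 0 s)) => a; rewrite !inE => ->.
- move=> i s' _ _ [ag Ji]; split; last exact: stable _ _ _ (@agree_upd _ _ _ _) (step i s' ag Ji).
  move=> a al; move: (al); rewrite inE negb_or => /andP[ax ab].
  by rewrite upd_neq // den_frame // ag.
Qed.

End LoopSpecs.

Declare Scope aexp_scope.
Delimit Scope aexp_scope with aexp.
Bind Scope aexp_scope with aexp.
Notation "x + y" := (Bin OAdd x y) : aexp_scope.
Notation "x - y" := (Bin OSub x y) : aexp_scope.
Notation "x * y" := (Bin OMul x y) : aexp_scope.
Notation "x %/ y" := (Bin ODiv x y) : aexp_scope.
Notation "x %% y" := (Bin OMod x y) : aexp_scope.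
Notation "x <= y" := (Bin OLeq x y) : aexp_scope.
Notation "x < y" := (Bin OLeq (Bin OAdd x (Lit 1)) y) : aexp_scope.
Notation "~~ x" := (Bin OSub (Lit 1) x) : aexp_scope.
Notation "# z" := (Lit (Posz z%N)) (at level 1, format "# z") : aexp_scope.
Notation "$ a" := (Arr a (Lit 0)) (at level 1, format "$ a") : aexp_scope.

Declare Scope cmd_scope.
Delimit Scope cmd_scope with cmd.
Bind Scope cmd_scope with cmd.
Notation "a [ e ] ::= e'" := (CSet a e%aexp e'%aexp)
  (at level 70, e at next level, no associativity) : cmd_scope.
Notation "a ::= e'" := (CSet a (Lit 0) e'%aexp)
  (at level 70, no associativity) : cmd_scope.
Notation "c1 ;; c2" := (CSeq c1 c2) (at level 90, right associativity) : cmd_scope.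

(* Arrays are named after their mathematical counterparts: the perceptron uses
   [W], [WW] and [X], clusters are [PAR] and [LAM], and the auction has prices [P]
   and assignment [OWN], [HAS].  The guess is the dilation of the pair [(A, B)],
   and [(BA, BB)] is the best successful guess so far, with solution [RES]. *)
Definition vIN := 0%N.    Definition vPQ := 1%N.   Definition vA := 2%N.
Definition vB := 3%N.     Definition vC := 4%N.    Definition vFU := 5%N.
Definition vW := 6%N.     Definition vWW := 7%N.   Definition vX := 8%N.
Definition vSM := 9%N.    Definition vK := 10%N.   Definition vI := 11%N.
Definition vJ := 12%N.    Definition vIT := 13%N.  Definition vACC := 14%N.
Definition vU := 15%N.    Definition vXS := 16%N.  Definition vPAR := 17%N.
Definition vLAM := 18%N.  Definition vBEN := 19%N. Definition vP := 20%N.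
Definition vOWN := 21%N.  Definition vHAS := 22%N. Definition vBI := 23%N.
Definition vBJ := 24%N.   Definition vSOL := 25%N. Definition vSZ := 26%N.
Definition vY := 27%N.    Definition vCNT := 28%N. Definition vFND := 29%N.
Definition vBA := 30%N.   Definition vBB := 31%N.  Definition vRES := 32%N.
Definition vOUT := 33%N.
Definition narrays := 34%N.

Section Program.
Local Open Scope aexp_scope.

Definition en : aexp := Arr vIN #0.
Definition ek : aexp := Arr vIN #1.
Definition em : aexp := Arr vIN #2.

Definition erad (v : aexp) (j : nat) : aexp := Arr vIN (#3 + (v * #2 + #j)).
Definition edist (u v : aexp) (j : nat) : aexp :=
  Arr vIN (#3 + (en * #2 + (u * (en * #2) + (v * #2 + #j)))).

Definition erad_le (v w : aexp) : aexp :=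
  erad v 0 * erad w 1 <= erad w 0 * erad v 1.

(* [dist u v * rad x <= rho * (dist u' v' * rad y)], cross-multiplied. *)
Definition edist_le (rho : int) (u v x u' v' y : aexp) : aexp :=
  edist u v 0 * erad x 0 * (edist u' v' 1 * erad y 1)
    <= Lit rho * (edist u' v' 0 * erad y 0 * (edist u v 1 * erad x 1)).

Definition ecov (u v : aexp) : aexp := Arr vC (u * en + v).
Definition efu (v w : aexp) : aexp := Arr vFU (v * en + w).
Definition eshare (v w : aexp) : aexp := ecov (efu v w) v * ecov (efu v w) w.
(** A truth value computed by products becomes a comparison, the form that [additive] accepts as a
    left factor. *)
Definition etruth (e : aexp) : aexp := #1 <= e.
Definition eclamp (e : aexp) : aexp := (#0 <= e) * e.
Definition edesc (v w : aexp) : aexp := ~~ (erad_le v w) * eshare v w.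
Definition enn : aexp := en + en.

Local Open Scope cmd_scope.

Definition p_input : cmd := CFor vI 4 2 (vIN [ $vI ] ::= Inp $vI).

Definition p_cov : cmd :=
  CFor vI 1 2 (vC [ $vI ] ::=
    edist_le 1 ($vI %/ en) ($vI %% en) $vB $vA $vB ($vI %% en)).

(** Maximising a truth value finds a common center if there is one. Otherwise the entry is an
    arbitrary point, which [eshare] rejects. *)
Definition p_fu : cmd :=
  CFor vI 1 2
    (argmax vJ vU 1 1 (fun u => ecov u ($vI %/ en) * ecov u ($vI %% en)) ;;
     vFU [ $vI ] ::= $vU).

Definition p_percep_init : cmd :=
  CFor vI 1 1 (vW [ $vI ] ::= #0) ;;
  CFor vI 1 1 (vX [ $vI ] ::= #0) ;;
  vWW ::= #0 ;;
  CIf (en <= ek) (vK ::= en) (vK ::= ek).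

(** The order matters: [vACC] is computed before [vW] changes, and [vWW] changes last, since all
    updates refer to the old multipliers. *)
Definition p_percep_step : cmd :=
  CFor vI 1 1
    (sumcmd vJ vACC 1 1 (etruth (ecov $vI $vJ) * Arr vW $vJ) ;;
     vSM [ $vI ] ::= $vACC) ;;
  argmax vI vU 1 1 (fun u => Arr vSM u) ;;
  vX [ $vU ] ::= Arr vX $vU + #1 ;;
  sumcmd vI vACC 1 1 (Arr vW $vI < $vWW) ;;
  CFor vI 1 1 (vW [ $vI ] ::=
    eclamp (Arr vW $vI + (Arr vW $vI < $vWW) - etruth (ecov $vU $vI) * $vK)) ;;
  vWW ::= eclamp ($vWW + em - $vACC).

Definition p_load : cmd :=
  CFor vI 1 1
    (sumcmd vJ vACC 1 1 (etruth (ecov $vJ $vI) * Arr vX $vJ) ;;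
     vXS [ $vI ] ::= $vACC) ;;
  CFor vI 1 1 (vPAR [ $vI ] ::= #0).

(** The added 1 puts unassigned points of load 0 ahead of the assigned ones, whose value is 0. *)
Definition p_cluster_step : cmd :=
  argmax vI vU 1 1 (fun v => (Arr vPAR v <= #0) * (Arr vXS v + #1)) ;;
  CFor vI 1 1 (vPAR [ $vI ] ::= Arr vPAR $vI +
    etruth ((Arr vPAR $vI <= #0) * (erad_le $vI $vU * erad_le $vU $vI
            * eshare $vU $vI)) * ($vU + #1)).

Definition p_weight : cmd :=
  CFor vI 1 1
    (sumcmd vJ vACC 1 1
       ((Arr vPAR $vJ <= $vI + #1) * ($vI + #1 <= Arr vPAR $vJ)) ;;
     vLAM [ $vI ] ::= $vACC).

Definition eallowed (i j : aexp) : aexp :=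
  (i < en) * edesc i j + (en <= i) * (i < en + $vK).

Definition eoff (i j : aexp) : aexp :=
  (j < en) * ~~ ((i <= j) * (j <= i)).

(** Benefits are stored unscaled because scaling is a product of two variable quantities; [p_bid]
    scales them inside [argmax], where nothing but an index is stored. *)
Definition p_benefit : cmd :=
  CFor vI 4 2 (vBEN [ $vI ] ::=
    etruth (eoff ($vI %/ enn) ($vI %% enn) * eallowed ($vI %/ enn) ($vI %% enn))
      * Arr vLAM ($vI %% enn)
    - etruth (eoff ($vI %/ enn) ($vI %% enn) * ~~ (eallowed ($vI %/ enn) ($vI %% enn)))
      * (en + #1)).

Definition p_auction_init : cmd :=
  CFor vI 2 1 (vP [ $vI ] ::= #0) ;;
  CFor vI 2 1 (vOWN [ $vI ] ::= #0) ;;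
  CFor vI 2 1 (vHAS [ $vI ] ::= #0).

(** The previous owner has to be released while [vOWN] still names it. *)
Definition p_bid : cmd :=
  argmax vI vBI 2 1 (fun i => Arr vHAS i <= #0) ;;
  CIf (Arr vHAS $vBI <= #0)
    (argmax vI vBJ 2 1
       (fun j => (enn + #1) * Arr vBEN ($vBI * enn + j) - Arr vP j) ;;
     CIf (#1 <= Arr vOWN $vBJ) (vHAS [ Arr vOWN $vBJ - #1 ] ::= #0) CSkip ;;
     vOWN [ $vBJ ] ::= $vBI + #1 ;;
     vHAS [ $vBI ] ::= $vBJ + #1 ;;
     vP [ $vBJ ] ::= Arr vP $vBJ + #1)
    CSkip.

Definition p_centers : cmd :=
  CFor vI 1 1 (vSOL [ $vI ] ::= #0) ;;
  CFor vI 1 1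
    (CIf (en < Arr vHAS $vI)
       (vSOL [ (Arr vOWN $vI <= en) * efu (Arr vOWN $vI - #1) $vI
               + (en < Arr vOWN $vI) * $vI ] ::= #1)
       CSkip).

Definition p_solve : cmd :=
  p_cov ;; p_fu ;; p_percep_init ;; CFor vIT 1 15 p_percep_step ;;
  p_load ;; CFor vIT 1 1 p_cluster_step ;; p_weight ;;
  p_benefit ;; p_auction_init ;; CFor vIT 1 15 p_bid ;; p_centers.

Definition p_check (rho : int) : cmd :=
  sumcmd vI vSZ 1 1 (Arr vSOL $vI) ;;
  CFor vI 1 1
    (argmax vJ vU 1 1
       (fun u => Arr vSOL u * edist_le rho $vI u $vB $vA $vB $vI) ;;
     vY [ $vI ] ::= etruth (Arr vSOL $vU * edist_le rho $vI $vU $vB $vA $vB $vI)) ;;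
  sumcmd vI vCNT 1 1 (Arr vY $vI) ;;
  CIf ((($vSZ <= ek) * (em <= $vCNT)) *
       (($vFND <= #0) + ~~ (edist_le 1 $vBA $vBB $vB $vA $vB $vBB)))
    (CFor vI 1 1 (vRES [ $vI ] ::= Arr vSOL $vI) ;;
     vFND ::= #1 ;; vBA ::= $vA ;; vBB ::= $vB)
    CSkip.

Definition p_main (rho : int) : cmd :=
  p_input ;;
  CFor vPQ 1 2
    (vA ::= $vPQ %/ en ;; vB ::= $vPQ %% en ;; p_solve ;; p_check rho).

End Program.

Lemma p_main_wf rho : wf narrays (p_main rho).
Proof. by []. Qed.

(** * Correctness of the program *)

Lemma evB inp s o e1 e2 : ev inp s (Bin o e1 e2) = op_sem o (ev inp s e1) (ev inp s e2).
Proof. by []. Qed.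

Lemma evA inp s a e : ev inp s (Arr a e) = s a `|ev inp s e|%N.
Proof. by []. Qed.

Lemma evL inp s z : ev inp s (Lit z) = z.
Proof. by []. Qed.

Lemma denS inp c1 c2 s : den inp (CSeq c1 c2) s = den inp c2 (den inp c1 s).
Proof. by []. Qed.

Lemma den_set_var inp s A x e (i : nat) : s x 0%N = i%:Z ->
  forall j, den inp (CSet A (Arr x (Lit 0)) e) s A j = if j == i then ev inp s e else s A j.
Proof. by move=> xi j; rewrite /= xi absz_nat /upd eqxx. Qed.

Lemma op_leq (x y : int) : op_sem OLeq x y = (x <= y)%R%:Z.
Proof. by rewrite /=; case: ifP. Qed.

Lemma mulz_bool (a b : bool) : a%:Z * b%:Z = (a && b)%:Z.
Proof. by case: a; case: b. Qed.

Lemma subz_bool (a : bool) : 1 - a%:Z = (~~ a)%:Z.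
Proof. by case: a. Qed.

Lemma truth_bool (a : bool) : (1 <= a%:Z)%R = a.
Proof. by case: a. Qed.

Lemma divmod_lt i d : (i < d * d)%N -> (i %/ d < d)%N /\ (i %% d < d)%N.
Proof.
move=> h; have d0 : (0 < d)%N by nia.
by rewrite ltn_divLR // ltn_pmod.
Qed.

Lemma index_lt u v d : (u < d)%N -> (v < d)%N -> (u * d + v < d * d)%N.
Proof. nia. Qed.

Lemma index_divmod u v d : (v < d)%N ->
  ((u * d + v) %/ d = u)%N /\ ((u * d + v) %% d = v)%N.
Proof.
move=> vd; have d0 : (0 < d)%N by lia.
by rewrite divnMDl // divn_small // addn0 modnMDl modn_small.
Qed.

(** * The input data as seen by the program *)

Section Spec.
Variables (I : instance) (t : nat).
Hypothesis t2 : (2 <= t)%N.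
Local Notation n := (npts I).
Hypothesis n2 : (2 <= n)%N.

Lemma n_gt0 : (0 < n)%N. Proof. exact: leq_trans n2. Qed.

(** Numbers out of range denote point 0, so that the metric axioms hold for [D] on all natural
    numbers. *)
Definition pt (v : nat) : 'I_n := insubd (Ordinal n_gt0) v.
Definition D (u v : nat) : rat := dist (pt u) (pt v).
Definition R (v : nat) : rat := rad (pt v).

Lemma pt_val v : (v < n)%N -> pt v = v :> nat.
Proof. by move=> vn; rewrite /pt val_insubd vn. Qed.

Lemma pt_ord (v : 'I_n) : pt v = v.
Proof. by apply: val_inj; rewrite /= pt_val. Qed.

Lemma R_gt0 v : 0 < R v. Proof. exact: rad_gt0. Qed.
Lemma D_self v : D v v = 0. Proof. exact/dist_eq0. Qed.

Local Notation inp := (inp_of I).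
Local Notation ev := (ev inp).
Local Notation den := (den inp).

Definition input_ok (s : state) := forall i, (i < input_end n)%N -> s vIN i = inp i.

Lemma ev_n s : input_ok s -> ev s en = n%:Z.
Proof. by move=> ok; rewrite /en evA evL ok. Qed.

Lemma ev_k s : input_ok s -> ev s ek = (ncenters I)%:Z.
Proof. by move=> ok; rewrite /ek evA evL ok. Qed.

Lemma ev_m s : input_ok s -> ev s em = (ncovered I)%:Z.
Proof. by move=> ok; rewrite /em evA evL ok. Qed.

Lemma ev_erad s e (v j : nat) : input_ok s -> ev s e = v%:Z -> (v < n)%N -> (j < 2)%N ->
  ev s (erad e j) = nth 0 (encode_rat (R v)) j.
Proof.
move=> ok ve vn j2; rewrite /erad evA !evB ve !evL /op_sem -!PoszM -!PoszD absz_nat.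
rewrite ok; last by rewrite /input_end; nia.
by rewrite -{1}(pt_val vn) inp_of_rad.
Qed.

Lemma ev_edist s e1 e2 (u v j : nat) : input_ok s -> ev s e1 = u%:Z -> ev s e2 = v%:Z ->
  (u < n)%N -> (v < n)%N -> (j < 2)%N ->
  ev s (edist e1 e2 j) = nth 0 (encode_rat (D u v)) j.
Proof.
move=> ok ue ve un vn j2; rewrite /edist evA !evB ue ve (ev_n ok) !evL /op_sem.
rewrite -!PoszM -!PoszD absz_nat.
rewrite ok; last by rewrite /input_end; nia.
by rewrite -{1}(pt_val un) -{1}(pt_val vn) inp_of_dist.
Qed.

Lemma rat_prod_le (p1 p2 p3 p4 : rat) (rho : int) :
  (numq p1 * numq p2 * (denq p3 * denq p4)
     <= rho * (numq p3 * numq p4 * (denq p1 * denq p2))) =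
  (p1 * p2 <= rho%:~R * (p3 * p4)).
Proof.
have pos : 0 < (denq p1)%:~R * (denq p2)%:~R * ((denq p3)%:~R * (denq p4)%:~R) :> rat.
  by rewrite !mulr_gt0 ?ltr0z ?denq_gt0.
rewrite -(ler_int rat) !intrM !numqE -[RHS](ler_pM2r pos).
by congr (_ <= _); ring.
Qed.

Lemma ev_edist_le s rho e1 e2 e3 e4 e5 e6 (u v x u' v' y : nat) :
  input_ok s -> ev s e1 = u%:Z -> ev s e2 = v%:Z -> ev s e3 = x%:Z ->
  ev s e4 = u'%:Z -> ev s e5 = v'%:Z -> ev s e6 = y%:Z ->
  [&& u < n, v < n, x < n, u' < n, v' < n & y < n]%N ->
  ev s (edist_le rho e1 e2 e3 e4 e5 e6) =
  (D u v * R x <= rho%:~R * (D u' v' * R y))%R%:Z.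
Proof.
move=> ok h1 h2 h3 h4 h5 h6 /and5P[un vn xn u'n /andP[v'n yn]].
rewrite /edist_le evB op_leq !evB evL.
rewrite !(ev_edist ok h1 h2 un vn) // !(ev_edist ok h4 h5 u'n v'n) //.
rewrite !(ev_erad ok h3 xn) // !(ev_erad ok h6 yn) //.
by rewrite /= rat_prod_le.
Qed.

Lemma ev_erad_le s e1 e2 (v w : nat) :
  input_ok s -> ev s e1 = v%:Z -> ev s e2 = w%:Z -> (v < n)%N -> (w < n)%N ->
  ev s (erad_le e1 e2) = (R v <= R w)%R%:Z.
Proof.
move=> ok h1 h2 vn wn; rewrite /erad_le evB op_leq !evB.
rewrite !(ev_erad ok h1 vn) // !(ev_erad ok h2 wn) //=.
have := rat_prod_le (R v) 1 (R w) 1 1; rewrite !mulr1 !mul1r => <-.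
by [].
Qed.

(** * The subprograms for a single guess *)

Section Guess.
Variables a b : nat.
Hypothesis an : (a < n)%N.
Hypothesis bn : (b < n)%N.

Definition alpha : rat := D a b / R b.
Local Notation cov := (covers D R alpha).

Definition guess_ok (s : state) := [/\ input_ok s, s vA 0%N = a%:Z & s vB 0%N = b%:Z].

Lemma guess_agree l s s' : vIN \notin l -> vA \notin l -> vB \notin l ->
  agree l s s' -> guess_ok s -> guess_ok s'.
Proof.
move=> h1 h2 h3 ag [ok ea eb]; split; rewrite ?ag // => i iI.
by rewrite ag // ok.
Qed.

Lemma alphaE (x y : rat) (rho : int) :
  (x * R b <= rho%:~R * (D a b * y)) = (x <= rho%:~R * (alpha * y)).
Proof.
have Rb := R_gt0 b; rewrite /alpha -ler_pdivlMr // [in RHS]mulrAC.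
by rewrite [in RHS]mulrA.
Qed.

Lemma guess_den c s : vIN \notin writes c -> vA \notin writes c -> vB \notin writes c ->
  guess_ok s -> guess_ok (den c s).
Proof. by move=> h1 h2 h3; apply: guess_agree h1 h2 h3 (@agree_den inp c s). Qed.

Definition cov_ok (C : nat -> int) :=
  forall u v, (u < n)%N -> (v < n)%N -> C (u * n + v)%N = (cov u v)%:Z.

Definition mat (A : nat -> int) (u v : nat) : nat := `|A (u * n + v)%N|%N.

Definition fu_ok (FU : nat -> int) :=
  forall v w, (v < n)%N -> (w < n)%N ->
    [/\ FU (v * n + w)%N = (mat FU v w)%:Z, (mat FU v w < n)%N &
     forall u, (u < n)%N -> cov u v -> cov u w -> shares D R alpha (mat FU) v w].

Lemma loop1 d : (1 * `|inp 0%N| ^ d)%N = (n ^ d)%N.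
Proof. by rewrite mul1n. Qed.

Lemma ev_index s (e1 e2 e3 : aexp) (u v d : nat) :
  ev s e1 = u%:Z -> ev s e2 = v%:Z -> ev s e3 = d%:Z ->
  ev s (e1 * e3 + e2)%aexp = (u * d + v)%N%:Z.
Proof. by move=> h1 h2 h3; rewrite !evB h1 h2 h3 /= -PoszM -PoszD. Qed.

Lemma ev_var s x (i : nat) : s x 0%N = i%:Z -> ev s (Arr x (Lit 0)) = i%:Z.
Proof. by []. Qed.

Lemma ev_divmod s e1 e2 (i d : nat) : ev s e1 = i%:Z -> ev s e2 = d%:Z ->
  ev s (e1 %/ e2)%aexp = (i %/ d)%N%:Z /\ ev s (e1 %% e2)%aexp = (i %% d)%N%:Z.
Proof. by move=> h1 h2; rewrite !evB h1 h2 /= divz_nat modz_nat. Qed.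

Lemma p_cov_correct s : guess_ok s -> cov_ok (den p_cov s vC).
Proof.
move=> ok u v un vn.
have H := @map_correct inp vI vC 1 2 _ s (fun i z => z = (cov (i %/ n) (i %% n))%:Z).
have [ud vd] := index_divmod u vn.
rewrite (H _ isT _ (u * n + v)%N) ?ud ?vd ?loop1 -?mulnn ?index_lt //.
move=> s' i ag iN xi _.
have [ok' ea eb] : guess_ok s' by apply: guess_agree ag ok.
have [dv dm] := ev_divmod (ev_var xi) (ev_n ok').
have [i1 i2] := divmod_lt iN.
eexists; last exact: den_set_var xi.
rewrite (ev_edist_le _ ok' dv dm (ev_var eb) (ev_var ea) (ev_var eb) dm).
  by rewrite alphaE mul1r.
by rewrite i1 i2 an bn.
Qed.

Lemma ev_ecov s e1 e2 (u v : nat) : input_ok s -> cov_ok (s vC) ->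
  ev s e1 = u%:Z -> ev s e2 = v%:Z -> (u < n)%N -> (v < n)%N ->
  ev s (ecov e1 e2) = (cov u v)%:Z.
Proof.
move=> ok C h1 h2 un vn; rewrite /ecov evA (ev_index h1 h2 (ev_n ok)) absz_nat.
exact: C.
Qed.

Lemma p_fu_correct s : guess_ok s -> cov_ok (s vC) -> fu_ok (den p_fu s vFU).
Proof.
move=> ok C.
pose Q i z := exists f, [/\ z = f%:Z, (f < n)%N & forall u, (u < n)%N ->
  cov u (i %/ n) -> cov u (i %% n) -> cov f (i %/ n) && cov f (i %% n)].
suff H i : (i < 1 * `|inp 0%N| ^ 2)%N -> Q i (den p_fu s vFU i).
  move=> v w vn wn; have := H (v * n + w)%N.
  rewrite loop1 -mulnn => /(_ (index_lt vn wn)) [f [fe fn fmax]].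
  have mf : mat (den p_fu s vFU) v w = f by rewrite /mat fe.
  have [dv dm] := index_divmod v wn; rewrite dv dm in fmax.
  by rewrite mf fe; split=> // u un; rewrite /shares mf; apply: fmax.
move: i; apply: (@map_correct inp vI vFU 1 2 _ s Q) => // s' i ag iN xi _.
have [ok' ea eb] : guess_ok s' by apply: guess_agree ag ok.
have C' : s' vC = s vC by apply: ag.
have [dv dm] := ev_divmod (ev_var xi) (ev_n ok').
have {}iN : (i < n * n)%N by move: iN; rewrite mul1n mulnn.
have [i1 i2] := divmod_lt iN.
have [||f [fn fmax fe]] := @argmax_correct inp vJ vU 1 1
  (fun u => (ecov u ($vI %/ en) * ecov u ($vI %% en))%aexp) s'
  (fun u => (cov u (i %/ n) && cov u (i %% n))%:Z) isT.
- by rewrite loop1 expn1 n_gt0.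
- move=> s2 y j ag2 yJ jN yj; rewrite loop1 expn1 in jN.
  have ok2 : input_ok s2 by have [] : guess_ok s2 by apply: guess_agree ag2 _.
  have xi2 : s2 vI 0%N = i%:Z by rewrite ag2.
  have C2 : cov_ok (s2 vC) by rewrite ag2 // C'.
  have [dv2 dm2] := ev_divmod (ev_var xi2) (ev_n ok2).
  by rewrite evB (ev_ecov ok2 C2 (ev_var yj) dv2) // (ev_ecov ok2 C2 (ev_var yj) dm2) //= mulz_bool.
rewrite loop1 expn1 in fn fmax.
exists f%:Z; last first.
  move=> j; rewrite denS (@den_set_var _ _ _ _ _ i) ?den_frame //.
  by rewrite evA evL fe.
exists f; split=> // u un c1 c2.
by have := fmax u un; rewrite c1 c2 /=; case: (_ && _).
Qed.

Lemma zero_correct A c d s : A != vI ->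
  forall i, (i < c * n ^ d)%N ->
  den (CFor vI c d (CSet A (Arr vI (Lit 0)) (Lit (Posz 0)))) s A i = 0.
Proof.
move=> AI; apply: (@map_correct inp vI A c d _ s (fun _ z => z = 0)) => // s' i _ _ xi _.
by exists 0 => // j; rewrite (@den_set_var _ _ _ _ _ _ xi).
Qed.

(** No set of points has more than [n] elements, so the cap loses no solution; it provides the bound
    [k <= n] that the perceptron and the [n] available sources rely on. *)
Definition kk : nat := minn n (ncenters I).
Local Notation m := (ncovered I).

Lemma kk_le : (kk <= n)%N. Proof. exact: geq_minl. Qed.

Lemma loop_n : (1 * `|inp 0%N| ^ 1)%N = n.
Proof. by rewrite loop1 expn1. Qed.

Lemma percep_init_correct s : guess_ok s ->
  let s' := den p_percep_init s in
  perceptron_inv n kk m cov 0 (s' vW) (s' vWW 0%N) (s' vX) (fun _ => 0) /\ s' vK 0%N = kk%:Z.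
Proof.
move=> ok s'; rewrite {}/s' /p_percep_init 3!denS.
set c1 := CFor _ _ _ (CSet vW _ _); set c2 := CFor _ _ _ (CSet vX _ _).
set c3 := CSet vWW _ _; set c4 := CIf _ _ _.
set s1 := den c1 s; set s2 := den c2 s1; set s3 := den c3 s2.
have W0 v : (v < n)%N -> den c4 s3 vW v = 0.
  move=> vn; rewrite den_frame // /s3 den_frame // /s2 den_frame //.
  by apply: zero_correct => //; rewrite loop_n.
have X0 v : (v < n)%N -> den c4 s3 vX v = 0.
  move=> vn; rewrite den_frame // /s3 den_frame //.
  by apply: zero_correct => //; rewrite loop_n.
have WW0 : den c4 s3 vWW 0%N = 0 by rewrite den_frame.
split.
  split; split; rewrite ?WW0 //.
  - by move=> v vn; rewrite W0.
  - by move=> v vn; rewrite X0.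
  - by rewrite big1 // => v _; rewrite X0.
  - by rewrite big1 ?expr0n // => v _; rewrite W0.
  - move=> v vn; rewrite W0 // sub0r oppr_le0 mulr_ge0 //.
    by apply: sumr_ge0 => u _; rewrite X0 // mulr0.
  - by rewrite mul0n sub0r big1 // oppr0.
have ok3 : guess_ok s3.
  by do 3!apply: guess_den => //.
have [ok3' _ _] := ok3.
rewrite /c4 -[den _ _]/(if ev s3 (en <= ek)%aexp != 0
  then den (vK ::= en)%cmd s3 else den (vK ::= ek)%cmd s3).
rewrite evB op_leq (ev_n ok3') (ev_k ok3').
rewrite /kk; case: lerP => h /=.
  by rewrite -[LHS]/(ev s3 en) ev_n //; lia.
by rewrite -[LHS]/(ev s3 ek) ev_k //; lia.
Qed.

Lemma percep_step_correct s : guess_ok s -> cov_ok (s vC) -> s vK 0%N = kk%:Z ->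
  let s' := den p_percep_step s in
  perceptron_step n kk m cov (s vW) (s vWW 0%N) (s vX) (s' vW) (s' vWW 0%N) (s' vX).
Proof.
move=> ok C K s'; rewrite {}/s' /p_percep_step 5!denS.
set c1 := CFor _ _ _ (CSeq _ _); set c2 := argmax _ _ _ _ _.
set c3 := CSet vX _ _; set c4 := sumcmd _ _ _ _ _.
set c5 := CFor _ _ _ _; set c6 := CSet vWW _ _.
set s1 := den c1 s; set s2 := den c2 s1; set s3 := den c3 s2.
set s4 := den c4 s3; set s5 := den c5 s4.
have SM i : (i < n)%N -> s1 vSM i = score n cov (s vW) i.
  rewrite -{1}loop_n; move: i; apply: (@map_correct inp vI vSM 1 1 _ s
    (fun i z => z = score n cov (s vW) i)) => // s' i ag iN xi _.
  have [ok' ea eb] : guess_ok s' by apply: guess_agree ag ok.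
  rewrite loop_n in iN; eexists; last first.
    move=> j; rewrite denS (@den_set_var _ _ _ _ _ i) ?den_frame //.
  rewrite evA evL absz_nat.
  rewrite (@sumcmd_correct inp vJ vACC 1 1 _ s' (fun v => (cov i v)%:Z * s vW v)) //.
    by rewrite loop_n.
  move=> s2' v ag2 vN xv; rewrite loop_n in vN.
  have [ok2 _ _] : guess_ok s2' by apply: guess_agree ag2 _.
  have C2 : cov_ok (s2' vC) by rewrite ag2 // ag.
  have xi2 : s2' vI 0%N = i%:Z by rewrite ag2.
  rewrite evB /etruth evB op_leq evL (ev_ecov ok2 C2 (ev_var xi2) (ev_var xv)) // truth_bool.
  by rewrite evA (ev_var xv) absz_nat /= ag2 // ag.
have [||u [uN umax uE]] := @argmax_correct inp vI vU 1 1 (fun u => Arr vSM u) s1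
  (score n cov (s vW)) isT.
- by rewrite loop_n n_gt0.
- move=> s' y i ag yI iN yi; rewrite evA (ev_var yi) absz_nat ag // SM //.
  by rewrite loop_n in iN.
rewrite loop_n in uN umax.
have g3 : guess_ok s3 by do 3!apply: guess_den => //.
have g4 : guess_ok s4 by apply: guess_den.
have g5 : guess_ok s5 by apply: guess_den.
have fr A : A \notin writes c1 -> A \notin writes c2 -> A \notin writes c3 ->
    s3 A = s A.
  by move=> h1 h2 h3; rewrite /s3 den_frame // /s2 den_frame // /s1 den_frame.
have fr4 A : A \notin writes c1 -> A \notin writes c2 -> A \notin writes c3 ->
    A \notin writes c4 -> s4 A = s A.
  by move=> *; rewrite /s4 den_frame // fr.
have ACC : s4 vACC 0%N = \sum_(v < n) (s vW v < s vWW 0%N)%R%:Z.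
  rewrite /s4 (@sumcmd_correct inp vI vACC 1 1 _ s3
    (fun v => (s vW v < s vWW 0%N)%R%:Z)) // ?loop_n //.
  move=> s' i ag iN xi.
  by rewrite evB op_leq evB !evA !evL !absz_nat xi absz_nat /= !ag // !fr // lezD1.
have U4 : s4 vU 0%N = u%:Z by rewrite /s4 den_frame // /s3 den_frame.
exists u; split=> //.
- move=> v vn; rewrite den_frame // /s5 den_frame // /s4 den_frame //.
  have U2 : ev s2 (Arr vU (Lit 0)) = u%:Z by [].
  rewrite -[s3 vX v]/(if (v == `|ev s2 (Arr vU (Lit 0))|)%N then
     ev s2 (Arr vX (Arr vU (Lit 0)) + Lit 1)%aexp else s2 vX v).
  rewrite U2 absz_nat evB evA U2 absz_nat evL /= /s2 den_frame // /s1 den_frame //.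
  by case: eqP => [->|_] //=; rewrite addr0.
- move=> v vn; rewrite den_frame //.
  pose Q i z := z = Num.max 0 (s vW i + (s vW i < s vWW 0%N)%R%:Z - (cov u i)%:Z * kk%:Z).
  apply: (@map_correct inp vI vW 1 1 _ s4 Q) => //; last by rewrite loop_n.
  move=> s' i ag iN xi same; rewrite loop_n in iN.
  have [ok' _ _] : guess_ok s' by apply: guess_agree ag g4.
  have C' : cov_ok (s' vC) by rewrite ag // fr4.
  have U' : s' vU 0%N = u%:Z by rewrite ag.
  have W' : s' vW i = s vW i by rewrite same // fr4.
  eexists; last exact: den_set_var xi.
  set e := (_ + _ - _)%aexp.
  have eE : ev s' e = s vW i + (s vW i < s vWW 0%N)%R%:Z - (cov u i)%:Z * kk%:Z.
    rewrite /e evB evB [ev _ (_ * _)%aexp]evB /etruth !evB !op_leq !evL.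
    rewrite (ev_ecov ok' C' (ev_var U') (ev_var xi)) // truth_bool.
    rewrite !evA !evL !absz_nat xi absz_nat /= W' !ag // !fr4 // K.
    by rewrite lezD1.
  rewrite /Q /eclamp evB evB op_leq eE evL /= maxEle.
  by case: ifP; rewrite ?mul1r ?mul0r.
- have [ok5 _ _] := g5.
  rewrite -[LHS]/(ev s5 (eclamp (Arr vWW (Lit 0) + em - Arr vACC (Lit 0)))).
  rewrite /eclamp evB evB op_leq !evB (ev_m ok5) !evA !evL /=.
  rewrite /s5 !den_frame // ACC !fr4 // maxEle.
  by case: ifP; rewrite ?mul1r ?mul0r.
Qed.

Definition natv (A : nat -> int) (v : nat) : nat := `|A v|%N.
Definition nonneg (N : nat) (A : nat -> int) := forall v, (v < N)%N -> 0 <= A v.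

Lemma natvE N A v : nonneg N A -> (v < N)%N -> A v = (natv A v)%:Z.
Proof. by move=> h vN; rewrite /natv gez0_abs ?h. Qed.

Local Notation share FU := (shares D R alpha (mat FU)).

Lemma ev_share s e1 e2 (v w : nat) : input_ok s -> cov_ok (s vC) -> fu_ok (s vFU) ->
  ev s e1 = v%:Z -> ev s e2 = w%:Z -> (v < n)%N -> (w < n)%N ->
  ev s (eshare e1 e2) = (share (s vFU) v w)%:Z.
Proof.
move=> ok C F h1 h2 vn wn; have [fe fn _] := F v w vn wn.
have h3 : ev s (efu e1 e2) = (mat (s vFU) v w)%:Z.
  by rewrite /efu evA (ev_index h1 h2 (ev_n ok)) absz_nat.
rewrite /eshare evB (ev_ecov ok C h3 h1 fn vn) (ev_ecov ok C h3 h2 fn wn) /=.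
by rewrite mulz_bool.
Qed.

Lemma share_refl FU v : fu_ok FU -> (v < n)%N -> share FU v v.
Proof.
move=> F vn; have [_ _ h] := F v v vn vn; apply: (h v) => //;
by rewrite /covers D_self mulr_ge0 ?divr_ge0 // ?dist_ge0 // ltW // R_gt0.
Qed.

(** The entries for the two orders may be different points, but each one witnesses that a common
    center exists. *)
Lemma share_sym FU v w : fu_ok FU -> (v < n)%N -> (w < n)%N -> share FU v w = share FU w v.
Proof.
move=> F vn wn.
have [_ f1 h1] := F v w vn wn; have [_ f2 h2] := F w v wn vn.
apply/idP/idP => /andP[c1 c2]; first exact: h2 f1 c2 c1.
exact: h1 f2 c2 c1.
Qed.

Lemma p_load_correct s : guess_ok s -> cov_ok (s vC) ->
  (forall v, (v < n)%N -> den p_load s vXS v = load n cov (s vX) v) /\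
  (forall v, (v < n)%N -> den p_load s vPAR v = 0).
Proof.
move=> ok C; rewrite /p_load denS; split=> v vn; last first.
  by apply: zero_correct => //; rewrite loop_n.
rewrite den_frame //; move: vn; rewrite -{1}loop_n; move: v.
apply: (@map_correct inp vI vXS 1 1 _ s (fun i z => z = load n cov (s vX) i)) => // s' i ag iN xi _.
have [ok' ea eb] : guess_ok s' by apply: guess_agree ag ok.
rewrite loop_n in iN; eexists; last first.
  by move=> j; rewrite denS (@den_set_var _ _ _ _ _ i) ?den_frame.
rewrite evA evL absz_nat.
rewrite (@sumcmd_correct inp vJ vACC 1 1 _ s' (fun u => (cov u i)%:Z * s vX u)) //.
  by rewrite loop_n.
move=> s2' v ag2 vN xv; rewrite loop_n in vN.
have [ok2 _ _] : guess_ok s2' by apply: guess_agree ag2 _.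
have C2 : cov_ok (s2' vC) by rewrite ag2 // ag.
have xi2 : s2' vI 0%N = i%:Z by rewrite ag2.
rewrite evB /etruth evB op_leq evL (ev_ecov ok2 C2 (ev_var xv) (ev_var xi2)) // truth_bool.
by rewrite evA (ev_var xv) absz_nat /= ag2 // ag.
Qed.

Lemma p_cluster_correct s (sc : nat -> int) :
  guess_ok s -> cov_ok (s vC) -> fu_ok (s vFU) ->
  (forall v, (v < n)%N -> s vXS v = sc v) -> nonneg n sc -> nonneg n (s vPAR) ->
  let s' := den p_cluster_step s in
  nonneg n (s' vPAR) /\
  cluster_step n R (share (s vFU)) sc (natv (s vPAR)) (natv (s' vPAR)).
Proof.
move=> ok C F XSE XS0 PAR0 s'; rewrite {}/s' /p_cluster_step denS.
set c1 := argmax _ _ _ _ _; set c2 := CFor _ _ _ _; set s1 := den c1 s.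
pose f v := (natv (s vPAR) v == 0%N)%:Z * (sc v + 1).
have [||u [uN umax uE]] := @argmax_correct inp vI vU 1 1
  (fun v => ((Arr vPAR v <= #0) * (Arr vXS v + #1))%aexp) s f isT.
- by rewrite loop_n n_gt0.
- move=> s' y i ag yI iN yi; rewrite loop_n in iN.
  rewrite evB [ev _ (_ <= _)%aexp]evB op_leq [ev _ (_ + _)%aexp]evB.
  rewrite !evA !evL !absz_nat yi absz_nat !ag // /f /=.
  by rewrite XSE // (natvE PAR0 iN); congr (_%:Z * _); case: natv.
rewrite loop_n in uN umax; rewrite -/c1 -/s1 in uE.
have g1 : guess_ok s1 by apply: guess_den.
pose par' w := if [&& natv (s vPAR) w == 0%N, R w == R u & share (s vFU) u w] then u.+1
               else natv (s vPAR) w.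
have H w : (w < n)%N -> den c2 s1 vPAR w = (par' w)%:Z.
  rewrite -{1}loop_n; move: w.
  apply: (@map_correct inp vI vPAR 1 1 _ s1 (fun w z => z = (par' w)%:Z)) => // s' i ag iN xi same.
  rewrite loop_n in iN; have [ok' _ _] : guess_ok s' by apply: guess_agree ag g1.
  have C' : cov_ok (s' vC) by rewrite ag // /s1 den_frame.
  have FE : s' vFU = s vFU by rewrite ag // /s1 den_frame.
  have F' : fu_ok (s' vFU) by rewrite FE.
  have U' : s' vU 0%N = u%:Z by rewrite ag.
  have P' : s' vPAR i = (natv (s vPAR) i)%:Z.
    by rewrite same // /s1 den_frame // (natvE PAR0).
  eexists; last exact: den_set_var xi.
  rewrite evB [ev _ (_ * (_ + _))%aexp]evB /etruth [ev _ (Lit 1 <= _)%aexp]evB op_leq.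
  rewrite [ev _ (_ * (_ * _))%aexp]evB [ev _ (_ <= #0)%aexp]evB op_leq.
  rewrite [ev _ (_ * _ * _)%aexp]evB [ev _ (_ * _)%aexp]evB.
  rewrite (ev_erad_le ok' (ev_var xi) (ev_var U')) // (ev_erad_le ok' (ev_var U') (ev_var xi)) //.
  rewrite (ev_share ok' C' F' (ev_var U') (ev_var xi)) // FE.
  rewrite evB !evA !evL !absz_nat xi absz_nat U' P' /=.
  rewrite !mulz_bool truth_bool /par' lez_nat leqn0 [R i == R u]eq_le.
  by case: eqP => [->|_] /=; rewrite ?mul0r ?addr0 //; case: ifP => _;
     rewrite ?mul1r ?mul0r ?add0r -?PoszD ?addn1.
split=> [v vn|]; first by rewrite H.
exists u; split=> // [v vn v0|w wn]; last by rewrite {1}/natv H // absz_nat.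
have := umax v vn; rewrite /f v0 eqxx mul1r.
case: eqP => [u0|_] /=; first by rewrite mul1r lerD2r => h; split.
by rewrite mul0r; have := XS0 v vn; lia.
Qed.

Lemma p_weight_correct s : guess_ok s -> nonneg n (s vPAR) ->
  forall v, (v < n)%N -> den p_weight s vLAM v = weight n (natv (s vPAR)) v.
Proof.
move=> ok P0 v; rewrite -{1}loop_n; move: v.
apply: (@map_correct inp vI vLAM 1 1 _ s
  (fun v z => z = weight n (natv (s vPAR)) v)) => // s' i ag iN xi _.
rewrite loop_n in iN; eexists; last first.
  by move=> j; rewrite denS (@den_set_var _ _ _ _ _ i) ?den_frame.
rewrite evA evL absz_nat.
rewrite (@sumcmd_correct inp vJ vACC 1 1 _ s' (fun w => (natv (s vPAR) w == i.+1)%:Z)) //.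
  by rewrite loop_n.
move=> s2 w ag2 wN xw; rewrite loop_n in wN.
have xi2 : s2 vI 0%N = i%:Z by rewrite ag2.
have PE : s2 vPAR w = (natv (s vPAR) w)%:Z by rewrite ag2 // ag // (natvE P0).
rewrite evB ![ev _ (_ <= _)%aexp]evB !op_leq !evB !evA !evL !absz_nat xw absz_nat xi2 PE /=.
by rewrite mulz_bool -!PoszD addn1 !lez_nat eqn_leq.
Qed.

Local Notation desc FU := (descends D R alpha (mat FU)).

Lemma ev_nn s : input_ok s -> ev s enn = (n + n)%N%:Z.
Proof. by move=> ok; rewrite /enn evB (ev_n ok). Qed.

Lemma ev_desc s e1 e2 (v w : nat) : input_ok s -> cov_ok (s vC) -> fu_ok (s vFU) ->
  ev s e1 = v%:Z -> ev s e2 = w%:Z -> (v < n)%N -> (w < n)%N ->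
  ev s (edesc e1 e2) = (desc (s vFU) v w)%:Z.
Proof.
move=> ok C F h1 h2 vn wn; rewrite /edesc evB [ev _ (~~ _)%aexp]evB evL.
rewrite (ev_erad_le ok h1 h2) // (ev_share ok C F h1 h2) //= subz_bool mulz_bool.
by rewrite -ltNge.
Qed.

Lemma ev_allowed s e1 e2 (v w : nat) : input_ok s -> cov_ok (s vC) -> fu_ok (s vFU) ->
  s vK 0%N = kk%:Z ->
  ev s e1 = v%:Z -> ev s e2 = w%:Z -> (w < n)%N ->
  ev s (eallowed e1 e2) = (pack_allowed n kk (desc (s vFU)) v w)%:Z.
Proof.
move=> ok C F K h1 h2 wn; rewrite /eallowed evB.
rewrite [ev _ ((_ < en) * _)%aexp]evB [ev _ ((en <= _) * _)%aexp]evB.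
rewrite ![ev _ (_ <= _)%aexp]evB !op_leq [ev _ (en + _)%aexp]evB (ev_n ok).
rewrite ![ev _ (_ + #1)%aexp]evB h1 !evL [ev _ (Arr _ _)]evA evL absz_nat K.
rewrite /op_sem -!PoszD !addn1 !lez_nat /pack_allowed.
move: (ev s (edesc e1 e2)) (fun vn => ev_desc ok C F h1 h2 vn wn) => z zE.
case: ltnP => vn /=; last by rewrite mul0r mul1r add0r.
by rewrite mul0r addr0 mul1r zE.
Qed.

Lemma ev_off s e1 e2 (v w : nat) : input_ok s ->
  ev s e1 = v%:Z -> ev s e2 = w%:Z ->
  ev s (eoff e1 e2) = ((w < n)%N && (v != w))%:Z.
Proof.
move=> ok h1 h2; rewrite /eoff evB [ev _ (~~ _)%aexp]evB [ev _ (_ * _)%aexp]evB.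
rewrite ![ev _ (_ <= _)%aexp]evB !op_leq (ev_n ok) !evB h1 h2 !evL /=.
by rewrite mulz_bool subz_bool mulz_bool -PoszD addn1 !lez_nat -eqn_leq.
Qed.

Lemma p_benefit_correct s (lam : nat -> int) :
  guess_ok s -> cov_ok (s vC) -> fu_ok (s vFU) -> s vK 0%N = kk%:Z ->
  (forall v, (v < n)%N -> s vLAM v = lam v) ->
  forall v w, (v < n + n)%N -> (w < n + n)%N ->
  den p_benefit s vBEN (v * (n + n) + w)%N = pack_benefit n kk lam (desc (s vFU)) v w.
Proof.
move=> ok C F K L v w vn wn.
suff H i : (i < 4 * `|inp 0%N| ^ 2)%N -> den p_benefit s vBEN i =
    pack_benefit n kk lam (desc (s vFU)) (i %/ (n + n)) (i %% (n + n)).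
  have [dv dm] := index_divmod v wn.
  rewrite H ?dv ?dm //; apply: leq_trans (index_lt vn wn) _.
  by rewrite /= !expnS expn0; lia.
move: i; apply: (@map_correct inp vI vBEN 4 2 _ s (fun i z =>
  z = pack_benefit n kk lam (desc (s vFU)) (i %/ (n + n)) (i %% (n + n)))) => //.
move=> s' i ag iN xi _.
have [ok' ea eb] : guess_ok s' by apply: guess_agree ag ok.
have C' : cov_ok (s' vC) by rewrite ag.
have F' : fu_ok (s' vFU) by rewrite ag.
have K' : s' vK 0%N = kk%:Z by rewrite ag.
have {}iN : (i < (n + n) * (n + n))%N by move: iN; rewrite /= !expnS expn0; lia.
have [i1 i2] := divmod_lt iN.
have [dv dm] := ev_divmod (ev_var xi) (ev_nn ok').
eexists; last exact: den_set_var xi.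
rewrite evB ![ev _ (_ * _)%aexp]evB /etruth ![ev _ (Lit 1 <= _)%aexp]evB !op_leq !evL.
rewrite ![ev _ (eoff _ _ * _)%aexp]evB (ev_off ok' dv dm).
rewrite [ev _ (~~ _)%aexp]evB evL evA dm absz_nat [ev _ (en + _)%aexp]evB (ev_n ok').
move: (ev s' (eallowed _ _)) (ev_allowed ok' C' F' K' dv dm) => z zE.
rewrite /pack_benefit; case: ltnP => jn /=; last by rewrite !mul0r.
rewrite zE // subz_bool !ag // L // -PoszD addn1.
by case: eqP => _ /=; rewrite ?mul0r ?mul1r //; case: pack_allowed => /=;
  rewrite ?mul0r ?mul1r ?subr0 ?sub0r.
Qed.

Local Notation NN := (n + n)%N.

Lemma loop_nn : (2 * `|inp 0%N| ^ 1)%N = NN.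
Proof. by rewrite mul2n addnn expn1. Qed.

Lemma p_auction_init_correct s :
  let s' := den p_auction_init s in
  forall i, (i < NN)%N -> [/\ s' vP i = 0, s' vOWN i = 0 & s' vHAS i = 0].
Proof.
move=> s' i iN; rewrite {}/s' /p_auction_init 2!denS; rewrite -loop_nn in iN.
split.
- by rewrite den_frame // den_frame //; apply: zero_correct.
- by rewrite den_frame //; apply: zero_correct.
- exact: zero_correct.
Qed.

Definition bid_benefit (BEN : nat -> int) (i j : nat) : int :=
  (pack_scale n)%:Z * BEN (i * NN + j)%N.

Lemma denSet s A e1 e2 : den (CSet A e1 e2) s = upd s A `|ev s e1|%N (ev s e2).
Proof. by []. Qed.

Lemma denIf s e c1 c2 :
  den (CIf e c1 c2) s = if ev s e != 0 then den c1 s else den c2 s.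
Proof. by []. Qed.

Lemma den_ifT s e c1 c2 : ev s e != 0 -> den (CIf e c1 c2) s = den c1 s.
Proof. by rewrite denIf => ->. Qed.

Lemma den_ifF s e c1 c2 : ev s e = 0 -> den (CIf e c1 c2) s = den c2 s.
Proof. by rewrite denIf => ->. Qed.

Lemma p_bid_correct s (ben : nat -> nat -> int) : guess_ok s ->
  (forall i j, (i < NN)%N -> (j < NN)%N -> bid_benefit (s vBEN) i j = ben i j) ->
  nonneg NN (s vOWN) -> nonneg NN (s vHAS) ->
  let s' := den p_bid s in
  [/\ nonneg NN (s' vOWN), nonneg NN (s' vHAS) &
   auction_step NN ben (natv (s vOWN)) (natv (s vHAS)) (s vP)
         (natv (s' vOWN)) (natv (s' vHAS)) (s' vP)].
Proof.
move=> ok benE O0 H0 s'; rewrite {}/s' /p_bid denS.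
set c1 := argmax _ vBI _ _ _; set s1 := den c1 s.
have [||i [iN imax iE]] := @argmax_correct inp vI vBI 2 1
  (fun i => (Arr vHAS i <= #0)%aexp) s (fun i => (natv (s vHAS) i == 0%N)%:Z) isT.
- by rewrite loop_nn; have := n_gt0; lia.
- move=> s' y i ag yI iN yi; rewrite loop_nn in iN.
  rewrite evB op_leq !evA !evL !absz_nat yi absz_nat ag // (natvE H0 iN).
  by rewrite lez_nat leqn0.
rewrite loop_nn in iN imax; rewrite -/c1 -/s1 in iE.
have g1 : guess_ok s1 by apply: guess_den.
have iE' : ev s1 (Arr vBI (Lit 0)) = i%:Z by [].
have pick i' : (i' < NN)%N -> natv (s vHAS) i' = 0%N -> natv (s vHAS) i = 0%N.
  by move=> iN' e; have := imax i' iN'; rewrite e eqxx; case: eqP.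
have HE : s1 vHAS = s vHAS by rewrite /s1 den_frame.
have OE : s1 vOWN = s vOWN by rewrite /s1 den_frame.
have cE : ev s1 (Arr vHAS (Arr vBI (Lit 0)) <= #0)%aexp = (natv (s vHAS) i == 0%N)%:Z.
  by rewrite evB op_leq evA iE' absz_nat HE evL (natvE H0 iN) lez_nat leqn0.
have [hi|hi] := eqVneq (natv (s vHAS) i) 0%N; last first.
  rewrite den_ifF; last by rewrite cE (negbTE hi).
  rewrite -[den CSkip s1]/s1 HE OE; split=> //; exists i; split=> //.
  by rewrite (negbTE hi); split=> // l lN; rewrite /s1 den_frame.
rewrite den_ifT; last by rewrite cE hi.
rewrite 4!denS.
set c2 := argmax _ vBJ _ _ _; set c3 := CIf _ _ _; set s2 := den c2 s1.
have [||j [jN jmax jE]] := @argmax_correct inp vI vBJ 2 1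
  (fun j => ((enn + #1) * Arr vBEN (Arr vBI (Lit 0) * enn + j) - Arr vP j)%aexp) s1
  (fun j => ben i j - s vP j) isT.
- by rewrite loop_nn; have := n_gt0; lia.
- move=> s' y l ag yI lN yl; rewrite loop_nn in lN.
  have [ok' _ _] : guess_ok s' by apply: guess_agree ag g1.
  have B' : ev s' (Arr vBI (Lit 0)) = i%:Z by rewrite evA evL absz_nat ag.
  rewrite evB [ev _ (_ * Arr _ _)%aexp]evB [ev _ (enn + _)%aexp]evB (ev_nn ok') evL.
  rewrite [ev _ (Arr vBEN _)]evA (ev_index B' (ev_var yl) (ev_nn ok')) absz_nat.
  rewrite evA (ev_var yl) absz_nat !ag // /s1 !den_frame //.
  by rewrite -benE // /bid_benefit /pack_scale /= -PoszD addn1.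
rewrite loop_nn in jN jmax; rewrite -/c2 -/s2 in jE.
set s3 := den c3 s2.
have fr A : A \notin writes c1 -> A \notin writes c2 -> A \notin writes c3 ->
    s3 A = s A.
  by move=> h1 h2 h3; rewrite /s3 den_frame // /s2 den_frame // /s1 den_frame.
have j2 : ev s2 (Arr vBJ (Lit 0)) = j%:Z by [].
have O2 : s2 vOWN j = (natv (s vOWN) j)%:Z.
  by rewrite /s2 den_frame // OE (natvE O0).
have H3 l : s3 vHAS l = if natv (s vOWN) j == l.+1 then 0 else s vHAS l.
  rewrite /s3 /c3 denIf evB op_leq evA j2 absz_nat O2 evL lez_nat.
  have H2 : s2 vHAS = s vHAS by rewrite /s2 den_frame.
  case: (natv (s vOWN) j) O2 => [|o] O2 /=; first by rewrite H2.
  rewrite /upd eqxx /= H2.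
  rewrite -[s2 vBJ 0%N]/(ev s2 (Arr vBJ (Lit 0))) j2 absz_nat O2.
  rewrite (_ : o.+1%:Z - 1 = o%:Z) ?absz_nat; last by lia.
  by rewrite eqSS [l == o]eq_sym.
have i3 : ev s3 (Arr vBI (Lit 0)) = i%:Z.
  by rewrite evA evL absz_nat /s3 den_frame // /s2 den_frame.
have j3 : ev s3 (Arr vBJ (Lit 0)) = j%:Z.
  by rewrite evA evL absz_nat /s3 den_frame.
rewrite [den (CSet vOWN _ _) _]denSet.
rewrite [ev _ (_ + #1)%aexp]evB i3 j3 absz_nat evL [op_sem _ _ _]/= -PoszD addn1.
set s4 := upd _ _ _ _.
have i4 : ev s4 (Arr vBI (Lit 0)) = i%:Z by [].
have j4 : ev s4 (Arr vBJ (Lit 0)) = j%:Z by [].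
rewrite [den (CSet vHAS _ _) _]denSet [ev _ (_ + #1)%aexp]evB i4 j4 absz_nat evL.
rewrite [op_sem _ _ _]/= -PoszD addn1.
set s5 := upd _ _ _ _.
have j5 : ev s5 (Arr vBJ (Lit 0)) = j%:Z by [].
rewrite denSet j5 absz_nat evB evA j5 absz_nat evL [op_sem _ _ _]/=.
set s6 := upd _ _ _ _.
have O6 l : s6 vOWN l = if l == j then i.+1%:Z else s vOWN l.
  rewrite /s6 upd_neq // /s5 upd_neq // /s4 /upd eqxx /=.
  by case: eqP => // _; rewrite fr.
have H6 l : s6 vHAS l = if l == i then j.+1%:Z else
    if natv (s vOWN) j == l.+1 then 0 else s vHAS l.
  rewrite /s6 upd_neq // /s5 /upd eqxx /=.
  by case: eqP => // _; rewrite -H3.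
have P6 l : s6 vP l = s vP l + (l == j)%:Z.
  have P5 : s5 vP = s vP by rewrite /s5 upd_neq // /s4 upd_neq // fr.
  by rewrite /s6 /upd eqxx /= P5; case: eqP => [->|_] //=; rewrite addr0.
split.
- by move=> l lN; rewrite O6; case: eqP => // _; apply: O0.
- by move=> l lN; rewrite H6; case: eqP => // _; case: eqP => // _; apply: H0.
exists i; split=> //; rewrite hi eqxx.
exists j; split=> // l lN; rewrite /natv ?O6 ?H6 ?P6 //.
  by case: eqP.
by case: eqP => // _; rewrite -/(natv (s vOWN) j); case: eqP.
Qed.

Definition selected (A : nat -> int) : {set 'I_n} := [set v : 'I_n | A v != 0].

Definition bit (N : nat) (A : nat -> int) := forall v, (v < N)%N -> A v = 0 \/ A v = 1.

(** That the entries are bits holds at every guess, which lets [p_check] count centers by a sum;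
    that they describe [solution] requires a complete assignment. *)
Lemma p_centers_correct s : guess_ok s -> fu_ok (s vFU) ->
  nonneg NN (s vOWN) -> nonneg NN (s vHAS) ->
  let s' := den p_centers s in
  bit n (s' vSOL) /\
  ((forall v, (v < NN)%N -> (0 < natv (s vOWN) v)%N) ->
   selected (s' vSOL) =
     solution n (mat (s vFU)) (natv (s vOWN)) (natv (s vHAS))).
Proof.
move=> ok F O0 H0 s'; rewrite {}/s' /p_centers denS.
set c1 := CFor _ _ _ (CSet _ _ _); set s1 := den c1 s.
have S0 u : (u < n)%N -> s1 vSOL u = 0.
  by move=> un; apply: zero_correct => //; rewrite loop_n.
have g1 : guess_ok s1 by apply: guess_den.
set e := (_ * efu _ _ + _)%aexp; set c2 := CIf _ _ _.
pose own := natv (s vOWN); pose has := natv (s vHAS).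
pose J i (s' : state) := [/\ agree (vI :: writes c2) s1 s', bit n (s' vSOL) &
  (forall v, (v < NN)%N -> (0 < own v)%N) -> forall u, (u < n)%N ->
   (s' vSOL u != 0) = [exists v : 'I_n, [&& v < i, n < has v &
      center n (mat (s vFU)) own v == u]]%N].
suff [_ B E] : J n (den (CFor vI 1 1 c2) s1).
  split=> // full; apply/setP => u; rewrite /solution !inE E //.
  by apply: eq_existsb => v; rewrite ltn_ord.
rewrite -{1}loop_n; apply: (@forloop_inv vI _ (den c2) J).
- split.
  + by move=> A; rewrite inE negb_or => /andP[h _]; rewrite upd_neq.
  + by move=> u un; left; rewrite upd_neq // S0.
  + move=> _ u un; rewrite upd_neq // S0 // eqxx.
    by apply/esym/negbTE/negP => /existsP[v].
move=> i s' iN xi [ag B E]; rewrite loop_n in iN.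
have [ok' _ _] : guess_ok s' by apply: guess_agree ag g1.
have iNN : (i < NN)%N by lia.
have H' : s' vHAS i = (has i)%:Z.
  by rewrite ag // /s1 den_frame // (natvE H0).
have O' : s' vOWN i = (own i)%:Z.
  by rewrite ag // /s1 den_frame // (natvE O0).
have FE : s' vFU = s vFU by rewrite ag // /s1 den_frame.
have exS (p : pred 'I_n) : [exists v : 'I_n, (v < i.+1)%N && p v] =
    [exists v : 'I_n, (v < i)%N && p v] || p (Ordinal iN).
  apply/existsP/orP => [[v /andP[vi pv]]|[/existsP[v /andP[vi pv]]|pv]].
  - have [vi'|vi'] := eqVneq (v : nat) i.
      by right; rewrite (_ : Ordinal iN = v) //; apply: val_inj.
    by left; apply/existsP; exists v; rewrite pv andbT; lia.
  - by exists v; rewrite pv andbT; lia.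
  - by exists (Ordinal iN); rewrite pv /= ltnSn.
have frame : agree (vI :: writes c2) s1 (upd (den c2 s') vI 0 i.+1%:Z).
  move=> A al; move: (al); rewrite inE negb_or => /andP[h1 h2].
  by rewrite upd_neq // den_frame // ag.
have cE : ev s' (en < Arr vHAS (Arr vI (Lit 0)))%aexp = (n < has i)%N%:Z.
  rewrite evB op_leq evB (ev_n ok') evA (ev_var xi) absz_nat H' evL /op_sem.
  by rewrite -PoszD addn1 lez_nat.
have [hi|hi] := ltnP n (has i); last first.
  have c2E : den c2 s' = s' by rewrite /c2 den_ifF // cE ltnNge hi.
  rewrite c2E in frame *; split=> //.
  move=> full u un; rewrite upd_neq // E // exS /=.
  by rewrite [(n < has i)%N]ltnNge hi /= orbF.
have c2E : den c2 s' = upd s' vSOL `|ev s' e|%N 1.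
  by rewrite /c2 den_ifT // cE hi.
rewrite c2E in frame *; split=> //.
  move=> u un; rewrite upd_neq // /upd eqxx /=; case: eqP => _; first by right.
  exact: B.
move=> full u un.
have eE : `|ev s' e|%N = center n (mat (s vFU)) own i.
  have oi := full i iNN.
  rewrite /e evB [ev _ ((_ <= _) * _)%aexp]evB [ev _ ((en < _) * _)%aexp]evB.
  rewrite ![ev _ (_ <= _)%aexp]evB !op_leq [ev _ (en + _)%aexp]evB (ev_n ok').
  rewrite [ev _ (Arr vOWN _)]evA (ev_var xi) absz_nat O' evL /op_sem -PoszD addn1 !lez_nat.
  rewrite /center; have [oin|oin] := leqP (own i) n.
    have -> : ((own i).-1 < n)%N by lia.
    have p1 : ev s' (Arr vOWN (Arr vI (Lit 0)) - #1)%aexp = (own i).-1%:Z.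
      by rewrite evB evA (ev_var xi) absz_nat O' evL /op_sem; lia.
    rewrite /efu evA (ev_index p1 (ev_var xi) (ev_n ok')) absz_nat FE.
    have [|-> _ _] := F (own i).-1 i _ iN; first by lia.
    by rewrite mul1r mul0r addr0 absz_nat.
  have -> : ((own i).-1 < n)%N = false by lia.
  by rewrite mul0r mul1r add0r absz_nat.
rewrite upd_neq // /upd eqxx eE /= exS /= hi /=.
have [ue|ne] := eqVneq u (center n (mat (s vFU)) own i); first by rewrite orbT.
by rewrite orbF E.
Qed.

Lemma sum_bit A : bit n A -> \sum_(v < n) A v = #|selected A|%:Z.
Proof.
move=> B; rewrite -sumz_bool; apply: eq_bigr => v _.
by case: (B v (ltn_ord v)) => ->.
Qed.

Section Check.
Variable rho : int.

Definition served (S : {set 'I_n}) (al : rat) : {set 'I_n} :=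
  [set w : 'I_n | [exists u in S, D w u <= rho%:~R * (al * R w)]].

Definition good (S : {set 'I_n}) (al : rat) : bool :=
  (#|S| <= ncenters I)%N && (m <= #|served S al|)%N.

Definition better (x y : nat) : bool := D a b * R y < D x y * R b.

(** The test is exact for any candidate. An [argmax] over truth values decides whether some selected
    center serves a point: the value at the maximiser is the answer. *)
Lemma p_check_correct s (f x y : nat) : guess_ok s -> bit n (s vSOL) ->
  s vFND 0%N = f%:Z -> s vBA 0%N = x%:Z -> s vBB 0%N = y%:Z -> (x < n)%N -> (y < n)%N ->
  let s' := den (p_check rho) s in
  if good (selected (s vSOL)) alpha && ((f == 0%N) || better x y) then
    [/\ selected (s' vRES) = selected (s vSOL), s' vFND 0%N = 1, s' vBA 0%N = a%:Z &
        s' vBB 0%N = b%:Z]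
  else [/\ s' vRES = s vRES, s' vFND 0%N = f%:Z, s' vBA 0%N = x%:Z & s' vBB 0%N = y%:Z].
Proof.
move=> ok B fE xE yE xn yn s'; rewrite {}/s' /p_check 3!denS.
set c1 := sumcmd _ vSZ _ _ _; set c2 := CFor _ _ _ (CSeq (argmax _ _ _ _ _) _).
set c3 := sumcmd _ vCNT _ _ _.
set s1 := den c1 s; set s2 := den c2 s1; set s3 := den c3 s2.
have g1 : guess_ok s1 by apply: guess_den.
have g2 : guess_ok s2 by apply: guess_den.
have g3 : guess_ok s3 by apply: guess_den.
pose S := selected (s vSOL).
have SZ : s1 vSZ 0%N = #|S|%:Z.
  rewrite -sum_bit // /s1 (@sumcmd_correct inp vI vSZ 1 1 _ s (s vSOL)) // ?loop_n //.
  by move=> s' i ag iN xi; rewrite evA (ev_var xi) absz_nat ag.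
have Y v : (v < n)%N -> s2 vY v =
    [exists u in S, D v (u : 'I_n) <= rho%:~R * (alpha * R v)]%:Z.
  rewrite -{1}loop_n; move: v.
  apply: (@map_correct inp vI vY 1 1 _ s1 (fun v z => z = _)) => // s' i ag iN xi _.
  rewrite loop_n in iN.
  have g' : guess_ok s' by apply: guess_agree ag g1.
  have SE : s' vSOL = s vSOL by rewrite ag // /s1 den_frame.
  pose p u := (s vSOL u != 0) && (D i u <= rho%:~R * (alpha * R i)).
  have valE (s2' : state) e u : agree [:: vJ; vU] s' s2' -> ev s2' e = u%:Z -> (u < n)%N ->
      ev s2' (Arr vSOL e * edist_le rho (Arr vI (Lit 0)) e (Arr vB (Lit 0))
        (Arr vA (Lit 0)) (Arr vB (Lit 0)) (Arr vI (Lit 0)))%aexp = (p u)%:Z.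
    move=> ag2 ue un.
    have [ok2 ea eb] : guess_ok s2' by apply: guess_agree ag2 g'.
    have xi2 : s2' vI 0%N = i%:Z by rewrite ag2.
    rewrite evB (ev_edist_le _ ok2 (ev_var xi2) ue (ev_var eb) (ev_var ea) (ev_var eb)
      (ev_var xi2)); last first.
      by rewrite iN un an bn.
    rewrite evA ue absz_nat ag2 // SE alphaE /p /=.
    by case: (B u un) => -> /=; rewrite ?mul0r ?mul1r.
  have [||u [uN umax uE]] := @argmax_correct inp vJ vU 1 1
    (fun u => (Arr vSOL u * edist_le rho (Arr vI (Lit 0)) u (Arr vB (Lit 0))
        (Arr vA (Lit 0)) (Arr vB (Lit 0)) (Arr vI (Lit 0)))%aexp) s'
    (fun u => (p u)%:Z) isT.
  - by rewrite loop_n n_gt0.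
  - move=> s2' y' u ag2 yJ uN yu; rewrite loop_n in uN.
    exact: valE (ev_var yu) uN.
  rewrite loop_n in uN umax; eexists; last first.
    by move=> j; rewrite denS (@den_set_var _ _ _ _ _ i) ?den_frame.
  rewrite /etruth evB op_leq evL (@valE _ _ u) //; last first.
    move=> A hA; rewrite den_frame //; move: hA.
    by rewrite /= !inE => /norP[/negbTE-> /negbTE->].
  rewrite truth_bool; congr (nat_of_bool _)%:Z; apply/idP/existsP => [pu|[u' /andP[u'S h]]].
    exists (Ordinal uN); rewrite !inE /=; exact: pu.
  have := umax u' (ltn_ord u'); rewrite {1}/p h.
  by rewrite inE in u'S; rewrite u'S /=; case: (p u).
have CNT : s3 vCNT 0%N = #|served S alpha|%:Z.
  rewrite /s3 (@sumcmd_correct inp vI vCNT 1 1 _ s2 (s2 vY)) // ?loop_n; last first.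
    by move=> s' i ag iN xi; rewrite evA (ev_var xi) absz_nat ag.
  by rewrite -sumz_bool; apply: eq_bigr => v _; rewrite Y.
have SZ3 : s3 vSZ 0%N = #|S|%:Z by rewrite /s3 den_frame // /s2 den_frame.
have fr A : A \notin writes c1 -> A \notin writes c2 -> A \notin writes c3 -> s3 A = s A.
  by move=> h1 h2 h3; rewrite /s3 den_frame // /s2 den_frame // /s1 den_frame.
have [ok3 ea3 eb3] := g3.
set e := (_ * _)%aexp; set c4 := CSeq _ _.
have eE : (ev s3 e != 0) = good S alpha && ((f == 0%N) || better x y).
  rewrite /e evB [ev _ ((_ <= _) * _)%aexp]evB ![ev _ (_ <= _)%aexp]evB !op_leq.
  rewrite (ev_k ok3) (ev_m ok3) [ev _ (_ + _)%aexp]evB [ev _ (_ <= #0)%aexp]evB op_leq.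
  rewrite [ev _ (~~ _)%aexp]evB !evL.
  have x3 : s3 vBA 0%N = x%:Z by rewrite fr.
  have y3 : s3 vBB 0%N = y%:Z by rewrite fr.
  rewrite (ev_edist_le _ ok3 (ev_var x3) (ev_var y3) (ev_var eb3) (ev_var ea3)
    (ev_var eb3) (ev_var y3)); last first.
    by rewrite xn yn an bn.
  rewrite !evA !evL !absz_nat SZ3 CNT fr // fE !lez_nat leqn0 mul1r.
  rewrite /op_sem subz_bool mulz_bool -ltNge /good /better.
  by case: (_ && _) => //; case: (f == 0%N); case: (_ < _).
case: ifP => cond.
  rewrite den_ifT; last by rewrite eE.
  rewrite /c4 3!denS; split.
  - rewrite den_frame // den_frame // den_frame //; apply/setP => v; rewrite !inE.
    suff H w : (w < n)%N ->
        den (CFor vI 1 1 (CSet vRES (Arr vI (Lit 0)) (Arr vSOL (Arr vI (Lit 0))))) s3 vRES w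
        = s vSOL w by rewrite H.
    rewrite -{1}loop_n; move: w.
    apply: (@map_correct inp vI vRES 1 1 _ s3 (fun v z => z = s vSOL v)) => // s' i ag iN xi _.
    eexists; last exact: den_set_var xi.
    by rewrite evA (ev_var xi) absz_nat ag // fr.
  - by rewrite den_frame // den_frame // denSet.
  - rewrite den_frame // denSet.
    rewrite -[LHS]/(ev (den (CSet vFND (Lit 0) (Lit 1)) (den (CFor vI 1 1
      (CSet vRES (Arr vI (Lit 0)) (Arr vSOL (Arr vI (Lit 0))))) s3)) (Arr vA (Lit 0))).
    by rewrite evA evL den_frame // den_frame.
  - rewrite denSet -[LHS]/(den _ _ vB 0%N).
    by rewrite den_frame // den_frame // den_frame.
rewrite den_ifF; last by apply/eqP/negPn; rewrite eE cond.
by rewrite -[den CSkip s3]/s3 !fr.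
Qed.

End Check.

(** * Numbers of rounds, ranks of radii, and a whole guess *)

Lemma double_le_cube : ((n + n).+1 <= n ^ 3)%N.
Proof. by rewrite !expnS expn0; nia. Qed.

Lemma succ_le_square : (n.+1 <= n ^ 2)%N.
Proof. by rewrite !expnS expn0; nia. Qed.

(** With [2n + 1 <= n ^ 3] and [n + 1 <= n ^ 2] the left side is at most [n ^ 14], which explains
    the exponent 15 in [p_solve]. *)
Lemma percep_rounds : ((n + n).+1 ^ 2 * (n.+1 ^ 3 * n ^ 2) < n ^ 15)%N.
Proof.
apply: (@leq_ltn_trans ((n ^ 3) ^ 2 * ((n ^ 2) ^ 3 * n ^ 2))%N).
  apply: leq_mul; first by rewrite leq_exp2r ?double_le_cube.
  by apply: leq_mul => //; rewrite leq_exp2r ?succ_le_square.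
by rewrite -!expnM -!expnD ltn_exp2l.
Qed.

Lemma auction_rounds :
  NN%:Z * ((pack_scale n)%:Z * (pack_scale n)%:Z + 1) < (n ^ 15)%N%:Z.
Proof.
rewrite /pack_scale -PoszM -PoszD -PoszM ltz_nat.
apply: (@leq_ltn_trans (n ^ 3 * n ^ 7)%N); last by rewrite -expnD ltn_exp2l.
apply: leq_mul; first exact: ltnW double_le_cube.
apply: (@leq_trans (n ^ 3 * n ^ 3 + n ^ 3 * n ^ 3)%N).
  by apply: leq_add; [rewrite leq_mul ?double_le_cube|rewrite muln_gt0 expn_gt0 n_gt0].
by rewrite -expnD addnn -mul2n [leqRHS]expnS leq_mul.
Qed.

(** The height [h] of the rounding argument: with [t] distinct radii it takes values below [t]. *)
Definition rank (v : nat) : nat :=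
  count (fun x => x < R v) (undup (codom (@rad I))).

Lemma R_in v : R v \in undup (codom (@rad I)).
Proof. by rewrite mem_undup codom_f. Qed.

Lemma rank_lt v w : R w < R v -> (rank w < rank v)%N.
Proof.
move=> wv; rewrite /rank; have := R_in w; elim: (undup _) => //= x s IH.
rewrite inE => /orP[/eqP<-|/IH {}IH].
  rewrite ltxx wv add0n add1n ltnS; apply: sub_count => y /=.
  by move=> yw; apply: lt_trans wv.
rewrite -addnS leq_add //; case: (ltP x (R w)) => // xw.
by rewrite (lt_trans xw wv).
Qed.

Lemma rank_num_radii v : (rank v < num_radii I)%N.
Proof.
rewrite /rank /num_radii -(count_predC (fun x => x < R v)) -[X in (X < _)%N]addn0 ltn_add2l.
by rewrite -has_count; apply/hasP; exists (R v); rewrite ?R_in //= ltxx.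
Qed.

Lemma alpha_ge0 : 0 <= alpha.
Proof. by rewrite divr_ge0 ?dist_ge0 // ltW // R_gt0. Qed.

Lemma load_ge0 X v : nonneg n X -> 0 <= load n cov X v.
Proof. by move=> h; apply: sumr_ge0 => u _; rewrite mulr_ge0 ?h. Qed.

Lemma p_solve_correct s : guess_ok s -> num_radii I = t ->
  let s' := den p_solve s in
  bit n (s' vSOL) /\
  (feasible n kk m cov -> good (2 * t%:Z - 1) (selected (s' vSOL)) alpha).
Proof.
move=> ok tE s'; rewrite {}/s' /p_solve 10!denS.
set s1 := den p_cov s; set s2 := den p_fu s1; set s3 := den p_percep_init s2.
set c4 := CFor vIT 1 15 p_percep_step; set s4 := den c4 s3.
set s5 := den p_load s4; set c6 := CFor vIT 1 1 p_cluster_step; set s6 := den c6 s5.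
set s7 := den p_weight s6; set s8 := den p_benefit s7.
set s9 := den p_auction_init s8; set c10 := CFor vIT 1 15 p_bid.
set s10 := den c10 s9.
have g1 : guess_ok s1 by apply: guess_den.
have g2 : guess_ok s2 by apply: guess_den.
have g3 : guess_ok s3 by apply: guess_den.
have g4 : guess_ok s4 by apply: guess_den.
have g5 : guess_ok s5 by apply: guess_den.
have g6 : guess_ok s6 by apply: guess_den.
have g7 : guess_ok s7 by apply: guess_den.
have g8 : guess_ok s8 by apply: guess_den.
have g9 : guess_ok s9 by apply: guess_den.
have g10 : guess_ok s10 by apply: guess_den.
have C1 : cov_ok (s1 vC) := p_cov_correct ok.
have F2 : fu_ok (s2 vFU) := p_fu_correct g1 C1.
have C2 : s2 vC = s1 vC by apply: den_frame.
have C3 : s3 vC = s1 vC by rewrite -C2; apply: den_frame.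
have C4 : s4 vC = s1 vC by rewrite -C3; apply: den_frame.
have C5 : s5 vC = s1 vC by rewrite -C4; apply: den_frame.
have C6 : s6 vC = s1 vC by rewrite -C5; apply: den_frame.
have C7 : s7 vC = s1 vC by rewrite -C6; apply: den_frame.
have F5 : s5 vFU = s2 vFU.
  by rewrite /s5 den_frame // /s4 den_frame // /s3 den_frame.
have F7 : s7 vFU = s2 vFU by rewrite -F5 /s7 den_frame // /s6 den_frame.
have F10 : s10 vFU = s2 vFU.
  by rewrite -F7 /s10 den_frame // /s9 den_frame // /s8 den_frame.
have [pI0 K3] := percep_init_correct g2.
have K7 : s7 vK 0%N = kk%:Z.
  by rewrite -K3 /s7 den_frame // /s6 den_frame // /s5 den_frame // /s4 den_frame.
have C4' : cov_ok (s4 vC) by rewrite C4.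
have C5' : cov_ok (s5 vC) by rewrite C5.
have F5' : fu_ok (s5 vFU) by rewrite F5.
have C7' : cov_ok (s7 vC) by rewrite C7.
have F7' : fu_ok (s7 vFU) by rewrite F7.
have F10' : fu_ok (s10 vFU) by rewrite F10.
have [XS5 PAR5] := p_load_correct g4 C4'; rewrite -/s5 in XS5 PAR5.
have kn := kk_le.
pose par := natv (s6 vPAR); pose lam := weight n par.
pose ben i j := (pack_scale n)%:Z * pack_benefit n kk lam (desc (s2 vFU)) i j.
pose B : int := (pack_scale n)%:Z * (pack_scale n)%:Z + 1.
have fractional : feasible n kk m cov -> exists Y,
    perceptron_inv n kk m cov (n ^ 15) (s4 vW) (s4 vWW 0%N) (s4 vX) Y.
  move=> feas.
  pose J i (s' : state) := exists Y, perceptron_inv n kk m cov i (s' vW) (s' vWW 0%N) (s' vX) Y.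
  have -> : (n ^ 15 = 1 * `|inp 0%N| ^ 15)%N by rewrite mul1n.
  apply: (@iter_correct inp vIT 1 15 p_percep_step s3 J).
  - by move=> i sa sb ag [Y h]; exists Y; rewrite !ag.
  - by exists (fun _ => 0).
  move=> i s' ag [Y h]; eexists; apply: (perceptron_step_inv feas kn h).
  apply: percep_step_correct.
  - exact: guess_agree ag g3.
  - by rewrite ag // C3.
  - by rewrite ag.
have clustered : feasible n kk m cov ->
    nonneg n (s6 vPAR) /\ cluster_inv n R (share (s2 vFU)) (load n cov (s4 vX)) n par.
  move=> feas; have [Y [[_ _ X0 _] _]] := fractional feas.
  have sc0 : nonneg n (load n cov (s4 vX)) by move=> v _; apply: load_ge0.
  pose J i (s' : state) := nonneg n (s' vPAR) /\
    cluster_inv n R (share (s2 vFU)) (load n cov (s4 vX)) i (natv (s' vPAR)).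
  suff : J (1 * `|inp 0%N| ^ 1)%N s6 by rewrite loop_n.
  apply: (@iter_correct inp vIT 1 1 p_cluster_step s5 J).
  - by move=> i sa sb ag; rewrite /J ag.
  - split; first by move=> v vn; rewrite PAR5.
    have p0 v : (v < n)%N -> natv (s5 vPAR) v = 0%N by move=> vn; rewrite /natv PAR5.
    split=> [w wn|v w vn wn|v w vn wn|]; rewrite ?p0 //.
    by rewrite subn0 (leq_trans (max_card _)) // card_ord.
  move=> i s' ag [P0 h].
  have FE : s' vFU = s2 vFU by rewrite ag // F5.
  have g' : guess_ok s' by apply: guess_agree ag g5.
  have C' : cov_ok (s' vC) by rewrite ag.
  have F' : fu_ok (s' vFU) by rewrite FE.
  have XS' v : (v < n)%N -> s' vXS v = load n cov (s4 vX) v.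
    by move=> vn; rewrite ag // XS5.
  have [P1 st] := p_cluster_correct g' C' F' XS' sc0 P0.
  split=> //; rewrite FE in st; apply: cluster_step_inv h st.
    by move=> v vn; apply: share_refl.
  by move=> v w vn wn; apply: share_sym.
have init i : (i < NN)%N -> [/\ s9 vP i = 0, s9 vOWN i = 0 & s9 vHAS i = 0].
  exact: p_auction_init_correct.
(* This is needed at infeasible guesses too, so [p_bid_correct] is applied with whatever benefits
   the memory holds. *)
have [O10 H10] : nonneg NN (s10 vOWN) /\ nonneg NN (s10 vHAS).
  pose J (i : nat) (s' : state) := nonneg NN (s' vOWN) /\ nonneg NN (s' vHAS).
  apply: (@iter_correct inp vIT 1 15 p_bid s9 J).
  - by move=> i sa sb ag [h1 h2]; rewrite /J !ag.
  - by split=> i iN; have [_ e1 e2] := init i iN; rewrite ?e1 ?e2.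
  move=> i s' ag [h1 h2].
  have g' : guess_ok s' by apply: guess_agree ag g9.
  by have [] := @p_bid_correct s' (bid_benefit (s' vBEN)) g' (fun _ _ _ _ => erefl) h1 h2.
have auctioned : feasible n kk m cov ->
    auction_inv NN ben B (n ^ 15) (natv (s10 vOWN)) (natv (s10 vHAS)) (s10 vP).
  move=> feas; have [P6 rI] := clustered feas.
  have LAM v : (v < n)%N -> s7 vLAM v = lam v by apply: p_weight_correct.
  have lam0 v : 0 <= lam v by apply: weight_ge0.
  have lam_sum : \sum_(v < n) lam v <= n%:Z.
    have par1 w : (w < n)%N -> exists2 v, (v < n)%N & par w = v.+1.
      move=> wn; have [r1 _ _ _] := rI.
      by have [v [vn e] _] := r1 w wn (cluster_done rI wn); exists v.
    have := sum_weight (fun _ => 1) par1.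
    rewrite (eq_bigr (fun v : 'I_n => lam v)) => [->|v _]; last by rewrite mulr1.
    by rewrite sumr_const card_ord natz.
  pose J i (s' : state) := [/\ nonneg NN (s' vOWN), nonneg NN (s' vHAS) &
    auction_inv NN ben B i (natv (s' vOWN)) (natv (s' vHAS)) (s' vP)].
  suff [] : J (1 * `|inp 0%N| ^ 15)%N s10 by rewrite mul1n.
  apply: (@iter_correct inp vIT 1 15 p_bid s9 J).
  - by move=> i sa sb ag [h1 h2 h3]; rewrite /J !ag.
  - have own0 i : (i < NN)%N -> natv (s9 vOWN) i = 0%N.
      by move=> iN; have [_ e1 _] := init i iN; rewrite /natv e1.
    have has0 i : (i < NN)%N -> natv (s9 vHAS) i = 0%N.
      by move=> iN; have [_ _ e2] := init i iN; rewrite /natv e2.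
    split; [by move=> i iN; have [_ -> _] := init i iN
           |by move=> i iN; have [_ _ ->] := init i iN|split].
    + by split=> i iN; rewrite ?own0 ?has0.
    + by move=> i iN; have [-> _ _] := init i iN; rewrite /B; split; lia.
    + by move=> i j iN jN; rewrite has0.
    + by right; apply: sumr_ge0 => i _; have [-> _ _] := init i (ltn_ord i).
  move=> i s' ag [h1 h2 h3].
  have g' : guess_ok s' by apply: guess_agree ag g9.
  have benE v w : (v < NN)%N -> (w < NN)%N -> bid_benefit (s' vBEN) v w = ben v w.
    move=> vN wN; rewrite ag // /s9 den_frame // /bid_benefit.
    by rewrite /s8 (p_benefit_correct g7 C7' F7' K7 LAM) // F7.
  have [h1' h2' st] := p_bid_correct g' benE h1 h2.
  split=> //; apply: auction_step_inv h3 st => v w l _ _ _.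
  exact: pack_benefit_spread.
have [bitS solE] := p_centers_correct g10 F10' O10 H10.
split=> // feas.
have aI := auctioned feas; have [P6 rI] := clustered feas.
have [Y pI] := fractional feas.
have full i := auction_done auction_rounds aI (i := i).
have mo : matched NN (natv (s10 vOWN)) (natv (s10 vHAS)) by case: aI.
rewrite solE; last first.
  exact: own_full mo full.
rewrite F10.
have fu_lt v w : (v < n)%N -> (w < n)%N -> (mat (s2 vFU) v w < n)%N.
  by move=> vn wn; have [] := F2 v w vn wn.
have fu_sh u v w : (u < n)%N -> (v < n)%N -> (w < n)%N -> cov u v -> cov u w ->
    share (s2 vFU) v w.
  by move=> un vn wn; have [_ _ h] := F2 v w vn wn; apply: h.
have D_sym u v : D u v = D v u by apply: dist_sym.
have D_tri u v w : D u w <= D u v + D v w by apply: dist_triangle.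
have rank_t v : (rank v < t)%N by rewrite -tE rank_num_radii.
have rlt v w : (v < n)%N -> (w < n)%N -> R w < R v -> (rank w < rank v)%N.
  by move=> _ _; apply: rank_lt.
have [h1 h2] := approximation_core t2 kn alpha_ge0 D_self D_sym D_tri R_gt0 rlt rank_t
  fu_lt fu_sh percep_rounds pI rI auction_rounds aI.
rewrite /good (leq_trans h1 (geq_minr _ _)) /=.
apply: leq_trans h2 _; apply/subset_leq_card/subsetP => w; rewrite !inE => /existsP[u].
move=> /andP[uS h]; apply/existsP; exists u; rewrite uS /=.
by rewrite rmorphB rmorphM /= -pmulrn.
Qed.

End Guess.

(** * The search over all guesses *)

(** For [n >= 2] the loop of [p_input] reaches the whole input; indices past the end wrap around. *)
Lemma input_end_le : (input_end n <= 4 * `|inp 0%N| ^ 2)%N.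
Proof. by rewrite /input_end /= !expnS expn0; nia. Qed.

Lemma p_input_correct s : input_ok (den p_input s).
Proof.
move=> i iN; have := leq_trans iN input_end_le; move: iN; move: i.
suff H i : (i < 4 * `|inp 0%N| ^ 2)%N -> (i < input_end n)%N -> den p_input s vIN i = inp i.
  by move=> i iN /H; apply.
move: i; apply: (@map_correct inp vI vIN 4 2 _ s
  (fun i z => (i < input_end n)%N -> z = inp i)) => // s' i _ _ xi _.
eexists; last exact: den_set_var xi.
move=> iN; rewrite -[LHS]/(inp `|(ev s' (Arr vI (Lit 0)) %% (input_end n)%:Z)%Z|%N).
by rewrite (ev_var xi) modz_nat absz_nat modn_small.
Qed.

Definition ratio : int := 2 * t%:Z - 1.

Definition feasible_at (j : nat) : Prop :=
  feasible n kk (ncovered I) (covers D R (alpha (j %/ n) (j %% n))).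

(** The stored guess is only known to have passed the test; what counts is that it is at most every
    feasible guess seen so far. *)
Definition search_inv (i : nat) (s : state) : Prop :=
  input_ok s /\ exists f x y,
  [/\ s vFND 0%N = f%:Z, s vBA 0%N = x%:Z, s vBB 0%N = y%:Z, (x < n)%N & (y < n)%N] /\
  if f == 0%N then
    selected (s vRES) = set0 /\ forall j, (j < i)%N -> ~ feasible_at j
  else good ratio (selected (s vRES)) (alpha x y) /\
    forall j, (j < i)%N -> feasible_at j -> alpha x y <= alpha (j %/ n) (j %% n).

Lemma betterE a b x y : better a b x y = (alpha a b < alpha x y).
Proof.
have Ry := R_gt0 y; have Rb := R_gt0 b.
by rewrite /better /alpha ltr_pdivrMr // mulrAC ltr_pdivlMr.
Qed.

Lemma search_step i s : num_radii I = t -> (i < n * n)%N -> s vPQ 0%N = i%:Z ->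
  search_inv i s ->
  search_inv i.+1 (den (CSeq (CSet vA (Lit 0) (Bin ODiv (Arr vPQ (Lit 0)) en))
    (CSeq (CSet vB (Lit 0) (Bin OMod (Arr vPQ (Lit 0)) en))
      (CSeq p_solve (p_check ratio)))) s).
Proof.
move=> tE iN pq [ok [f [x [y [[fE xE yE xn yn] inv]]]]].
rewrite 3!denS.
set c1 := CSet vA _ _; set c2 := CSet vB _ _.
set s1 := den c1 s; set s2 := den c2 s1; set s3 := den p_solve s2.
have [an bn] := divmod_lt iN; set a := (i %/ n)%N in an *; set b := (i %% n)%N in bn *.
have ok1 : input_ok s1 by move=> j jN; rewrite /s1 den_frame // ok.
have ok2 : input_ok s2 by move=> j jN; rewrite /s2 den_frame // ok1.
have A1 : s1 vA 0%N = a%:Z.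
  rewrite -[LHS]/(ev s (Arr vPQ (Lit 0) %/ en)%aexp).
  by have [-> _] := ev_divmod (ev_var pq) (ev_n ok).
have B2 : s2 vB 0%N = b%:Z.
  rewrite -[LHS]/(ev s1 (Arr vPQ (Lit 0) %% en)%aexp).
  have pq1 : s1 vPQ 0%N = i%:Z by rewrite /s1 den_frame.
  by have [_ ->] := ev_divmod (ev_var pq1) (ev_n ok1).
have g2 : guess_ok a b s2 by split=> //; rewrite /s2 den_frame.
have [bitS solve] := p_solve_correct an bn g2 tE; rewrite -/s3 in bitS solve.
have g3 : guess_ok a b s3 by apply: guess_den.
have fr A : A \notin writes c1 -> A \notin writes c2 -> A \notin writes p_solve ->
    s3 A = s A.
  by move=> h1 h2 h3; rewrite /s3 den_frame // /s2 den_frame // /s1 den_frame.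
have f3 : s3 vFND 0%N = f%:Z by rewrite fr.
have x3 : s3 vBA 0%N = x%:Z by rewrite fr.
have y3 : s3 vBB 0%N = y%:Z by rewrite fr.
have := p_check_correct an bn ratio g3 bitS f3 x3 y3 xn yn.
cbv zeta; set s4 := den (p_check ratio) s3.
have ok4 : input_ok s4.
  by move=> j jN; rewrite /s4 den_frame //; case: g3 => ok3 _ _; rewrite ok3.
have feasE : feasible_at i -> good ratio (selected (s3 vSOL)) (alpha a b) by [].
case: ifP => [/andP[goodS bet] [resE f4 x4 y4]|cond [resE f4 x4 y4]].
  split=> //; exists 1%N, a, b; split; first by [].
  rewrite /= resE; split=> // j; rewrite ltnS leq_eqVlt => /orP[/eqP->//|ji] fj.
  move: inv bet; case: eqP => [_ [_ no] _|_ [_ le] /=].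
    by case: (no j ji).
  by rewrite betterE => /ltW lt; apply: le_trans lt (le j ji fj).
split=> //; exists f, x, y; split; first by [].
rewrite resE fr //; move: inv cond; case: eqP => [_ [res0 no]|_ [gd le]] /=.
  rewrite andbT => bad; split=> // j.
  rewrite ltnS leq_eqVlt => /orP[/eqP->|/no//] /feasE.
  by rewrite bad.
move=> bad; split=> // j; rewrite ltnS leq_eqVlt => /orP[/eqP->|/le//] /feasE gd'.
by move: bad; rewrite gd' /= betterE => /negbT; rewrite -leNgt.
Qed.

Lemma p_main_correct : num_radii I = t ->
  search_inv (n * n) (den (p_main ratio) init_state).
Proof.
move=> tE; rewrite /p_main denS.
set s1 := den p_input init_state.
rewrite mulnn -loop1.
have ok1 : input_ok s1 by apply: p_input_correct.
set body := CSeq _ _.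
apply: (@forloop_inv vPQ (1 * `|inp 0%N| ^ 2) (den body) search_inv s1).
- split; first by move=> i iN; rewrite upd_neq // ok1.
  exists 0%N, 0%N, 0%N; rewrite !upd_neq // /s1 !den_frame // n_gt0; split=> //.
- move=> i s' iN pq inv.
  have {}iN : (i < n * n)%N by move: iN; rewrite mul1n -mulnn.
  have [ok [f [x [y [[fE xE yE xn yn] h]]]]] := search_step tE iN pq inv.
  split; first by move=> j jN; rewrite upd_neq // ok.
  by exists f, x, y; rewrite !upd_neq.
Qed.

Lemma set_dist_le (v : 'I_n) (S : {set 'I_n}) (z : rat) :
  (set_dist v S <= z%:E)%E = [exists u in S, dist v u <= z].
Proof.
apply/idP/existsP => [h|[u /andP[uS h]]]; last first.
  by apply: (@bigmin_inf _ _ _ _ u) => //; rewrite lee_fin.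
case: (pickP (fun u => (u \in S) && (dist v u <= z))) => [u hu|no]; first by exists u.
move: h; rewrite leNgt => /negP[]; apply/bigmin_gtP; split; first exact: ltry.
by move=> u uS; rewrite lte_fin ltNge; have := no u; rewrite uS /= => ->.
Qed.

(** Assign to each covered point a center that serves it and lower [opt] to the largest ratio that
    occurs: the same set still covers the same points. *)
Lemma feasible_guess opt : optimum I opt ->
  exists2 j, (j < n * n)%N & feasible_at j /\ alpha (j %/ n) (j %% n) <= opt.
Proof.
move=> [[S [Sk [opt0 Sm]]] _].
have Skk : (#|S| <= kk)%N.
  by rewrite /kk leq_min Sk andbT (leq_trans (max_card _)) // card_ord.
(* The center is produced as data, so that the ratio [g] can be defined from it. *)
have near v : v \in covered S opt -> {u : 'I_n | u \in S & D u v <= opt * R v}.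
  rewrite inE set_dist_le => h.
  case: (pickP (fun u => (u \in S) && (dist v u <= opt * rad v))) => [u /andP[uS hu]|no].
    by exists u => //; rewrite /D /R !pt_ord dist_sym.
  by exfalso; move/existsP: h => [u]; rewrite no.
have conclude (u v : 'I_n) : alpha u v <= opt ->
    (forall w, w \in covered S opt -> [exists x in S, covers D R (alpha u v) (x : 'I_n) w]) ->
    exists2 j, (j < n * n)%N & feasible_at j /\ alpha (j %/ n) (j %% n) <= opt.
  move=> le h; have [dv dm] := index_divmod u (ltn_ord v).
  exists (u * n + v)%N; first exact: index_lt.
  rewrite /feasible_at dv dm; split=> //; exists S; split=> //.
  apply: leq_trans Sm _; apply/subset_leq_card/subsetP => w wC.
  by rewrite inE; apply: h.
have [C0|[v0 v0C]] := set_0Vmem (covered S opt).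
  apply: (conclude (pt 0) (pt 0)); first by rewrite /alpha D_self mul0r.
  by move=> w; rewrite C0 inE.
pose g (v : 'I_n) : rat :=
  if boolP (v \in covered S opt) is AltTrue h then alpha (s2val (near v h)) v else 0.
have gE v (h : v \in covered S opt) :
    exists2 u : 'I_n, u \in S & g v = alpha u v /\ alpha u v <= opt.
  rewrite /g; case: {-}_ / boolP => [h'|]; last by rewrite h.
  case: (near v h') => u uS hu; exists u => //; split=> //.
  by rewrite /alpha ler_pdivrMr ?R_gt0.
case: (arg_maxP (fun v : 'I_n => g v) v0C) => v vC vmax.
have [u uS [gv le]] := gE v vC.
apply: (conclude u v le) => w wC; have [x xS [gw _]] := gE w wC.
apply/existsP; exists x; rewrite xS /= /covers -gv.
have := vmax w wC; rewrite /= gw => h.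
by rewrite -ler_pdivrMr ?R_gt0.
Qed.

Lemma p_main_approx (mu : memory) : num_radii I = t ->
  (forall v, (v < n)%N -> mu v = den (p_main ratio) init_state vRES v) ->
  approx_solution (2 * t%:R - 1) (output I mu).
Proof.
move=> tE muE; have [_ [f [x [y [[_ _ _ xn yn] inv]]]]] := p_main_correct tE.
have -> : output I mu = selected (den (p_main ratio) init_state vRES).
  by apply/setP => v; rewrite !inE (muE v (ltn_ord v)).
(* If no guess passed, then there is no optimum by [feasible_guess], and the empty answer respects
   the bound on the centers. *)
move: inv; set S := selected _; case: eqP => [_ [S0 no]|_ [/andP[Sk Sm] le]].
  split; first by rewrite S0 cards0.
  by move=> opt /feasible_guess[j jn [fj _]]; case: (no j jn).
split=> // opt /feasible_guess[j jn [fj jle]].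
have rho0 : 0 <= 2 * t%:R - 1 :> rat by rewrite subr_ge0 -natrM ler1n; lia.
have rhoE : ratio%:~R = 2 * t%:R - 1 :> rat by rewrite rmorphB rmorphM /= -pmulrn.
exists ((2 * t%:R - 1) * alpha x y); split.
  split; first by rewrite mulr_ge0 ?alpha_ge0.
  apply: leq_trans Sm _; apply/subset_leq_card/subsetP => w; rewrite !inE set_dist_le.
  move=> /existsP[u /andP[uS h]]; apply/existsP; exists u; rewrite uS /=.
  by move: h; rewrite /D /R !pt_ord rhoE mulrA.
by rewrite ler_wpM2l // (le_trans (le j jn fj)).
Qed.

End Spec.

Unset Implicit Arguments.

Theorem theorem3p12 (t : nat) (ht : (2 <= t)%N) :
  exists c : program,
    polytime_approx (2 * t%:R - 1) (fun I : instance => num_radii I = t) c.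
Proof.
exists (with_output narrays vOUT vRES (compile narrays (p_main (ratio t)))).
have [p pP] := with_output_correct (p_main_wf (ratio t)) (isT : vOUT < narrays)%N
  (isT : vRES < narrays)%N (isT : vRES != vOUT).
exists p => I tE.
(* Two distinct radii need two points; the bounds by powers of [n] rest on this. *)
have n2 : (2 <= npts I)%N.
  apply: leq_trans ht _; rewrite -tE /num_radii.
  by apply: leq_trans (size_undup _) _; rewrite size_codom card_ord.
have [T [mu [ex Tp out]]] := pP I (ltnW n2).
exists T, mu; split=> //.
exact: (p_main_approx ht n2 tE out).
Qed.
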